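(* Let $\varpi=(q,t)$ be a singular parameter with $q^mt^n=1$, $m\ge 1$, $2\le n\le N$ (see context), and let $p$ be a non-constant homogeneous polynomial in $x_1,\dots,x_N$ which is singular at $\varpi$. Let $\tau$ be the isotype of any irreducible $\mathcal H_N(t)$-submodule of $\mathcal H_N(t)p$. Then there is an integer $L\ge 1$ and there are integers $d_1\ge d_2\ge\dots\ge d_L\ge 1$ and $0\le r_{L+1}\le nd_L-1$ with $\tau=(nd_1-1,nd_2-1,\dots,nd_L-1,r_{L+1})$, and in any such expression of $\tau$ one has $d_i=1$ for all $2\le i\le L$. Thus $$\tau=(nd-1,\underbrace{n-1,\dots,n-1}_{L-1},r)$$ for some integers $d\ge 1$, $L\ge 1$, $r\ge 0$; singular polynomials of other isotypes do not exist.
   Context: Singular parameters: let $m\ge1$, $2\le n\le N$ be integers, $g=\gcd(m,n)$, $z=\exp(2\pi \mathrm i k/m)$ with $\gcd(k,g)=1$ (and $z=1$ if $g=1$), and let $u\neq 0$ be a complex number which is not a root of unity. Then $\varpi:=(q,t)=(zu^{-n/g},u^{m/g})$; it satisfies $q^mt^n=1$. All operators below are taken with these values of $(q,t)$. Operators: let $\mathbb K$ be a field containing $\mathbb Q(q,t)$ and $\mathcal P=\mathbb K[x_1,\dots,x_N]$. For $1\le i<N$, $xs_i$ is $x$ with $x_i,x_{i+1}$ interchanged, and $$T_ip(x)=(1-t)x_{i+1}\frac{p(x)-p(xs_i)}{x_i-x_{i+1}}+tp(xs_i).$$ These satisfy the braid relations and $(T_i-t)(T_i+1)=0$; $\mathcal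 H_N(t)$ is the (Hecke) algebra generated by $T_1,\dots,T_{N-1}$. Let $wp(x)=p(qx_N,x_1,\dots,x_{N-1})$. For $1\le i\le N$ put $\xi_i=t^{i-1}T_iT_{i+1}\cdots T_{N-1}\,w\,T_1^{-1}T_2^{-1}\cdots T_{i-1}^{-1}$ (Cherednik operators) and $\omega_i=t^{i-N}T_iT_{i+1}\cdots T_{N-1}T_{N-1}T_{N-2}\cdots T_i$ (Jucys-Murphy operators; $\omega_N=1$). A polynomial $p$ is called singular if $\xi_ip=\omega_ip$ for all $1\le i\le N$. (If $p$ is singular then $\mathcal H_N(t)p$ consists of singular polynomials.) Isotype: a reverse standard Young tableau (RSYT) of shape $\tau$ ($\tau$ a partition of $N$) is a filling of the Ferrers diagram of $\tau$ by $1,\dots,N$, each used once, with entries decreasing along each row and down each column; if $k$ is in row $i$, column $j$ of $Y$ then its content is $c(k,Y)=j-i$. Irreducible representations of $\mathcal H_N(t)$ (for $t$ with $t^k\ne1$, $2\le k\le N$) are indexed by partitions $\tau$ of $N$: the one of isotype $\tau$ has a basis indexed by the RSYT $Y$ of shape $\tau$, whose elements are simultaneous eigenvectors of the $\omega_i$ with $\omega_iY=t^{c(i,Y)}Y$. (In this convention constants, on which $T_i$ acts as $t$, have isotype $(N)$.) Trailing zeros in partitions are ignored. *)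

(* Defs.v *)
(* Mathematical Components, with multinomials for K[x_1,...,x_N], real-closed
   for R[i] and MathComp-Analysis for cos, sin and pi.

   Indices are 0-based: the variable x_k, the operators T_k, xi_k, omega_k and
   the tableau entry k are indexed by the ordinal k - 1 : 'I_N. *)
From HB Require Import structures.
From mathcomp Require Import all_boot all_order all_algebra.
From mathcomp Require Import fingroup perm.
From mathcomp Require Import complex mpoly.
From mathcomp Require Import reals trigo.
From mathcomp Require Import ring.

Set Implicit Arguments.
Unset Strict Implicit.
Unset Printing Implicit Defensive.

Import Order.TTheory GRing.Theory Num.Theory.
Local Open Scope ring_scope.

(* exp(2 pi i k / m) *)
Definition unity_root (R : realType) (m : nat) (k : int) : R[i] :=
  let theta : R := 2 * pi * k%:~R / m%:R in (cos theta +i* sin theta)%C.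

Definition singular_parameter (R : realType) (m n : nat) (q t : R[i]) : Prop :=
  let g := gcdn m n in
  exists (k : int) (u : R[i]),
    let z := if g == 1%N then 1 else unity_root R m k in
    [/\ coprimez k g%:Z, u != 0, (forall e : nat, (0 < e)%N -> u ^+ e != 1),
        q = z * u ^- (n %/ g) & t = u ^+ (m %/ g)].

Section Operators.
Variables (K : fieldType) (N : nat).
Local Notation P := {mpoly K[N]}.
Implicit Types (p f : P) (i j : 'I_N).

Lemma divdiff_exists i j p :
  exists r : P, ('X_i - 'X_j) * r == p - msym (tperm i j) p.
Proof.
have good0 : exists r : P, ('X_i - 'X_j) * r == 0 - msym (tperm i j) 0.
  by exists 0; rewrite msym0 subr0 mulr0.
have good1 : exists r : P, ('X_i - 'X_j) * r == 1 - msym (tperm i j) 1.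
  by exists 0; rewrite msym1 subrr mulr0.
have goodM a b :
    (exists r : P, ('X_i - 'X_j) * r == a - msym (tperm i j) a) ->
    (exists r : P, ('X_i - 'X_j) * r == b - msym (tperm i j) b) ->
    exists r : P, ('X_i - 'X_j) * r == a * b - msym (tperm i j) (a * b).
  move=> [ra /eqP ea] [rb /eqP eb].
  exists (ra * b + msym (tperm i j) a * rb); apply/eqP.
  rewrite mulrDr mulrA ea mulrCA eb msymM; ring.
have goodX l :
    exists r : P, ('X_i - 'X_j) * r == 'X_l - msym (tperm i j) 'X_l.
  have -> : msym (tperm i j) ('X_l : P) = 'X_(tperm i j l).
    by rewrite /msym mmapX mmap1U.
  case: tpermP => [->|->|_ _]; first by exists 1; rewrite mulr1.
    by exists (-1); rewrite mulrN1 opprB.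
  by exists 0; rewrite mulr0 subrr.
rewrite [p]mpolyE.
elim/big_rec: _ => // mon a _ [ra /eqP ea].
have [rm /eqP em] :
    exists r : P, ('X_i - 'X_j) * r == 'X_[mon] - msym (tperm i j) 'X_[mon].
  rewrite (mpolyXE_id _ mon); elim/big_rec: _ => // l b _ hb; apply: (goodM _ _ _ hb).
  elim: (mon l) => [|e IH]; first by rewrite expr0.
  by rewrite exprS; apply: (goodM _ _ (goodX l) IH).
exists (p@_mon *: rm + ra); apply/eqP.
by rewrite mulrDr -scalerAr em ea msymD msymZ scalerBr opprD addrACA.
Qed.

(* (p(x) - p(x s)) / (x_i - x_j), where x s is x with x_i, x_j interchanged *)
Definition divdiff i j p : P := xchoose (divdiff_exists i j p).

Lemma divdiffE i j p :
  ('X_i - 'X_j) * divdiff i j p = p - msym (tperm i j) p.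
Proof. exact/eqP/(xchooseP (divdiff_exists i j p)). Qed.

Variables (q t : K).

(* Only the indices with i.+1 < N are used, and for these ordS i is i + 1. *)
Definition T i p : P :=
  (1 - t) *: ('X_(ordS i) * divdiff i (ordS i) p)
  + t *: msym (tperm i (ordS i)) p.

(* The inverse of T i, given by (T_i - t) (T_i + 1) = 0 when t <> 0;
   see T_TinvK and TinvTK below. *)
Definition Tinv i p : P := t^-1 *: (T i p + (1 - t) *: p).

(* p(x) |-> p(q x_N, x_1, ..., x_(N-1)); ord_pred sends the first index to the
   last one. *)
Definition w p : P :=
  p \mPo [tuple (if val i == 0%N then q *: 'X_(ord_pred i)
                 else 'X_(ord_pred i)) | i < N].

(* h i_1 \o h i_2 \o ... \o h i_k for s = [:: i_1; i_2; ...; i_k] *)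
Definition compose (h : 'I_N -> P -> P) (s : seq 'I_N) : P -> P :=
  foldr (fun i acc => h i \o acc) id s.

Definition idx_from i : seq 'I_N :=
  [seq j : 'I_N <- enum 'I_N | (i <= j)%N && (j.+1 < N)%N].
Definition idx_below i : seq 'I_N := [seq j : 'I_N <- enum 'I_N | (j < i)%N].

Definition xi i p : P :=
  t ^+ i *: compose T (idx_from i) (w (compose Tinv (idx_below i) p)).

Definition omega i p : P :=
  t ^ (i.+1%:Z - N%:Z) *:
    compose T (idx_from i) (compose T (rev (idx_from i)) p).

Definition singular p : Prop := forall i, xi i p = omega i p.

Inductive hecke : (P -> P) -> Prop :=
| hecke_id : hecke id
| hecke_T i : (i.+1 < N)%N -> hecke (T i)
| hecke_add h1 h2 : hecke h1 -> hecke h2 -> hecke (fun f => h1 f + h2 f)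
| hecke_scale c h : hecke h -> hecke (fun f => c *: h f)
| hecke_comp h1 h2 : hecke h1 -> hecke h2 -> hecke (h1 \o h2).

Definition hecke_orbit p : P -> Prop :=
  fun f => exists2 h, hecke h & f = h p.

Definition hecke_submodule (M : P -> Prop) : Prop :=
  [/\ M 0, (forall f1 f2, M f1 -> M f2 -> M (f1 + f2)),
      (forall c f, M f -> M (c *: f))
    & (forall h f, hecke h -> M f -> M (h f))].

Definition hecke_irreducible (M : P -> Prop) : Prop :=
  [/\ hecke_submodule M, (exists2 f, M f & f <> 0)
    & forall M' : P -> Prop, hecke_submodule M' -> (forall f, M' f -> M f) ->
        (forall f, M' f -> f = 0) \/ (forall f, M f -> M' f)].

End Operators.

Definition is_partition (N : nat) (tau : seq nat) : bool :=
  sorted geq tau && (sumn tau == N).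

(* Equality of partitions up to trailing zeros. *)
Definition same_shape (tau sigma : seq nat) : Prop :=
  forall i, nth 0%N tau i = nth 0%N sigma i.

(* A filling is given by the cell Y k = (row, column), counted from 0, that
   contains the entry k. Y is injective with values in the diagram, which has N
   cells when tau is a partition of N, so each cell is filled exactly once. *)
Definition is_rsyt (N : nat) (tau : seq nat)
    (Y : {ffun 'I_N -> 'I_N * 'I_N}) : bool :=
  [&& injectiveb Y,
      [forall k, ((Y k).2 < nth 0%N tau (Y k).1)%N],
      [forall k, forall l,
        ((Y k).1 == (Y l).1) && ((Y k).2 < (Y l).2)%N ==> (l < k)%N]
    & [forall k, forall l,
        ((Y k).2 == (Y l).2) && ((Y k).1 < (Y l).1)%N ==> (l < k)%N]].

Definition rsyt (N : nat) (tau : seq nat) :=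
  {Y : {ffun 'I_N -> 'I_N * 'I_N} | is_rsyt tau Y}.

Definition content (N : nat) (tau : seq nat) (k : 'I_N) (Y : rsyt N tau) : int :=
  (val Y k).2%:Z - (val Y k).1%:Z.

Definition has_isotype (K : fieldType) (N : nat) (t : K) (tau : seq nat)
    (M : {mpoly K[N]} -> Prop) : Prop :=
  exists b : rsyt N tau -> {mpoly K[N]},
    [/\ (forall Y, M (b Y)),
        (forall a : rsyt N tau -> K,
           \sum_Y a Y *: b Y = 0 -> forall Y, a Y = 0),
        (forall f, M f -> exists a : rsyt N tau -> K, f = \sum_Y a Y *: b Y)
      & (forall i Y, omega t i (b Y) = t ^ content i Y *: b Y)].

(* tau = (n d_1 - 1, ..., n d_L - 1, r) with ds = (d_1, ..., d_L) *)
Definition nd_expression (n : nat) (tau ds : seq nat) (r : nat) : Prop :=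
  [/\ (1 <= size ds)%N, sorted geq ds, all (leq 1) ds,
      (r <= n * last 0 ds - 1)%N
    & same_shape tau (rcons [seq (n * d - 1)%N | d <- ds] r)].

Section InverseOfT.
Variables (K : fieldType) (N : nat) (t : K) (i : 'I_N).
Hypotheses (lt_iN : (i.+1 < N)%N) (t_neq0 : t != 0).
Local Notation P := {mpoly K[N]}.
Local Notation j := (ordS i).
Local Notation s := (msym (tperm i j) : P -> P).

Let ij : i != j.
Proof.
by rewrite -val_eqE /= modn_small // neq_ltn leqnn.
Qed.

Let d_neq0 : ('X_i - 'X_j : P) != 0.
Proof.
rewrite subr_eq0; apply: contra ij => /eqP.
move=> /(congr1 (mcoeff U_(i)%MM)); rewrite !mcoeffXU eqxx eq_sym.
by case: eqP => // _ /eqP; rewrite oner_eq0.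
Qed.

Lemma divdiff_uniq (p r : P) : ('X_i - 'X_j) * r = p - s p -> divdiff i j p = r.
Proof. by rewrite -divdiffE => /(mulfI d_neq0). Qed.

Lemma T_is_linear a (p p' : P) : T t i (a *: p + p') = a *: T t i p + T t i p'.
Proof.
rewrite /T (@divdiff_uniq _ (a *: divdiff i j p + divdiff i j p')); last first.
  by rewrite mulrDr -scalerAr !divdiffE msymD msymZ scalerBr opprD addrACA.
rewrite msymD msymZ mulrDr -scalerAr !scalerDr !scalerA addrACA.
by rewrite ![a * _]mulrC.
Qed.

Lemma T_quadratic (p : P) : T t i (T t i p) = (t - 1) *: T t i p + t *: p.
Proof.
have sX l : s 'X_l = 'X_(tperm i j l) by rewrite /msym mmapX mmap1U.
have sK f : s (s f) = f by rewrite -msymMm tperm2 msym1m.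
set D := divdiff i j p.
have DE : ('X_i - 'X_j) * D = p - s p := divdiffE i j p.
have sD : s D = D.
  apply: (mulfI d_neq0); rewrite DE.
  have := congr1 s DE; rewrite msymM !msymB !sX tpermL tpermR sK => e.
  by rewrite -[RHS]opprB -e -mulNr opprB.
have sT : s (T t i p) = (1 - t) *: ('X_i * D) + t *: p.
  by rewrite {1}/T msymD !msymZ msymM sX tpermR sK sD.
have TE : T t i p = (1 - t) *: ('X_j * D) + t *: s p by [].
have dT : divdiff i j (T t i p) = (t - 1) *: D - t *: D.
  apply: divdiff_uniq; rewrite sT TE mulrBr -!scalerAr !DE.
  rewrite -!mul_mpolyC !mpolyCB mpolyC1.
  have -> : 'X_j * D = 'X_i * D - (p - s p) by rewrite -DE; ring.
  ring.
rewrite {1}/T dT sT TE -!mul_mpolyC !mpolyCB mpolyC1.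
have -> : 'X_i * D = 'X_j * D + (p - s p) by rewrite -DE; ring.
ring.
Qed.

Lemma T_TinvK : cancel (Tinv t i : P -> P) (T t i).
Proof.
move=> p; rewrite /Tinv.
have T0 : T t i (0 : P) = 0.
  have := T_is_linear (-1) (0 : P) 0.
  by rewrite addr0 scaleN1r oppr0 scaleN1r addNr.
have TZ a (f : P) : T t i (a *: f) = a *: T t i f.
  by rewrite -[a *: f]addr0 T_is_linear T0 addr0.
rewrite TZ -[T t i p]scale1r T_is_linear TZ scale1r T_quadratic.
rewrite addrAC -scalerDl addrA subrK subrr scale0r add0r.
by rewrite scalerA mulVf // scale1r.
Qed.

Lemma TinvTK : cancel (T t i : P -> P) (Tinv t i).
Proof.
move=> p; rewrite /Tinv T_quadratic addrAC -scalerDl.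
by rewrite addrA subrK subrr scale0r add0r scalerA mulVf // scale1r.
Qed.

End InverseOfT.

(* Main.v *)
Require Import Defs.
From HB Require Import structures.
From mathcomp Require Import all_boot all_order all_algebra.
From mathcomp Require Import fingroup perm.
From mathcomp Require Import complex mpoly boolp.
From mathcomp Require Import reals trigo.
From mathcomp Require Import ring zify lra.

Import Order.TTheory GRing.Theory Num.Theory.
Local Open Scope ring_scope.

Set Implicit Arguments.
Unset Strict Implicit.
Unset Printing Implicit Defensive.

(** The idea is to compare two ways of reading the weights of joint eigenvectors.

    For a singular polynomial p the shift w acts as an element theta of the
    Hecke algebra, and this persists over the whole orbit of p
    ([singular_orbit]). So on an irreducible submodule M of isotype tau the
    Cherednik operators have the same eigenvectors, indexed by tableaux Y, and
    the same eigenvalues t^c(i,Y) as the Jucys-Murphy operators.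

    On the other hand the eigenvalues of the Cherednik operators on polynomials
    are of the form q^a t^b with a an exponent and N - 1 - b a rank. The proof
    takes the coefficient of the highest power of one variable, which yields an
    eigenvector in one variable fewer ([eigenvector_exponents]); in a module
    that is stable under the T_i this variable can be the first one, so that
    some eigenvector has nonincreasing exponents, and its truncations to the
    last variables are again joint eigenvectors ([module_exponents]). Since
    q^a t^b = 1 holds for the multiples of (m, n) only
    ([singular_parameterP]), there are a tableau Y and a nonincreasing k with
    c(i,Y) = N - 1 - i - n k_i. Such a tableau lists the diagram row by row, and
    at the end of each row but the last the jump of the content shows that n
    divides tau_r + 1; as p is not constant there is more than one row
    ([rsyt_row_reading]). This gives the expression of tau.

    It remains to exclude a second row with n or more cells below a first row of
    nd - 1 cells. Truncation gives a joint eigenvector g in N = nd - 1 + n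
    variables with the weights of the tableau of shape (nd - 1, n). Its value at
    (1, t, ..., t^(N-1)) is 0, because T_i acts on this value by t, as on the
    trivial module, and the weights are not the trivial ones. Its xi weights
    determine its exponents (M^n, 0^(N-n)) with M = md ([rectangular_order]), so
    that g spans its eigenspace. When q is replaced by a variable u, there is a
    nonzero family of eigenvectors with these exponents, constructed from 1 by
    raising operators and intertwiners. The quotient of its value at
    (1, t, ..., t^(N-1)) by its leading coefficient is, up to a constant, the
    quotient of two explicit products ([rectangular_family]); at u = q the
    numerator has a simple zero and the denominator vanishes. Dividing the
    family by a power of u - q one finds an eigenvector at q, proportional to g,
    whose value is not 0: a contradiction ([no_rectangular_eigenvector]). *)

(** * The operators T_j with natural number indices *)

Lemma mpoly_rmorph_ext (K : fieldType) (N : nat) (R : comNzRingType)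
    (f g : {rmorphism {mpoly K[N]} -> R}) :
  (forall c, f c%:MP = g c%:MP) -> (forall i : 'I_N, f 'X_i = g 'X_i) ->
  f =1 g.
Proof.
move=> fgC fgX p; rewrite [p]mpolyE !rmorph_sum /=; apply: eq_bigr => mon _.
rewrite -mul_mpolyC !rmorphM fgC; congr (_ * _).
rewrite (mpolyXE_id _ mon) !rmorph_prod; apply: eq_bigr => i _.
by rewrite !rmorphXn fgX.
Qed.

(** Natural number indices make the shifts j.+1 and the words over iota
    expressible; only j with j.+1 < N is of interest. The operators are
    locked, since conversion would otherwise unfold the divided difference. *)
HB.lock Definition Tn (K : fieldType) (N : nat) (t : K) (j : nat)
    (p : {mpoly K[N]}) : {mpoly K[N]} :=
  oapp (fun i : 'I_N => T t i p) p (insub j).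

HB.lock Definition Tvn (K : fieldType) (N : nat) (t : K) (j : nat)
    (p : {mpoly K[N]}) : {mpoly K[N]} :=
  t^-1 *: (Tn t j p + (1 - t) *: p).

Section NatIndexedOperators.
Variables (K : fieldType) (N : nat).
Local Notation P := {mpoly K[N]}.
Implicit Types (p f g : P) (i j k : nat).

Definition var j : P := oapp (fun i : 'I_N => 'X_i) 0 (insub j).

Lemma var_ord (i : 'I_N) : var i = 'X_i.
Proof. by rewrite /var valK. Qed.

Lemma varE j (lt_jN : (j < N)%N) : var j = 'X_(Ordinal lt_jN).
Proof. by rewrite -var_ord. Qed.

Definition adj_perm j : 'S_N :=
  if insub j is Some i then tperm i (ordS i) else 1%g.
Definition adj_swap j k : nat :=
  if k == j then j.+1 else if k == j.+1 then j else k.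

Lemma val_ordS (i : 'I_N) : (i.+1 < N)%N -> val (ordS i) = i.+1.
Proof. by move=> lt_iN; rewrite /= modn_small. Qed.

Lemma adj_permE j (i : 'I_N) :
  (j.+1 < N)%N -> val (adj_perm j i) = adj_swap j i.
Proof.
move=> lt_jN; rewrite /adj_perm insubT ?(ltnW lt_jN) // => lt_jN' /=.
rewrite /adj_swap; case: tpermP => [->|->|] /=.
- by rewrite eqxx modn_small.
- by rewrite modn_small // eqxx; case: eqP => // /eqP; rewrite gtn_eqF.
move=> /eqP; rewrite -val_eqE /= => /negbTE-> /eqP.
by rewrite -val_eqE val_ordS //= => /negbTE->.
Qed.

Definition swap j p : P := msym (adj_perm j) p.

HB.instance Definition _ j := GRing.RMorphism.copy (swap j) (msym (adj_perm j)).

Lemma swapZ j c p : swap j (c *: p) = c *: swap j p.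
Proof. exact: msymZ. Qed.

Lemma swapD j p f : swap j (p + f) = swap j p + swap j f.
Proof. exact: msymD. Qed.

Lemma swapM j p f : swap j (p * f) = swap j p * swap j f.
Proof. exact: msymM. Qed.

Lemma swapC j c : swap j c%:MP = c%:MP.
Proof. by rewrite /swap /msym mmapC. Qed.

Lemma swap_var j k : (j.+1 < N)%N -> (k < N)%N ->
  swap j (var k) = var (adj_swap j k).
Proof.
move=> lt_jN lt_kN; rewrite (varE lt_kN) /swap /msym mmapX mmap1U.
by rewrite -var_ord adj_permE.
Qed.

Lemma adj_swapK j : involutive (adj_swap j).
Proof.
move=> k; rewrite /adj_swap; have [->|ne_kj] := eqVneq k j.
  by rewrite eqxx; case: eqP => // /eqP; rewrite gtn_eqF.
have [->|ne_kj1] := eqVneq k j.+1; first by rewrite eqxx.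
by rewrite (negbTE ne_kj) (negbTE ne_kj1).
Qed.

Lemma swapK j : (j.+1 < N)%N -> involutive (swap j).
Proof.
move=> lt_jN p; rewrite /swap /adj_perm insubT ?(ltnW lt_jN) // => lt_jN' /=.
by rewrite -msymMm tperm2 msym1m.
Qed.

Lemma var_inj j k : (j < N)%N -> (k < N)%N -> var j = var k -> j = k.
Proof.
move=> lt_jN lt_kN; rewrite (varE lt_jN) (varE lt_kN).
move=> /(congr1 (mcoeff U_(Ordinal lt_jN)%MM)); rewrite !mcoeffXU eqxx.
by case: eqP => [[]//|_ /eqP]; rewrite oner_eq0.
Qed.

Lemma varB_neq0 j k : (j < N)%N -> (k < N)%N -> j != k -> var j - var k != 0.
Proof.
move=> lt_jN lt_kN; apply: contra; rewrite subr_eq0 => /eqP.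
by move=> /(var_inj lt_jN lt_kN) ->.
Qed.

Variable t : K.

Local Notation Tn := (@Tn K N t).
Local Notation Tvn := (@Tvn K N t).

Lemma Tvn_def j p : Tvn j p = t^-1 *: (Tn j p + (1 - t) *: p).
Proof. by rewrite unlock. Qed.

Lemma TnE (i : 'I_N) p : Tn i p = T t i p.
Proof. by rewrite unlock valK. Qed.

Lemma TvnE (i : 'I_N) p : Tvn i p = Tinv t i p.
Proof. by rewrite Tvn_def TnE. Qed.

(** Clearing the denominator of the divided difference: together with
    [Tn_uniq], this equation replaces the definition of the operator in all
    later computations. *)
Lemma Tn_char j p : (j.+1 < N)%N ->
  (var j - var j.+1) * Tn j p =
  (1 - t)%:MP * var j.+1 * p + (t%:MP * var j - var j.+1) * swap j p.
Proof.
move=> lt_jN; have lt_jN' := ltnW lt_jN.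
have -> : Tn j p = T t (Ordinal lt_jN') p by rewrite -TnE.
rewrite /swap /adj_perm insubT /= /T.
rewrite (varE lt_jN') (varE lt_jN).
have -> : Ordinal lt_jN = ordS (Ordinal lt_jN').
  by apply: val_inj; rewrite val_ordS.
set x := 'X_(Ordinal _); set y := 'X_(ordS _); set s := msym _ p.
have := divdiffE (Ordinal lt_jN') (ordS (Ordinal lt_jN')) p.
rewrite -/x -/y -/s; set D := divdiff _ _ _ => DE.
rewrite -!mul_mpolyC mulrDr.
have -> : (x - y) * ((1 - t)%:MP * (y * D)) = (1 - t)%:MP * y * ((x - y) * D).
  by ring.
by rewrite DE mpolyCB mpolyC1; ring.
Qed.

Lemma Tn_uniq j p f : (j.+1 < N)%N ->
  (var j - var j.+1) * f =
  (1 - t)%:MP * var j.+1 * p + (t%:MP * var j - var j.+1) * swap j p ->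
  f = Tn j p.
Proof.
move=> lt_jN; rewrite -Tn_char //; apply/mulfI/varB_neq0 => //.
  exact: ltnW.
by rewrite ltn_eqF.
Qed.

Lemma Tn_linear j : (j.+1 < N)%N -> forall a p f,
  Tn j (a *: p + f) = a *: Tn j p + Tn j f.
Proof.
move=> lt_jN a p f; apply/esym/Tn_uniq => //.
rewrite mulrDr -scalerAr !Tn_char // swapD swapZ -!mul_mpolyC; ring.
Qed.

Lemma TnD j p f : (j.+1 < N)%N -> Tn j (p + f) = Tn j p + Tn j f.
Proof. by move=> /Tn_linear Tl; have := Tl 1 p f; rewrite !scale1r. Qed.

Lemma Tn0 j : (j.+1 < N)%N -> Tn j 0 = 0.
Proof.
move=> lt_jN; apply: (addIr (Tn j 0)).
by rewrite -TnD // addr0 add0r.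
Qed.

Lemma TnZ j a p : (j.+1 < N)%N -> Tn j (a *: p) = a *: Tn j p.
Proof. by move=> lt_jN; rewrite -[a *: p]addr0 Tn_linear // Tn0 // addr0. Qed.

Lemma Tn_quadratic j p : (j.+1 < N)%N ->
  Tn j (Tn j p) = (t - 1) *: Tn j p + t *: p.
Proof.
move=> lt_jN; have lt_jN' := ltnW lt_jN.
by have -> : j = Ordinal lt_jN' by []; rewrite !TnE T_quadratic.
Qed.

Hypothesis t_neq0 : t != 0.

Lemma TnK j : (j.+1 < N)%N -> cancel (Tn j) (Tvn j).
Proof.
move=> lt_jN p; have lt_jN' := ltnW lt_jN.
have -> : j = Ordinal lt_jN' by [].
by rewrite TvnE TnE TinvTK.
Qed.

Lemma TvnK j : (j.+1 < N)%N -> cancel (Tvn j) (Tn j).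
Proof.
move=> lt_jN p; have lt_jN' := ltnW lt_jN.
have -> : j = Ordinal lt_jN' by [].
by rewrite TvnE TnE T_TinvK.
Qed.

Lemma TvnD j p f : (j.+1 < N)%N -> Tvn j (p + f) = Tvn j p + Tvn j f.
Proof. by move=> lt_jN; rewrite !Tvn_def TnD // !scalerDr addrACA. Qed.

Lemma TvnZ j a p : (j.+1 < N)%N -> Tvn j (a *: p) = a *: Tvn j p.
Proof.
move=> lt_jN; rewrite !Tvn_def TnZ // [_ *: (a *: p)]scalerA mulrC -scalerA -scalerDr.
by rewrite !scalerA mulrC.
Qed.

End NatIndexedOperators.

(** * Braid relations *)

Lemma rmorph_ext_var (K : fieldType) (N : nat) (R : comNzRingType)
    (f g : {rmorphism {mpoly K[N]} -> R}) :
  (forall c, f c%:MP = g c%:MP) ->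
  (forall k, (k < N)%N -> f (var K N k) = g (var K N k)) ->
  f =1 g.
Proof.
by move=> fgC fgX; apply: mpoly_rmorph_ext => // i; rewrite -var_ord fgX.
Qed.

(** The braid relation as an identity of rational functions: p, pa, pb, ...
    stand for the images of one polynomial under the six permutations of x,
    y, z, and D for the divided difference. *)
Lemma braid_in_field (F : fieldType) (t x y z p pa pb pab pba paba : F) :
  x - y != 0 -> y - z != 0 -> x - z != 0 ->
  let D (u v f g : F) := ((1 - t) * v * f + (t * u - v) * g) / (u - v) in
  D x y (D y z (D x y p pa) (D x z pb pba))
        (D x z (D y x pa p) (D y z pab paba)) =
  D y z (D x y (D y z p pb) (D x z pa pab))
        (D x z (D z y pb p) (D x y pba paba)).
Proof.
move=> xy yz xz /=.
have yx : y - x != 0 by rewrite -opprB oppr_eq0.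
have zy : z - y != 0 by rewrite -opprB oppr_eq0.
by field; do ?[apply/andP; split].
Qed.

Ltac adj_swap_lia := rewrite /adj_swap;
  repeat match goal with |- context [if ?a == ?b then _ else _] =>
    lazymatch a with
    | context [if _ then _ else _] => fail
    | _ => case: (a =P b) => ?
    end end; lia.

Section Relations.
Variables (K : fieldType) (N : nat) (t : K).
Local Notation P := {mpoly K[N]}.
Local Notation x := (var K N).
Local Notation s := (@swap K N).
Local Notation T := (@Tn K N t).
Local Notation Tv := (@Tvn K N t).
Implicit Types (p f g : P) (i j k : nat).

Lemma swap_comm j k p : (j.+1 < N)%N -> (k.+1 < N)%N -> (j.+1 < k)%N ->
  s j (s k p) = s k (s j p).
Proof.
move=> ltj ltk ltjk; apply: (rmorph_ext_var (f := s j \o s k) (g := s k \o s j)).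
  by move=> c; rewrite /= !swapC.
move=> l ltl /=; rewrite !swap_var //.
- by congr (x _); adj_swap_lia.
- by adj_swap_lia.
- by adj_swap_lia.
Qed.

Lemma swap_braid j p : (j.+2 < N)%N ->
  s j (s j.+1 (s j p)) = s j.+1 (s j (s j.+1 p)).
Proof.
move=> ltj; apply: (rmorph_ext_var (f := s j \o (s j.+1 \o s j))
                                  (g := s j.+1 \o (s j \o s j.+1))).
  by move=> c; rewrite /= !swapC.
move=> l ltl /=; rewrite !swap_var //; try by adj_swap_lia.
by congr (x _); adj_swap_lia.
Qed.

Lemma Tn_mull k f p : (k.+1 < N)%N -> s k f = f -> T k (f * p) = f * T k p.
Proof.
move=> ltk sf; apply/esym/Tn_uniq => //.
by rewrite mulrCA Tn_char // swapM sf; ring.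
Qed.

Lemma swap_var_far j k : (j.+1 < N)%N -> (k < N)%N -> k != j -> k != j.+1 ->
  s j (x k) = x k.
Proof.
by move=> ltj ltk /negbTE nkj /negbTE nkj1; rewrite swap_var // /adj_swap nkj nkj1.
Qed.

Lemma Tn_var_far j k p : (j.+1 < N)%N -> (k < N)%N -> k != j -> k != j.+1 ->
  T j (x k * p) = x k * T j p.
Proof. by move=> *; rewrite Tn_mull // swap_var_far. Qed.

Lemma swap_var_l j : (j.+1 < N)%N -> s j (x j) = x j.+1.
Proof. by move=> ltj; rewrite swap_var ?(ltnW ltj) // /adj_swap eqxx. Qed.

Lemma swap_var_r j : (j.+1 < N)%N -> s j (x j.+1) = x j.
Proof. by move=> ltj; rewrite swap_var // /adj_swap eqxx; case: eqP => //; lia. Qed.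

Lemma Tn_swap_comm j k p : (j.+1 < N)%N -> (k.+1 < N)%N ->
  (j.+1 < k)%N || (k.+1 < j)%N -> T k (s j p) = s j (T k p).
Proof.
move=> ltj ltk far; apply/esym/Tn_uniq => //.
have sk : s j (x k) = x k by rewrite swap_var_far //; lia.
have sk1 : s j (x k.+1) = x k.+1 by rewrite swap_var_far //; lia.
have ss : s j (s k p) = s k (s j p).
  by case/orP: far => far; [rewrite swap_comm | rewrite (swap_comm p (j:=k))].
have := congr1 (s j) (Tn_char t p ltk).
by rewrite swapD !swapM ss !rmorphB /= !swapM sk sk1 !swapC.
Qed.

Lemma Tn_comm j k p : (j.+1 < N)%N -> (k.+1 < N)%N ->
  (j.+1 < k)%N || (k.+1 < j)%N -> T j (T k p) = T k (T j p).
Proof.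
move=> ltj ltk far; apply/esym/Tn_uniq => //.
have sk : s k (x j) = x j by rewrite swap_var_far //; lia.
have sk1 : s k (x j.+1) = x j.+1 by rewrite swap_var_far //; lia.
rewrite -Tn_mull //; last by rewrite rmorphB /= sk sk1.
rewrite Tn_char // TnD // Tn_mull //; last by rewrite swapM swapC sk1.
rewrite Tn_mull //; last by rewrite rmorphB /= swapM swapC sk sk1.
by rewrite (Tn_swap_comm (j := j)).
Qed.

(** In the field of fractions each T_k is given by a formula; the equations
    below are its instances at p and at the polynomials obtained from p by
    exchanging variables, so that both sides become the two sides of
    [braid_in_field]. *)
Lemma Tn_braid j p : (j.+2 < N)%N ->
  T j (T j.+1 (T j p)) = T j.+1 (T j (T j.+1 p)).
Proof.
move=> ltj2; have ltj1 := ltnW ltj2; have ltj := ltnW ltj1.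
have xy : x j - x j.+1 != 0 by rewrite varB_neq0 // ltn_eqF.
have yz : x j.+1 - x j.+2 != 0 by rewrite varB_neq0 // ltn_eqF.
have xz : x j - x j.+2 != 0 by rewrite varB_neq0 //; lia.
pose F : {rmorphism P -> {fraction P}} := @tofrac P.
have F0 f : (F f == 0) = (f == 0) by rewrite /F tofrac_eq0.
have sax : s j (x j) = x j.+1 := swap_var_l ltj1.
have say : s j (x j.+1) = x j := swap_var_r ltj1.
have saz : s j (x j.+2) = x j.+2 by rewrite swap_var_far //; lia.
have sbx : s j.+1 (x j) = x j by rewrite swap_var_far //; lia.
have sby : s j.+1 (x j.+1) = x j.+2 := swap_var_l ltj2.
have sbz : s j.+1 (x j.+2) = x j.+1 := swap_var_r ltj2.
pose D (u v f g : P) : {fraction P} :=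
  ((1 - F t%:MP) * F v * F f + (F t%:MP * F u - F v) * F g) / (F u - F v).
have DE (u v f g h : P) : u - v != 0 ->
    (u - v) * h = (1 - t)%:MP * v * f + (t%:MP * u - v) * g -> F h = D u v f g.
  move=> uv /(congr1 F) e; apply: (mulfI (x := F u - F v)).
    by rewrite -rmorphB F0.
  rewrite [RHS]mulrC /D divfK; last by rewrite -rmorphB F0.
  rewrite -[F u - F v]rmorphB -[LHS]rmorphM e.
  by rewrite mpolyCB mpolyC1 !(rmorphD, rmorphM, rmorphN, rmorph1).
have ch1 g := Tn_char t g ltj1; have ch2 g := Tn_char t g ltj2.
have app (h u v f g : P) : (u - v) * h = (1 - t)%:MP * v * f + (t%:MP * u - v) * g ->
   forall k, (s k u - s k v) * s k h =
     (1 - t)%:MP * s k v * s k f + (t%:MP * s k u - s k v) * s k g.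
  move=> e k; have := congr1 (s k) e.
  by rewrite swapD !swapM !rmorphB /= !swapM !swapC.
have key f g : F f = F g -> f = g.
  by move=> e; apply/eqP; rewrite -subr_eq0 -F0 rmorphB e subrr.
have yx : x j.+1 - x j != 0 by rewrite -opprB oppr_eq0.
have zy : x j.+2 - x j.+1 != 0 by rewrite -opprB oppr_eq0.
have eq1 := ch1 p.
have eq1a := app _ _ _ _ _ eq1 j; rewrite sax say swapK // in eq1a.
have eq1b := app _ _ _ _ _ eq1 j.+1; rewrite sbx sby in eq1b.
have eq1ab := app _ _ _ _ _ eq1b j; rewrite sax saz in eq1ab.
have eq2 := ch2 (T j p).
have eq2a := app _ _ _ _ _ eq2 j; rewrite say saz in eq2a.
have eq3 := ch1 (T j.+1 (T j p)).
have fq1 := ch2 p.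
have fq1b := app _ _ _ _ _ fq1 j.+1; rewrite sby sbz swapK // in fq1b.
have fq1a := app _ _ _ _ _ fq1 j; rewrite say saz in fq1a.
have fq1ba := app _ _ _ _ _ fq1a j.+1; rewrite sbx sbz -swap_braid // in fq1ba.
have fq2 := ch1 (T j.+1 p).
have fq2b := app _ _ _ _ _ fq2 j.+1; rewrite sbx sby in fq2b.
have fq3 := ch2 (T j (T j.+1 p)).
apply: key; rewrite (DE _ _ _ _ _ xy eq3) (DE _ _ _ _ _ yz fq3) /D.
rewrite (DE _ _ _ _ _ yz eq2) (DE _ _ _ _ _ xz eq2a).
rewrite (DE _ _ _ _ _ xy fq2) (DE _ _ _ _ _ xz fq2b) /D.
rewrite (DE _ _ _ _ _ xy eq1) (DE _ _ _ _ _ yx eq1a) (DE _ _ _ _ _ xz eq1b).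
rewrite (DE _ _ _ _ _ yz eq1ab).
rewrite (DE _ _ _ _ _ yz fq1) (DE _ _ _ _ _ zy fq1b) (DE _ _ _ _ _ xz fq1a).
rewrite (DE _ _ _ _ _ xy fq1ba) /D.
by apply: braid_in_field; rewrite -rmorphB F0.
Qed.

Hypothesis t_neq0 : t != 0.

Lemma Tvn_var_far j k p : (j.+1 < N)%N -> (k < N)%N -> k != j -> k != j.+1 ->
  Tv j (x k * p) = x k * Tv j p.
Proof.
by move=> *; rewrite !Tvn_def Tn_var_far // !scalerAr -mulrDr -scalerAr.
Qed.

Lemma Tvn_Tn_comm j k p : (j.+1 < N)%N -> (k.+1 < N)%N ->
  (j.+1 < k)%N || (k.+1 < j)%N -> Tv j (T k p) = T k (Tv j p).
Proof.
by move=> ltj ltk far; rewrite !Tvn_def TnZ // TnD // TnZ // Tn_comm.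
Qed.

Lemma Tvn_braid j p : (j.+2 < N)%N ->
  Tv j (Tv j.+1 (T j p)) = T j.+1 (Tv j (Tv j.+1 p)).
Proof.
move=> ltj2; have ltj1 := ltnW ltj2.
have {1}-> : p = T j.+1 (T j (Tv j (Tv j.+1 p))) by rewrite !TvnK.
by rewrite Tn_braid // !TnK.
Qed.

(** The commutation of the multiplications with T_j, in the form used for the
    raising operator. *)
Lemma Tn_varl j p : (j.+1 < N)%N -> T j (x j * p) = t *: (x j.+1 * Tv j p).
Proof.
move=> ltj; rewrite !Tvn_def -scalerAr scalerA mulfV // scale1r.
apply/esym/Tn_uniq => //; rewrite mulrCA mulrDr Tn_char // swapM swap_var_l //.
by rewrite -mul_mpolyC; ring.
Qed.

Lemma Tvn_varr j p : (j.+1 < N)%N -> Tv j (x j.+1 * p) = t^-1 *: (x j * T j p).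
Proof.
move=> ltj; apply: (can_inj (TnK t_neq0 ltj)).
by rewrite TvnK // TnZ // Tn_varl // TnK // scalerA mulVf // scale1r.
Qed.

End Relations.

(** * The shift w *)

Section Cherednik.
Variables (K : fieldType) (N : nat) (q t : K).
Local Notation P := {mpoly K[N]}.
Local Notation x := (var K N).
Local Notation s := (@swap K N).
Local Notation T := (@Tn K N t).
Local Notation Tv := (@Tvn K N t).
Local Notation w := (@w K N q).
Implicit Types (p f g : P) (i j k : nat).

Lemma wD p f : w (p + f) = w p + w f. Proof. exact: comp_mpolyD. Qed.
Lemma wZ c p : w (c *: p) = c *: w p. Proof. exact: comp_mpolyZ. Qed.
Lemma wM p f : w (p * f) = w p * w f. Proof. exact: rmorphM. Qed.
Lemma wC c : w c%:MP = c%:MP. Proof. exact: comp_mpolyC. Qed.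
Lemma wB p f : w (p - f) = w p - w f. Proof. exact: comp_mpolyB. Qed.

HB.instance Definition _ := GRing.RMorphism.copy w
  (comp_mpoly [tuple (if val i == 0%N then q *: 'X_(ord_pred i)
                 else 'X_(ord_pred i)) | i < N]).

Lemma w_var0 : (0 < N)%N -> w (x 0) = q *: x N.-1.
Proof.
move=> N_gt0; rewrite (varE K N_gt0) /w comp_mpolyXU -tnth_nth tnth_mktuple /=.
by rewrite -var_ord /= add0n modn_small // prednK.
Qed.

Lemma w_varS j : (j.+1 < N)%N -> w (x j.+1) = x j.
Proof.
move=> ltj; rewrite (varE K ltj) /w comp_mpolyXU -tnth_nth tnth_mktuple /=.
by rewrite -var_ord /= modnDr modn_small // ltnW.
Qed.

Lemma w_swap j p : (j.+2 < N)%N -> w (s j.+1 p) = s j (w p).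
Proof.
move=> ltj; apply: (rmorph_ext_var (f := w \o s j.+1) (g := s j \o w)).
  by move=> c; rewrite /= !(swapC, wC).
move=> [|k] ltk /=.
  rewrite swap_var // [adj_swap _ _]/= w_var0 // swapZ swap_var; try lia.
  by congr (_ *: x _); adj_swap_lia.
rewrite swap_var // w_varS // swap_var; [|lia|lia].
have -> : adj_swap j.+1 k.+1 = (adj_swap j k).+1 by adj_swap_lia.
by rewrite w_varS //; adj_swap_lia.
Qed.

Lemma w_Tn j p : (j.+2 < N)%N -> w (T j.+1 p) = T j (w p).
Proof.
move=> ltj; apply: Tn_uniq; first exact: ltnW.
have := congr1 w (Tn_char t p ltj).
by rewrite wD !wM !wB wM !wC !w_varS ?w_swap ?(ltnW ltj).
Qed.

Lemma w_Tvn j p : (j.+2 < N)%N -> w (Tv j.+1 p) = Tv j (w p).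
Proof. by move=> ltj; rewrite !Tvn_def wZ wD wZ w_Tn. Qed.

Lemma w2_swap p : (1 < N)%N -> w (w (s 0 p)) = s N.-2 (w (w p)).
Proof.
move=> ltN; have eN : N.-2.+1 = N.-1 by lia.
apply: (rmorph_ext_var (f := w \o (w \o s 0)) (g := s N.-2 \o (w \o w))).
  by move=> c; rewrite /= !(swapC, wC).
have e0 : w (w (x 0)) = q *: x N.-2.
  by rewrite w_var0 ?(ltnW ltN) // wZ -eN w_varS //; lia.
have e1 : w (w (x 1)) = q *: x N.-1 by rewrite w_varS // w_var0 // ltnW.
move=> [|[|k]] ltk /=.
- rewrite swap_var // [adj_swap _ _]/= e0 e1 swapZ swap_var; try lia.
  by congr (_ *: x _); adj_swap_lia.
- rewrite swap_var // [adj_swap _ _]/= e0 e1 swapZ swap_var; try lia.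
  by congr (_ *: x _); adj_swap_lia.
- rewrite swap_var // [adj_swap _ _]/= !w_varS ?(ltnW ltk) // swap_var; try lia.
  by congr (x _); adj_swap_lia.
Qed.

(** w shifts the index of T_j down by one; w^2 closes the cycle of indices. *)
Lemma w2_Tn p : q != 0 -> (1 < N)%N -> w (w (T 0 p)) = T N.-2 (w (w p)).
Proof.
move=> q_neq0 ltN; have N_gt0 := ltnW ltN.
have eN : N.-2.+1 = N.-1 by lia.
apply: Tn_uniq; first lia.
have := congr1 w (Tn_char t p ltN); rewrite wD !wM !wB wM !wC => /(congr1 w).
rewrite wD !wM !wB wM !wC w2_swap //.
have -> : w (w (x 1)) = q *: x N.-1 by rewrite w_varS // w_var0.
have -> : w (w (x 0)) = q *: x N.-2.
  by rewrite w_var0 // wZ -eN w_varS //; lia.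
rewrite eN -!mul_mpolyC => e; apply: (mulfI (x := q%:MP)).
  by rewrite mpolyC_eq0.
by rewrite mulrA mulrBr e; ring.
Qed.

Lemma w2_Tvn p : q != 0 -> (1 < N)%N -> w (w (Tv 0 p)) = Tv N.-2 (w (w p)).
Proof. by move=> q_neq0 ltN; rewrite !Tvn_def !(wZ, wD) w2_Tn. Qed.

(** * Words in the generators *)

Definition Tw p (r : seq nat) := foldr T p r.
Definition Tvw p (r : seq nat) := foldr Tv p r.
Definition in_range (r : seq nat) := all (fun j => j.+1 < N)%N r.
Definition far j (r : seq nat) := all (fun k => (j.+1 < k) || (k.+1 < j))%N r.

Lemma in_range_iota i k : (i + k < N)%N || (k == 0)%N -> in_range (iota i k).
Proof.
by move=> lt; apply/allP => j; rewrite mem_iota /=; lia.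
Qed.

Lemma far_iota j i k : (j.+1 < i)%N || (i + k < j)%N -> far j (iota i k).
Proof. by move=> H; apply/allP => l; rewrite mem_iota /=; lia. Qed.

Lemma far_rev j r : far j (rev r) = far j r.
Proof. exact: all_rev. Qed.

Lemma in_range_rev r : in_range (rev r) = in_range r.
Proof. exact: all_rev. Qed.

Lemma rev_iotaS i k : rev (iota i k.+1) = (i + k)%N :: rev (iota i k).
Proof. by rewrite -addn1 iotaD rev_cat. Qed.

Hypothesis t_neq0 : t != 0.

Lemma TwZ c p r : in_range r -> Tw (c *: p) r = c *: Tw p r.
Proof. by elim: r => //= j r IH /andP[ltj /IH ->]; rewrite TnZ. Qed.
Lemma TwD p f r : in_range r -> Tw (p + f) r = Tw p r + Tw f r.
Proof. by elim: r => //= j r IH /andP[ltj /IH ->]; rewrite TnD. Qed.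
Lemma TvwZ c p r : in_range r -> Tvw (c *: p) r = c *: Tvw p r.
Proof. by elim: r => //= j r IH /andP[ltj /IH ->]; rewrite TvnZ. Qed.
Lemma TvwD p f r : in_range r -> Tvw (p + f) r = Tvw p r + Tvw f r.
Proof. by elim: r => //= j r IH /andP[ltj /IH ->]; rewrite TvnD. Qed.

Lemma Tw_far j p r : (j.+1 < N)%N -> in_range r -> far j r ->
  Tw (T j p) r = T j (Tw p r).
Proof.
move=> ltj; elim: r => //= k r IH /andP[ltk rr] /andP[far_k far_r].
by rewrite IH // Tn_comm // orbC.
Qed.

Lemma Tvw_far j p r : (j.+1 < N)%N -> in_range r -> far j r ->
  Tvw (T j p) r = T j (Tvw p r).
Proof.
move=> ltj; elim: r => //= k r IH /andP[ltk rr] /andP[far_k far_r].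
by rewrite IH // Tvn_Tn_comm // orbC.
Qed.

Lemma Tw_shift i k j p : (i <= j)%N -> (j.+1 < i + k)%N -> (i + k < N)%N ->
  Tw (T j p) (iota i k) = T j.+1 (Tw p (iota i k)).
Proof.
elim: k i => [|k IH] i leij ltj ltN; first lia.
rewrite /=; have [ltij|eij] : (i < j)%N \/ i = j by lia.
  by rewrite IH 1?Tn_comm //; lia.
case: k IH ltj ltN => [|k] _ ltj ltN; first lia.
rewrite {}eij in leij ltj ltN *; rewrite /= Tw_far 1?Tn_braid //; try lia.
  by apply: in_range_iota; lia.
by apply: far_iota; lia.
Qed.

Lemma Tvw_shift i k j p : (i <= j)%N -> (j.+1 < i + k)%N -> (i + k < N)%N ->
  Tvw (T j p) (iota i k) = T j.+1 (Tvw p (iota i k)).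
Proof.
elim: k i => [|k IH] i leij ltj ltN; first lia.
rewrite /=; have [ltij|eij] : (i < j)%N \/ i = j by lia.
  by rewrite IH 1?Tvn_Tn_comm //; lia.
case: k IH ltj ltN => [|k] _ ltj ltN; first lia.
rewrite {}eij in leij ltj ltN *; rewrite /= Tvw_far 1?Tvn_braid //; try lia.
  by apply: in_range_iota; lia.
by apply: far_iota; lia.
Qed.

Lemma Tw_rev_shift i k j p : (i <= j)%N -> (j.+1 < i + k)%N -> (i + k < N)%N ->
  Tw (T j.+1 p) (rev (iota i k)) = T j (Tw p (rev (iota i k))).
Proof.
elim: k => [|k IH] leij ltj ltN; first lia.
rewrite rev_iotaS /=; have [ltjk|ejk] : (j.+1 < i + k)%N \/ (i + k = j.+1)%N by lia.
  by rewrite IH 1?Tn_comm //; lia.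
case: k IH ejk ltj ltN => [|k] _ ejk ltj ltN; first lia.
have ejk' : (i + k)%N = j by lia.
rewrite ejk rev_iotaS /= ejk' Tw_far.
- by rewrite -Tn_braid //; lia.
- lia.
- by rewrite in_range_rev in_range_iota //; lia.
- by rewrite far_rev far_iota //; lia.
Qed.

(** The operators xi and omega of the definitions, with words over iota in
    place of compositions over ordinals ([xiE], [omegaE]). *)
Definition xin i p : P :=
  t ^+ i *: Tw (w (Tvw p (iota 0 i))) (iota i (N.-1 - i)).
Definition omn i p : P :=
  t ^ (i.+1%:Z - N%:Z) *:
    Tw (Tw p (rev (iota i (N.-1 - i)))) (iota i (N.-1 - i)).

Lemma composeE (h : 'I_N -> P -> P) (F : nat -> P -> P) (r : seq 'I_N) p :
  (forall (i : 'I_N) f, h i f = F i f) -> compose h r p = foldr F p (map val r).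
Proof. by move=> hF; elim: r => //= i r <-; rewrite hF. Qed.

Lemma idx_fromE (i : 'I_N) : map val (idx_from i) = iota i (N.-1 - i).
Proof.
rewrite /idx_from -(filter_map val (fun j => (i <= j) && (j.+1 < N))%N).
rewrite val_enum_ord; apply: (irr_sorted_eq ltn_trans ltnn).
- by apply: sorted_filter; [exact: ltn_trans | exact: iota_ltn_sorted].
- exact: iota_ltn_sorted.
by move=> j; rewrite mem_filter !mem_iota; have := ltn_ord i; lia.
Qed.

Lemma idx_belowE (i : 'I_N) : map val (idx_below i) = iota 0 i.
Proof.
rewrite /idx_below -(filter_map val (fun j => j < i)%N).
rewrite val_enum_ord; apply: (irr_sorted_eq ltn_trans ltnn).
- by apply: sorted_filter; [exact: ltn_trans | exact: iota_ltn_sorted].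
- exact: iota_ltn_sorted.
by move=> j; rewrite mem_filter !mem_iota; have := ltn_ord i; lia.
Qed.

Lemma xiE (i : 'I_N) p : xi q t i p = xin i p.
Proof.
rewrite /xi /xin (composeE (F := T)) => [|j f]; last by rewrite TnE.
rewrite (composeE (F := Tv)) => [|j f]; last by rewrite TvnE.
by rewrite idx_fromE idx_belowE.
Qed.

Lemma omegaE (i : 'I_N) p : omega t i p = omn i p.
Proof.
rewrite /omega /omn !(composeE (F := T)) => [|j f|j f]; rewrite ?TnE //.
by rewrite map_rev idx_fromE.
Qed.

Lemma xin_T_above i j p : (i < j)%N -> (j.+1 < N)%N ->
  xin i (T j p) = T j (xin i p).
Proof.
move=> ltij ltj; rewrite /xin TnZ // Tvw_far //; last first.
- by apply: far_iota; lia.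
- by apply: in_range_iota; lia.
case: j ltij ltj => // j ltij ltj; rewrite w_Tn // Tw_shift //; lia.
Qed.

Lemma xin_T_below i j p : (j.+1 < i)%N -> (i < N)%N ->
  xin i (T j p) = T j (xin i p).
Proof.
move=> ltji lti; have ltj : (j.+1 < N)%N by lia.
rewrite /xin TnZ // Tvw_shift //; try lia.
rewrite w_Tn; last lia.
rewrite Tw_far //; first by apply: in_range_iota; lia.
by apply: far_iota; lia.
Qed.

Lemma xin_rec i p : (i.+1 < N)%N -> T i (xin i.+1 (T i p)) = t *: xin i p.
Proof.
move=> lti; rewrite /xin TnZ // scalerA -exprS; congr (_ *: _).
have -> : Tvw (T i p) (iota 0 i.+1) = Tvw p (iota 0 i).
  by rewrite -addn1 iotaD /Tvw foldr_cat /= TnK.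
by have -> : (N.-1 - i = (N.-1 - i.+1).+1)%N by lia.
Qed.

Lemma xinZ i c p : (i < N)%N -> xin i (c *: p) = c *: xin i p.
Proof.
move=> lti; rewrite /xin TvwZ; last by apply: in_range_iota; lia.
by rewrite wZ TwZ ?scalerA 1?mulrC //; apply: in_range_iota; lia.
Qed.

Lemma xinD i p f : (i < N)%N -> xin i (p + f) = xin i p + xin i f.
Proof.
move=> lti; rewrite /xin TvwD; last by apply: in_range_iota; lia.
by rewrite wD TwD ?scalerDr //; apply: in_range_iota; lia.
Qed.

Definition weight (z : nat -> K) p := forall i, (i < N)%N -> xin i p = z i *: p.

Definition intertwine (z : nat -> K) j p : P :=
  (z j - z j.+1) *: T j p + ((1 - t) * z j) *: p.

(** The combination of T_j and 1 that exchanges two weights follows from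
    t xi_j = T_j xi_{j+1} T_j. *)
Lemma weight_intertwine z j p : (j.+1 < N)%N -> weight z p ->
  weight (z \o adj_swap j) (intertwine z j p).
Proof.
move=> ltj zp i lti /=; rewrite /intertwine.
have [ltij|[eij|[eij1|gtij]]] : (i < j \/ i = j \/ i = j.+1 \/ j.+1 < i)%N by lia.
- have -> : adj_swap j i = i by adj_swap_lia.
  rewrite xinD // !xinZ // xin_T_above // zp // (TnZ _ (z i)) //.
  by rewrite scalerDr !scalerA ![_ * z i]mulrC.
- rewrite {}eij in lti *; rewrite /adj_swap eqxx.
  have T2 : T j (T j p) = (t - 1) *: T j p + t *: p by exact: Tn_quadratic.
  have xT : xin j (T j p) = ((t - 1) * z j) *: p + z j.+1 *: T j p.
    apply: (scalerI t_neq0); rewrite -xin_rec // T2 xinD // !xinZ // TnD //.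
    rewrite (TnZ _ (t - 1) _ ltj) (TnZ _ t _ ltj) (xin_rec _ ltj).
    rewrite (zp _ lti) (zp _ ltj) TnZ // scalerDr !scalerA.
    by congr (_ *: _ + _); ring.
  rewrite xinD // !xinZ // xT zp // !scalerDr !scalerA addrC addrA -scalerDl.
  by rewrite addrC; congr (_ *: _ + _ *: _); ring.
- rewrite {}eij1 in lti *; have -> : adj_swap j j.+1 = j by adj_swap_lia.
  have xT : xin j.+1 (T j p) = z j *: (T j p + (1 - t) *: p).
    apply: (can_inj (TnK t_neq0 ltj)); rewrite xin_rec // zp ?(ltnW ltj) //.
    rewrite (TnZ _ (z j)) // TnD // (TnZ _ (1 - t)) // Tn_quadratic //.
    rewrite -addrA [t *: p + _]addrC addrA -scalerDl.
    have -> : t - 1 + (1 - t) = 0 by ring.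
    by rewrite scale0r add0r !scalerA mulrC.
  rewrite xinD // !xinZ // xT zp // !scalerDr !scalerA -addrA -scalerDl.
  by congr (_ *: _ + _ *: _); ring.
- have -> : adj_swap j i = i by adj_swap_lia.
  rewrite xinD // !xinZ // xin_T_below // zp // (TnZ _ (z i)) //.
  by rewrite scalerDr !scalerA ![_ * z i]mulrC.
Qed.

(** * The raising operator *)

(** The affine raising operator: it rotates the weights and multiplies by q
    the one that comes last ([weight_raise]), so that it creates eigenvectors
    of higher degree from those of lower degree. *)
Definition raise p : P := x N.-1 * w p.

Lemma raiseZ c p : raise (c *: p) = c *: raise p.
Proof. by rewrite /raise [w _]wZ -scalerAr. Qed.

Lemma Tvw_var_far k f r : in_range r -> (k < N)%N ->
  all (fun j => (k != j) && (k != j.+1)) r ->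
  Tvw (x k * f) r = x k * Tvw f r.
Proof.
move=> + ltk; elim: r => //= j r IH /andP[ltj rr] /andP[/andP[kj kj1] kr].
by rewrite IH // Tvn_var_far.
Qed.

Lemma Tw_var_far k f r : in_range r -> (k < N)%N ->
  all (fun j => (k != j) && (k != j.+1)) r ->
  Tw (x k * f) r = x k * Tw f r.
Proof.
move=> + ltk; elim: r => //= j r IH /andP[ltj rr] /andP[/andP[kj kj1] kr].
by rewrite IH // Tn_var_far.
Qed.

Lemma Tvw_w i k f : (i + k < N.-1)%N || (k == 0)%N ->
  Tvw (w f) (iota i k) = w (Tvw f (iota i.+1 k)).
Proof.
elim: k i => //= k IH i lt; rewrite IH; last by lia.
by rewrite w_Tvn //; lia.
Qed.

Lemma Tw_w i k f : (i + k < N.-1)%N || (k == 0)%N ->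
  Tw (w f) (iota i k) = w (Tw f (iota i.+1 k)).
Proof.
elim: k i => //= k IH i lt; rewrite IH; last by lia.
by rewrite w_Tn //; lia.
Qed.

Lemma Tvw_varr k f : (k < N)%N ->
  Tvw (x k * f) (iota 0 k) = t ^- k *: (x 0 * Tw f (iota 0 k)).
Proof.
elim: k f => [|k IH] f ltk; first by rewrite expr0 invr1 scale1r.
have -> : iota 0 k.+1 = iota 0 k ++ [:: k] by rewrite -addn1 iotaD.
rewrite /Tvw foldr_cat /= Tvn_varr // -/(Tvw _ _).
rewrite TvwZ; last by apply: in_range_iota; lia.
by rewrite IH ?(ltnW ltk) // scalerA -invfM -exprS /Tw foldr_cat.
Qed.

Lemma xin_raise_last p : (0 < N)%N ->
  xin N.-1 (raise p) = q *: raise (xin 0 p).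
Proof.
move=> N_gt0; rewrite /xin /raise subnn /= Tvw_varr ?prednK // wZ scalerA.
rewrite mulfV ?expf_neq0 // !scale1r wM w_var0 // subn0.
by rewrite -scalerAl.
Qed.

Lemma xin_raise i p : q != 0 -> (i.+1 < N)%N ->
  xin i (raise p) = raise (xin i.+1 p).
Proof.
move=> q_neq0 lti; rewrite /xin /raise.
rewrite Tvw_var_far; first last.
- by apply/allP => j; rewrite mem_iota /=; lia.
- lia.
- by apply: in_range_iota; lia.
rewrite Tvw_w; last lia.
rewrite wM -[in w (x _)](@prednK N.-1); last lia.
rewrite w_varS; last lia.
have -> : (N.-1 - i = (N.-1 - i.+1) + 1)%N by lia.
rewrite iotaD /Tw foldr_cat -!/(Tw _ _) /=.
have -> : (i + (N.-1 - i.+1) = N.-2)%N by lia.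
rewrite Tn_varl //; last lia.
rewrite TwZ; last by apply: in_range_iota; lia.
rewrite prednK; last lia.
rewrite Tw_var_far; first last.
- by apply/allP => j; rewrite mem_iota /=; lia.
- lia.
- by apply: in_range_iota; lia.
rewrite -w2_Tvn //; last lia.
rewrite [w (t ^+ _ *: _)]wZ -scalerAr -Tw_w; last lia.
by rewrite scalerA -exprSr.
Qed.

Lemma weight_raise z p : q != 0 -> weight z p ->
  weight (fun i => if (i.+1 < N)%N then z i.+1 else q * z 0%N) (raise p).
Proof.
move=> q_neq0 zp i lti; case: ifP => [lti1|].
  by rewrite (xin_raise _ q_neq0 lti1) (zp _ lti1) raiseZ.
move=> nlt; have -> : i = N.-1 by lia.
have N_gt0 : (0 < N)%N by lia.
by rewrite (xin_raise_last _ N_gt0) (zp _ N_gt0) raiseZ scalerA.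
Qed.

End Cherednik.

(** * One variable isolated from the others *)

Section Isolate.
Variables (K : fieldType) (N : nat).
Local Notation PS := {mpoly K[N.+1]}.
Local Notation P := {mpoly K[N]}.
Implicit Types (p f g : PS) (i j k : nat).

Definition isolate_var (i : 'I_N.+1) (l : 'I_N.+1) : {poly P} :=
  oapp (fun k : 'I_N => ('X_k)%:P) 'X (unlift i l).

Definition isolate i p : {poly P} :=
  mmap (polyC \o @mpolyC N K) (isolate_var (inord i)) p.

HB.instance Definition _ i := GRing.RMorphism.copy (isolate i)
  (mmap (polyC \o @mpolyC N K) (isolate_var (inord i))).

Lemma isolateD i p f : isolate i (p + f) = isolate i p + isolate i f.
Proof. exact: rmorphD. Qed.
Lemma isolateB i p f : isolate i (p - f) = isolate i p - isolate i f.
Proof. exact: rmorphB. Qed.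
Lemma isolateM i p f : isolate i (p * f) = isolate i p * isolate i f.
Proof. exact: rmorphM. Qed.
Lemma isolateC i c : isolate i c%:MP = (c%:MP)%:P.
Proof. exact: mmapC. Qed.

Lemma isolate_var_nat i l : (i <= N)%N -> (l <= N)%N ->
  isolate i (var K N.+1 l) =
  if l == i then 'X else (var K N (unbump i l))%:P.
Proof.
move=> lei lel; have lel' : (l < N.+1)%N by [].
rewrite (varE K lel') /isolate mmapX mmap1U /isolate_var.
case: unliftP => [k|] /(congr1 val) /=; rewrite inordK // => ->.
  by rewrite -var_ord bumpK; case: eqP => // e; have := neq_bump i k; rewrite e eqxx.
by rewrite eqxx.
Qed.

Definition insert_mon (i k : nat) (m : 'X_{1..N}) : 'X_{1..N.+1} :=
  [multinom oapp m k (unlift (inord i) l) | l < N.+1].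
Definition delete_mon (i : nat) (m : 'X_{1..N.+1}) : 'X_{1..N} :=
  [multinom m (lift (inord i) l) | l < N].

Lemma insert_delete i (m : 'X_{1..N.+1}) : insert_mon i (m (inord i)) (delete_mon i m) = m.
Proof.
apply/mnmP => l; rewrite mnmE; case: unliftP => [k|] -> //=.
by rewrite mnmE.
Qed.

Lemma delete_insert i k (m : 'X_{1..N}) : delete_mon i (insert_mon i k m) = m.
Proof. by apply/mnmP => l; rewrite !mnmE liftK. Qed.

Lemma insert_mon_at i k (m : 'X_{1..N}) : insert_mon i k m (inord i) = k.
Proof. by rewrite mnmE unlift_none. Qed.

Lemma insert_mon_lift i k (m : 'X_{1..N}) (l : 'I_N) :
  insert_mon i k m (lift (inord i) l) = m l.
Proof. by rewrite mnmE liftK. Qed.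

Lemma isolateX i (m : 'X_{1..N.+1}) :
  isolate i 'X_[m] = ('X_[delete_mon i m])%:P * 'X^(m (inord i)).
Proof.
rewrite /isolate mmapX /mmap1 (bigD1_ord (inord i)) //= {1}/isolate_var.
rewrite unlift_none mulrC /=; congr (_ * _).
rewrite (mpolyXE_id K (delete_mon i m)) rmorph_prod; apply: eq_bigr => l _.
by rewrite /isolate_var liftK /= mnmE rmorphXn.
Qed.

(** Isolating the i-th variable is the isomorphism of K[x_0, ..., x_N] with a
    ring of polynomials in x_i over the others; on coefficients it inserts an
    exponent at position i. *)
Lemma coef_isolate i k p m : (isolate i p)`_k@_m = p@_(insert_mon i k m).
Proof.
rewrite [p]mpolyE !raddf_sum /= coef_sum raddf_sum /=; apply: eq_bigr => mon _.
rewrite -mul_mpolyC isolateM isolateC coefCM isolateX coefCM coefXn !mcoeffCM.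
congr (_ * _); rewrite mcoeffX; case: (k =P _) => [ek|nek].
  rewrite mulr1 mcoeffX; congr (_%:R); congr nat_of_bool; apply/eqP/eqP => [<-|->].
    by rewrite ek insert_delete.
  by rewrite delete_insert.
rewrite mulr0 mcoeff0; case: eqP => // e; case: nek.
by rewrite e insert_mon_at.
Qed.

Lemma rmorph_ext_isolate (R : comNzRingType)
    (f g : {rmorphism PS -> R}) :
  (forall c, f c%:MP = g c%:MP) ->
  (forall k, (k <= N)%N -> f (var K N.+1 k) = g (var K N.+1 k)) ->
  f =1 g.
Proof. exact: rmorph_ext_var. Qed.

Lemma isolate_swap_below i j p : (j.+1 < i)%N -> (i <= N)%N ->
  isolate i (swap j p) = map_poly (@swap K N j) (isolate i p).
Proof.
move=> ltj lei.
apply: (rmorph_ext_isolate (f := isolate i \o @swap K N.+1 j)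
                           (g := map_poly (@swap K N j) \o isolate i)).
  by move=> c; rewrite /= swapC !isolateC map_polyC /= swapC.
move=> l lel /=; rewrite swap_var ?isolate_var_nat //; try adj_swap_lia; try lia.
have -> : (adj_swap j l == i) = (l == i) by adj_swap_lia.
case: eqP => [_|/eqP nel]; first by rewrite map_polyX.
rewrite map_polyC /= swap_var; [|lia|rewrite /unbump; lia].
by congr (var K N _)%:P; rewrite /unbump; adj_swap_lia.
Qed.

Lemma isolate_swap_above i j p : (i <= j)%N -> (j.+2 < N.+1)%N ->
  isolate i (swap j.+1 p) = map_poly (@swap K N j) (isolate i p).
Proof.
move=> ltj ltj2.
apply: (rmorph_ext_isolate (f := isolate i \o @swap K N.+1 j.+1)
                           (g := map_poly (@swap K N j) \o isolate i)).
  by move=> c; rewrite /= swapC !isolateC map_polyC /= swapC.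
move=> l lel /=; rewrite swap_var ?isolate_var_nat //; try adj_swap_lia; try lia.
have -> : (adj_swap j.+1 l == i) = (l == i) by adj_swap_lia.
case: eqP => [_|/eqP nel]; first by rewrite map_polyX.
rewrite map_polyC /= swap_var; [|lia|rewrite /unbump; lia].
by congr (var K N _)%:P; rewrite /unbump; adj_swap_lia.
Qed.

Lemma isolate_swap_l i p : (i < N)%N -> isolate i (swap i p) = isolate i.+1 p.
Proof.
move=> lti.
apply: (rmorph_ext_isolate (f := isolate i \o @swap K N.+1 i)
                           (g := isolate i.+1)).
  by move=> c; rewrite /= swapC !isolateC.
move=> l lel /=; rewrite swap_var ?isolate_var_nat //; try adj_swap_lia; try lia.
have -> : (adj_swap i l == i) = (l == i.+1) by adj_swap_lia.
case: eqP => // /eqP nel.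
by congr (var K N _)%:P; rewrite /unbump; adj_swap_lia.
Qed.

Lemma isolate_swap_r i p : (i < N)%N -> isolate i.+1 (swap i p) = isolate i p.
Proof.
by move=> lti; rewrite -(isolate_swap_l _ lti) swapK.
Qed.

End Isolate.

(** * Equations with a linear factor *)

Section DivisionByLinearFactor.
Variable R : comNzRingType.
Implicit Types (u v a b c : R) (f g h : {poly R}).

Lemma coef_char_eq u v a b f g h M :
  (u%:P - v%:P) * h = a%:P * v%:P * f + (b%:P * u%:P - v%:P) * g ->
  (u - v) * h`_M = a * v * f`_M + (b * u - v) * g`_M.
Proof.
move=> /(congr1 (coefp M)); rewrite /coefp /= -!polyCM -!polyCB coefD.
by rewrite !coefCM.
Qed.

(** For f, g, h of degree at most M the equation determines the coefficient
    of degree M of the quotient h: this is how T_i acts on leading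
    coefficients. *)
Lemma lead_char_l u a c f g h M :
  ('X - u%:P) * h = (a * u)%:P * f + (c%:P * 'X - u%:P) * g ->
  f`_M.+1 = 0 -> g`_M.+1 = 0 -> h`_M.+1 = 0 -> h`_M = c * g`_M.
Proof.
move=> /(congr1 (coefp M.+1)) + f0 g0 h0; rewrite /coefp /=.
rewrite !mulrBl -mulrA coefB coefD coefB !coefCM !coefXM /= f0 g0 h0.
by rewrite !mulr0 !subr0 add0r.
Qed.

Lemma lead_char_r u a c f g h M :
  ('X - u%:P) * h = ('X - a%:P) * f - c%:P * 'X * g ->
  f`_M.+1 = 0 -> h`_M.+1 = 0 -> h`_M = f`_M - c * g`_M.
Proof.
move=> /(congr1 (coefp M.+1)) + f0 h0; rewrite /coefp /=.
rewrite !mulrBl -mulrA !coefB !coefCM !coefXM /= f0 h0.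
by rewrite !mulr0 !subr0.
Qed.

Lemma size_XsubC_mul_le u f B :
  (size (('X - u%:P) * f)%R <= B.+1)%N -> (size f <= B)%N.
Proof.
have [->|f0] := eqVneq f 0; first by rewrite size_poly0.
by rewrite mulrC size_Mmonic ?monicXsubC // size_XsubC addn2.
Qed.

Lemma size_char_l u a c f g h B :
  ('X - u%:P) * h = (a * u)%:P * f + (c%:P * 'X - u%:P) * g ->
  (size f <= B)%N -> (size g <= B)%N -> (size h <= B)%N.
Proof.
move=> e /leq_sizeP f0 /leq_sizeP g0; apply: (@size_XsubC_mul_le u).
apply/leq_sizeP => k ltk; rewrite e !mulrBl -mulrA coefD coefB !coefCM !coefXM.
rewrite f0 ?(ltnW ltk) // [g`_k]g0 ?(ltnW ltk) //; case: k ltk => // k ltk /=.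
by rewrite g0 // !mulr0 subrr addr0.
Qed.

Lemma size_char_r u a c f g h B :
  ('X - u%:P) * h = ('X - a%:P) * f - c%:P * 'X * g ->
  (size f <= B)%N -> (size g <= B)%N -> (size h <= B)%N.
Proof.
move=> e /leq_sizeP f0 /leq_sizeP g0; apply: (@size_XsubC_mul_le u).
apply/leq_sizeP => k ltk; rewrite e !mulrBl -mulrA !coefB !coefCM !coefXM.
rewrite [f`_k]f0 ?(ltnW ltk) //; case: k ltk => // k ltk /=.
by rewrite g0 // f0 // !mulr0 !subrr.
Qed.

End DivisionByLinearFactor.

(** * Coefficients of the powers of one variable *)

(** Locked, since conversion would otherwise compute with [isolate]. *)
HB.lock Definition coef_var (K : fieldType) (N : nat) (i M : nat)
    (p : {mpoly K[N.+1]}) : {mpoly K[N]} := (isolate i p)`_M.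

Section Restriction.
Variables (K : fieldType) (N : nat) (q t : K).
Local Notation PS := {mpoly K[N.+1]}.
Local Notation P := {mpoly K[N]}.
Local Notation x := (var K N).
Local Notation TS := (@Tn K N.+1 t).
Local Notation TvS := (@Tvn K N.+1 t).
Local Notation T := (@Tn K N t).
Local Notation Tv := (@Tvn K N t).
Local Notation wS := (@w K N.+1 q).
Local Notation w' := (@w K N q).
Implicit Types (p f g : PS) (i j k M : nat).

Lemma isolate_w i p : (i < N)%N ->
  isolate i (wS p) = map_poly w' (isolate i.+1 p).
Proof.
move=> lti; apply: (rmorph_ext_var (f := isolate i \o wS)
                                   (g := map_poly w' \o isolate i.+1)).
  by move=> c; rewrite /= wC !isolateC map_polyC /= wC.
have N_gt0 : (0 < N)%N by lia.
move=> [|k] ltk /=.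
  rewrite w_var0 // -mul_mpolyC isolateM isolateC !isolate_var_nat //; try lia.
  have -> : (N.+1.-1 == i) = false by lia.
  rewrite /= map_polyC /=.
  have -> : unbump i.+1 0 = 0%N by [].
  rewrite w_var0 // -mul_mpolyC polyCM; congr (_ * (x _)%:P).
  by rewrite /unbump; lia.
rewrite w_varS // !isolate_var_nat //; try lia.
rewrite eqSS; case: eqP => [_|/eqP nek]; first by rewrite map_polyX.
rewrite map_polyC /=.
have -> : unbump i.+1 k.+1 = (unbump i k).+1 by rewrite /unbump; lia.
by rewrite w_varS //; rewrite /unbump; lia.
Qed.

Lemma isolate_w_last p :
  isolate N (wS p) = isolate 0 p \Po (q%:MP *: 'X).
Proof.
apply: (rmorph_ext_var (f := isolate N \o wS)
          (g := comp_poly (q%:MP *: 'X) \o isolate 0)).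
  by move=> c; rewrite /= wC !isolateC comp_polyC.
move=> [|k] ltk /=.
  rewrite w_var0 // -mul_mpolyC isolateM isolateC !isolate_var_nat // !eqxx.
  by rewrite /= comp_polyX mul_polyC.
rewrite w_varS // !isolate_var_nat //; try lia.
have -> : (k == N) = false by lia.
rewrite comp_polyC; congr (x _)%:P; rewrite /unbump; lia.
Qed.

Local Notation coef_var := (@coef_var K N).

Lemma coef_varE i M p : coef_var i M p = (isolate i p)`_M.
Proof. by rewrite unlock. Qed.

Lemma mcoeff_coef_var i M p m :
  (coef_var i M p)@_m = p@_(insert_mon i M m).
Proof. by rewrite coef_varE coef_isolate. Qed.

Lemma coef_varZ i M c p : coef_var i M (c *: p) = c *: coef_var i M p.
Proof.
by rewrite !coef_varE -mul_mpolyC isolateM isolateC coefCM mul_mpolyC.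
Qed.

Lemma coef_varD i M p f :
  coef_var i M (p + f) = coef_var i M p + coef_var i M f.
Proof. by rewrite !coef_varE isolateD coefD. Qed.

Lemma coef_var_w i M p : (i < N)%N -> coef_var i M (wS p) = w' (coef_var i.+1 M p).
Proof. by move=> lti; rewrite !coef_varE isolate_w // coef_map. Qed.

Lemma coef_var_w_last M p :
  coef_var N M (wS p) = q ^+ M *: coef_var 0 M p.
Proof.
rewrite !coef_varE isolate_w_last comp_polyE coef_sum.
under eq_bigr => i _ do rewrite exprZn coefZ coefZ coefXn.
rewrite -mul_mpolyC rmorphXn /=; have [ltM|leM] := ltnP M (size (isolate 0 p)).
  rewrite (bigD1 (Ordinal ltM)) //= eqxx mulr1 big1 ?addr0 1?mulrC // => i.
  by rewrite -val_eqE /= eq_sym => /negbTE ->; rewrite !mulr0.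
rewrite [in RHS]nth_default // mulr0 big1 // => i _.
by rewrite (gtn_eqF (leq_trans (ltn_ord i) leM)) !mulr0.
Qed.

Lemma coef_var_T_below i M j p : (j.+1 < i)%N -> (i <= N)%N ->
  coef_var i M (TS j p) = T j (coef_var i M p).
Proof.
move=> ltj lei; apply: Tn_uniq; first lia.
rewrite !coef_varE.
have -> : swap j (isolate i p)`_M = (map_poly (@swap K N j) (isolate i p))`_M.
  by rewrite coef_map.
have ltj' : (j.+1 < N.+1)%N by lia.
apply: coef_char_eq.
have := congr1 (isolate i) (Tn_char t p ltj').
rewrite isolateD !isolateM !isolateB isolateM !isolateC.
rewrite !isolate_var_nat //; try lia.
have -> : (j == i) = false by lia.
have -> : (j.+1 == i) = false by lia.
have -> : unbump i j = j by rewrite /unbump; lia.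
have -> : unbump i j.+1 = j.+1 by rewrite /unbump; lia.
by rewrite (isolate_swap_below _ ltj lei).
Qed.

Lemma coef_var_T_above i M j p : (i <= j)%N -> (j.+2 < N.+1)%N ->
  coef_var i M (TS j.+1 p) = T j (coef_var i M p).
Proof.
move=> ltj lej; apply: Tn_uniq; first lia.
rewrite !coef_varE.
have -> : swap j (isolate i p)`_M = (map_poly (@swap K N j) (isolate i p))`_M.
  by rewrite coef_map.
apply: coef_char_eq.
have := congr1 (isolate i) (Tn_char t p lej).
rewrite isolateD !isolateM !isolateB isolateM !isolateC.
rewrite !isolate_var_nat //; try lia.
have -> : (j.+1 == i) = false by lia.
have -> : (j.+2 == i) = false by lia.
have -> : unbump i j.+1 = j by rewrite /unbump; lia.
have -> : unbump i j.+2 = j.+1 by rewrite /unbump; lia.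
by rewrite (isolate_swap_above _ ltj lej).
Qed.

Lemma coef_var_Tv_below i M j p : (j.+1 < i)%N -> (i <= N)%N ->
  coef_var i M (TvS j p) = Tv j (coef_var i M p).
Proof.
by move=> *; rewrite !Tvn_def coef_varZ coef_varD coef_varZ coef_var_T_below.
Qed.

Lemma coef_var_Tv_above i M j p : (i <= j)%N -> (j.+2 < N.+1)%N ->
  coef_var i M (TvS j.+1 p) = Tv j (coef_var i M p).
Proof.
by move=> *; rewrite !Tvn_def coef_varZ coef_varD coef_varZ coef_var_T_above.
Qed.

Lemma isolate_T_l i p : (i < N)%N ->
  ('X - (x i)%:P) * isolate i (TS i p) =
  ((1 - t)%:MP * x i)%:P * isolate i p
  + ((t%:MP)%:P * 'X - (x i)%:P) * isolate i.+1 p.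
Proof.
move=> lti; have lti' : (i.+1 < N.+1)%N by [].
have := congr1 (isolate i) (Tn_char t p lti').
rewrite isolateD !isolateM !isolateB isolateM !isolateC.
rewrite !isolate_var_nat //; try lia.
rewrite eqxx (isolate_swap_l _ lti) polyCM.
have -> : (i.+1 == i) = false by lia.
by have -> : unbump i i.+1 = i by rewrite /unbump; lia.
Qed.

Lemma isolate_T_r i p : (i < N)%N ->
  ('X - (x i)%:P) * isolate i.+1 (TS i p) =
  ('X - (t%:MP * x i)%:P) * isolate i p
  - ((1 - t)%:MP)%:P * 'X * isolate i.+1 p.
Proof.
move=> lti; have lti' : (i.+1 < N.+1)%N by [].
have := congr1 (isolate i.+1) (Tn_char t p lti').
rewrite isolateD !isolateM !isolateB isolateM !isolateC.
rewrite !isolate_var_nat //; try lia.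
rewrite eqxx (isolate_swap_r _ lti) polyCM.
have -> : (i == i.+1) = false by lia.
have -> : unbump i.+1 i = i by rewrite /unbump; lia.
move: (isolate _ (TS i p)) (isolate i.+1 p) (isolate i p) => h g f e.
by apply: oppr_inj; rewrite -mulNr opprB e; ring.
Qed.

Definition bounded B p := forall i M, (i <= N)%N -> (B <= M)%N ->
  coef_var i M p = 0.

Lemma boundedD B p f : bounded B p -> bounded B f -> bounded B (p + f).
Proof. by move=> bp bf i M *; rewrite coef_varD bp // bf // addr0. Qed.
Lemma boundedZ B c p : bounded B p -> bounded B (c *: p).
Proof. by move=> bp i M *; rewrite coef_varZ bp // scaler0. Qed.

Lemma size_boundP B p : bounded B p <->
  forall i, (i <= N)%N -> (size (isolate i p) <= B)%N.
Proof.
split=> [bp i lei|bp i M lei leB]; first by apply/leq_sizeP => M leM; rewrite -coef_varE bp.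
by rewrite coef_varE; have /leq_sizeP := bp i lei; apply.
Qed.

Lemma bounded_T B j p : (j.+1 < N.+1)%N -> bounded B p -> bounded B (TS j p).
Proof.
move=> ltj /[dup] bp /size_boundP sp i M lei leB.
have [ltji|[eij|[eij|ltij]]] : (j.+1 < i \/ i = j \/ i = j.+1 \/ i < j)%N by lia.
- by rewrite coef_var_T_below // bp // Tn0 //; lia.
- rewrite {}eij; have lej : (j <= N)%N by lia.
  rewrite coef_varE; suff /leq_sizeP/(_ M leB) : (size (isolate j (TS j p)) <= B)%N by [].
  by apply: (size_char_l (isolate_T_l _ _)); [lia | apply: sp | apply: sp].
- rewrite {}eij; have lej : (j <= N)%N by lia.
  rewrite coef_varE; suff /leq_sizeP/(_ M leB) : (size (isolate j.+1 (TS j p)) <= B)%N by [].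
  by apply: (size_char_r (isolate_T_r _ _)); [lia | apply: sp | apply: sp].
- case: j ltj ltij => // j ltj ltij.
  by rewrite coef_var_T_above // bp // Tn0.
Qed.

Lemma bounded_Tv B j p : (j.+1 < N.+1)%N -> bounded B p -> bounded B (TvS j p).
Proof.
move=> ltj bp; rewrite Tvn_def; apply/boundedZ/boundedD.
  exact: bounded_T.
exact: boundedZ.
Qed.

Lemma bounded_w B p : bounded B p -> bounded B (wS p).
Proof.
move=> bp i M lei leB; have [lti|eiN] : (i < N)%N \/ i = N by lia.
  by rewrite coef_var_w // bp // -mpolyC0 wC.
by rewrite eiN coef_var_w_last bp // scaler0.
Qed.

Lemma bounded_Tw B p r : in_range N.+1 r -> bounded B p ->
  bounded B (Tw t p r).
Proof.
move=> + bp; elim: r => [_|j r IH /andP[ltj /IH br]]; first exact: bp.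
exact: (bounded_T ltj br).
Qed.

Lemma bounded_Tvw B p r : in_range N.+1 r -> bounded B p ->
  bounded B (Tvw t p r).
Proof.
move=> + bp; elim: r => [_|j r IH /andP[ltj /IH br]]; first exact: bp.
exact: (bounded_Tv ltj br).
Qed.

(** On the coefficients of the highest power of one variable, T_i acts as on
    an induced module: it moves the distinguished variable from i to i + 1,
    as the lemmas below make precise. *)
Lemma coef_var_T_l i M p : (i < N)%N -> bounded M.+1 p ->
  coef_var i M (TS i p) = t *: coef_var i.+1 M p.
Proof.
move=> lti bp; have bT := bounded_T (lti : (i.+1 < N.+1)%N) bp.
rewrite -mul_mpolyC !coef_varE; apply: (lead_char_l (isolate_T_l p lti)).
- by rewrite -coef_varE bp //; lia.
- by rewrite -coef_varE bp.
- by rewrite -coef_varE bT //; lia.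
Qed.

Lemma coef_var_T_r i M p : (i < N)%N -> bounded M.+1 p ->
  coef_var i.+1 M (TS i p) = coef_var i M p + (t - 1) *: coef_var i.+1 M p.
Proof.
move=> lti bp; have bT := bounded_T (lti : (i.+1 < N.+1)%N) bp.
have e : coef_var i.+1 M (TS i p) =
    coef_var i M p - (1 - t)%:MP * coef_var i.+1 M p.
  rewrite !coef_varE; apply: (lead_char_r (isolate_T_r p lti)).
    by rewrite -coef_varE bp //; lia.
  by rewrite -coef_varE bT.
by rewrite e mul_mpolyC -scaleNr opprB.
Qed.

Lemma coef_var_Tv_r i M p : (i < N)%N -> bounded M.+1 p ->
  coef_var i.+1 M (TvS i p) = t^-1 *: coef_var i M p.
Proof.
move=> lti bp; rewrite Tvn_def coef_varZ coef_varD coef_varZ coef_var_T_r //.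
by rewrite -addrA -scalerDl addrA subrK subrr scale0r addr0.
Qed.

Hypothesis t_neq0 : t != 0.

Lemma coef_var_Tv_l i M p : (i < N)%N -> bounded M.+1 p ->
  coef_var i M p = 0 -> coef_var i M (TvS i p) = coef_var i.+1 M p.
Proof.
move=> lti bp p0; rewrite Tvn_def coef_varZ coef_varD coef_varZ coef_var_T_l //.
by rewrite p0 scaler0 addr0 scalerA mulVf // scale1r.
Qed.

Lemma coef_var_Tw_below i M p r : (i <= N)%N -> all (fun j => j.+1 < i)%N r ->
  coef_var i M (Tw t p r) = Tw t (coef_var i M p) r.
Proof.
move=> lei; elim: r => [//|j r IH /= /andP[ltj /IH <-]].
exact: coef_var_T_below.
Qed.

Lemma coef_var_Tvw_below i M p r : (i <= N)%N -> all (fun j => j.+1 < i)%N r ->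
  coef_var i M (Tvw t p r) = Tvw t (coef_var i M p) r.
Proof.
move=> lei; elim: r => [//|j r IH /= /andP[ltj /IH <-]].
exact: coef_var_Tv_below.
Qed.

Lemma coef_var_Tw_above i M p j k : (i <= j)%N -> (j + k < N)%N || (k == 0)%N ->
  coef_var i M (Tw t p (iota j.+1 k)) = Tw t (coef_var i M p) (iota j k).
Proof.
elim: k j => [//|k IH j leij lt] /=.
rewrite coef_var_T_above; [congr (T j _); apply: IH; lia|lia|lia].
Qed.

Lemma coef_var_Tvw_above i M p j k : (i <= j)%N -> (j + k < N)%N || (k == 0)%N ->
  coef_var i M (Tvw t p (iota j.+1 k)) = Tvw t (coef_var i M p) (iota j k).
Proof.
elim: k j => [//|k IH j leij lt] /=.
rewrite coef_var_Tv_above; [congr (Tv j _); apply: IH; lia|lia|lia].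
Qed.

Lemma coef_var_Tw_rev_above i M p j k :
  (i <= j)%N -> (j + k < N)%N || (k == 0)%N ->
  coef_var i M (Tw t p (rev (iota j.+1 k))) =
  Tw t (coef_var i M p) (rev (iota j k)).
Proof.
elim: k => [//|k IH leij lt]; rewrite !rev_iotaS addSn /=.
rewrite coef_var_T_above; [congr (T _ _); apply: IH; lia|lia|lia].
Qed.

(** The distinguished variable travels along the word. *)
Lemma coef_var_Tw_chain i k M p : (i + k <= N)%N -> bounded M.+1 p ->
  coef_var i M (Tw t p (iota i k)) = t ^+ k *: coef_var (i + k)%N M p.
Proof.
elim: k i => [|k IH] i lei bp; first by rewrite expr0 scale1r addn0.
have ltiN : (i < N)%N by lia.
rewrite /= coef_var_T_l //; last first.
  by apply: bounded_Tw => //; apply: in_range_iota; lia.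
by rewrite IH //; [rewrite scalerA -exprS addSnnS | lia].
Qed.

Lemma coef_var_Tvw_chain i k M p : (i + k <= N)%N -> bounded M.+1 p ->
  (forall l, (i <= l < i + k)%N -> coef_var l M p = 0) ->
  coef_var i M (Tvw t p (iota i k)) = coef_var (i + k)%N M p.
Proof.
elim: k i => [|k IH] i lei bp p0; first by rewrite addn0.
have ltiN : (i < N)%N by lia.
rewrite /= coef_var_Tv_l //.
- rewrite (IH i.+1) //; [by rewrite addSnnS | lia |].
  by move=> l ?; apply: p0; lia.
- by apply: bounded_Tvw => //; apply: in_range_iota; lia.
rewrite coef_var_Tvw_above //; last lia.
rewrite p0; last lia.
rewrite -(scale0r (0 : P)) TvwZ ?scale0r //.
by apply: in_range_iota; lia.
Qed.

(** Taking the coefficient of x_i^M, for the first i where it does not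
    vanish, turns a joint eigenvector in N + 1 variables into one in N
    variables: the operators xi_j with j different from i restrict to the
    operators of the smaller algebra ([coef_var_xin_below] for j below i),
    and xi_i acts by a scalar ([coef_var_xin_self]). *)
Lemma coef_var_xin_above i j M p : (i < j)%N -> (j <= N)%N -> bounded M.+1 p ->
  coef_var i M (xin q t j p) = xin q t j.-1 (coef_var i M p).
Proof.
move=> ltij lej bp; have [j' ej] : exists j', j = j'.+1 by exists j.-1; lia.
rewrite ej in ltij lej *; rewrite /xin coef_varZ -[N.+1.-1]/N -[j'.+1.-1]/j'.
rewrite coef_var_Tw_above //; last lia.
rewrite coef_var_w; last lia.
have -> : iota 0 j'.+1 = iota 0 i ++ i :: iota i.+1 (j' - i).
  by rewrite -[i :: _]/(iota i (j' - i).+1) -iotaD; congr iota; lia.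
rewrite /Tvw foldr_cat -!/(Tvw _ _ _) /= coef_var_Tvw_below; first last.
- by apply/allP => l; rewrite mem_iota; lia.
- lia.
rewrite coef_var_Tv_r; first last.
- by apply: bounded_Tvw => //; apply: in_range_iota; lia.
- lia.
rewrite coef_var_Tvw_above //; last lia.
rewrite TvwZ; last by apply: in_range_iota; lia.
rewrite wZ TwZ; last by apply: in_range_iota; lia.
rewrite scalerA exprSr mulfK //.
rewrite /Tvw -foldr_cat -iotaD -!/(Tvw _ _ _).
have -> : (i + (j' - i) = j')%N by lia.
by have -> : (N - j'.+1 = N.-1 - j')%N by lia.
Qed.

Lemma coef_var_xin_self i M p : (i <= N)%N -> bounded M.+1 p ->
  (forall l, (l < i)%N -> coef_var l M p = 0) ->
  coef_var i M (xin q t i p) = (q ^+ M * t ^+ N) *: coef_var i M p.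
Proof.
move=> lei bp p0; rewrite /xin coef_varZ /=.
have bT : bounded M.+1 (Tvw t p (iota 0 i)).
  by apply: bounded_Tvw => //; apply: in_range_iota; lia.
rewrite coef_var_Tw_chain; [|lia|exact: bounded_w].
rewrite subnKC // coef_var_w_last coef_var_Tvw_chain //.
by rewrite add0n !scalerA mulrA -exprD subnKC // mulrC.
Qed.

Lemma coef_var_xin_below i j M p : (j < i)%N -> (i <= N)%N -> bounded M.+1 p ->
  (forall l, (l < i)%N -> coef_var l M p = 0) ->
  coef_var i M (xin q t j p) = xin q t j (coef_var i M p).
Proof.
move=> ltji lei bp p0; case: i ltji lei p0 => // i ltji lei p0.
rewrite /xin coef_varZ; congr (_ *: _).
set g := Tvw t p _.
have bg : bounded M.+1 g by apply: bounded_Tvw => //; apply: in_range_iota; lia.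
have -> : (N.+1.-1 - j = (i - j) + (N - i.+1).+1)%N by lia.
rewrite iotaD /Tw foldr_cat -!/(Tw _ _ _) subnKC //= coef_var_Tw_below; first last.
- by apply/allP => l; rewrite mem_iota; lia.
- lia.
set h := Tw t (wS g) _.
have bh : bounded M.+1 h.
  by apply: bounded_Tw; [apply: in_range_iota; lia | exact: bounded_w].
rewrite coef_var_T_r //.
have -> : coef_var i.+1 M h = 0.
  rewrite coef_var_Tw_chain; [|lia|exact: bounded_w].
  rewrite subnKC // coef_var_w_last coef_var_Tvw_chain //.
  - by rewrite p0 ?scaler0.
  - lia.
  by move=> l ?; apply: p0; lia.
rewrite scaler0 addr0 coef_var_Tw_above //; last lia.
rewrite coef_var_w // /g coef_var_Tvw_below //; last first.
  by apply/allP => l; rewrite mem_iota; lia.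
rewrite /Tw -foldr_cat; congr foldr.
have e : i = (j + (i - j))%N by lia.
rewrite [X in _ ++ iota X _]e -iotaD.
by congr iota; lia.
Qed.

(** For i = 0 the Jucys-Murphy operators restrict as well, which makes it
    possible to truncate joint eigenvectors of both families. *)
Lemma coef_var0_omn j M p : (0 < j)%N -> (j <= N)%N ->
  coef_var 0 M (omn t j p) = omn t j.-1 (coef_var 0 M p).
Proof.
case: j => // j _ lej; rewrite /omn coef_varZ /=.
have e : (N - j.+1 = N.-1 - j)%N by lia.
rewrite coef_var_Tw_above //; last lia.
rewrite coef_var_Tw_rev_above //; last lia.
by rewrite e; congr (_ ^ _ *: _); lia.
Qed.

End Restriction.

(** * Exponents of monomials *)

Section LeadingExponents.
Variables (K : fieldType) (q t : K).
Hypothesis t_neq0 : t != 0.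

(** The exponent at a natural number index, 0 outside the range. *)
Definition mexp N (m : 'X_{1..N}) (j : nat) : nat :=
  oapp (fun i : 'I_N => m i) 0%N (insub j).

Lemma mexp_ord N (m : 'X_{1..N}) (i : 'I_N) : mexp m i = m i.
Proof. by rewrite /mexp valK. Qed.

Lemma mexp_insert N (m : 'X_{1..N}) i k j : (i <= N)%N -> (j < N)%N ->
  mexp (insert_mon i k m) (bump i j) = mexp m j.
Proof.
move=> lei ltj; pose j' := Ordinal ltj.
have -> : bump i j = lift (inord i) j' by rewrite /= inordK.
by rewrite mexp_ord insert_mon_lift -mexp_ord.
Qed.

Lemma mexp_insert_at N (m : 'X_{1..N}) i k : (i <= N)%N ->
  mexp (insert_mon i k m) i = k.
Proof.
move=> lei; have {2}-> : i = (inord i : 'I_N.+1) by rewrite inordK.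
by rewrite mexp_ord insert_mon_at.
Qed.

Definition exponents_below N B (p : {mpoly K[N]}) :=
  forall m, p@_m != 0 -> forall i, (m i < B)%N.

Lemma boundedP N B (p : {mpoly K[N.+1]}) :
  bounded B p <-> exponents_below B p.
Proof.
split=> [bp m pm i|bp i M lei leB].
  rewrite ltnNge; apply/negP => leB; case/negP: pm.
  rewrite -(insert_delete i m) -coef_isolate inord_val -coef_varE.
  by rewrite bp ?mcoeff0 // -ltnS.
apply/mpolyP => m; rewrite mcoeff_coef_var mcoeff0; apply/eqP.
apply/negP => /negP pm; have := bp _ pm (inord i).
by rewrite insert_mon_at ltnNge leB.
Qed.

Lemma top_degree N B (V : {mpoly K[N.+1]} -> Prop) (f : {mpoly K[N.+1]}) :
  V f -> f != 0 -> (forall p, V p -> bounded B p) ->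
  exists2 M, (M < B)%N /\ (forall p, V p -> bounded M.+1 p) &
    exists p i, [/\ V p, (i <= N)%N & coef_var i M p != 0].
Proof.
move=> Vf f0; elim: B => [|B IH] bV.
  have /boundedP bf := bV f Vf; exfalso.
  have [m fm] : exists m, f@_m != 0.
    by case: (EM (exists m, f@_m != 0)) => // /forallNP nf; case/eqP: f0;
       apply/mpolyP => m; rewrite mcoeff0; apply/eqP/negPn/negP/nf.
  by have := bf m fm ord0.
case: (EM (forall p, V p -> bounded B p)) => [bVB|].
  by have [M [ltM bM] H] := IH bVB; exists M => //; split=> //; apply: leqW.
move=> /existsNP[p /not_implyP[Vp nb]].
exists B; first by split.
move: nb => /existsNP[i /existsNP[M /not_implyP[lei /not_implyP[leB nz]]]].
exists p, i; split=> //; apply/eqP => e; case: nz.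
have [->//|ltBM] : M = B \/ (B < M)%N by lia.
exact: (bV p Vp).
Qed.

(** * Exponents of an arbitrary eigenvector *)

(** The list s sorts the indices by decreasing exponent, ties by increasing
    index. *)
Definition composition_order N (a : 'X_{1..N}) (s : seq nat) :=
  forall r, (r.+1 < N)%N ->
    let i := nth 0%N s r in let j := nth 0%N s r.+1 in
    (mexp a j < mexp a i)%N \/ (mexp a i = mexp a j /\ (i < j)%N).

Lemma perm_bump i N : (i <= N)%N ->
  perm_eq (i :: map (bump i) (iota 0 N)) (iota 0 N.+1).
Proof.
move=> lei; apply: uniq_perm; first 2 last.
- move=> j; rewrite inE mem_iota /=; apply/orP/idP => [[/eqP->//|]|ltj].
    by move=> /mapP[k]; rewrite mem_iota /= => ltk ->; rewrite /bump; lia.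
  have [->|neji] := eqVneq j i; [by left | right].
  apply/mapP; exists (unbump i j); last by rewrite unbumpK.
  by rewrite mem_iota /unbump /=; lia.
- rewrite /= map_inj_uniq ?iota_uniq ?andbT; last exact: (can_inj (bumpK i)).
  by apply/mapP => -[k _ e]; have := neq_bump i k; rewrite -e eqxx.
- exact: iota_uniq.
Qed.

Lemma weight_coef_var N (z : nat -> K) (g : {mpoly K[N.+1]}) i M :
  (i <= N)%N -> bounded M.+1 g ->
  (forall l, (l < i)%N -> coef_var l M g = 0) -> weight q t z g ->
  weight q t (z \o bump i) (coef_var i M g).
Proof.
move=> lei bg g0 zg j ltj; rewrite /= /bump.
have [leij|ltji] := leqP i j.
  rewrite add1n -coef_varZ -zg // coef_var_xin_above //.
rewrite add0n -coef_varZ -zg; last lia.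
by rewrite coef_var_xin_below.
Qed.

(** Induction on the number of variables: the first variable i of maximal
    degree M over all variables gets rank 0 and weight q^M t^(N-1) by
    [coef_var_xin_self], and the coefficient of x_i^M carries the remaining
    weights. *)
Lemma eigenvector_exponents N (z : nat -> K) (g : {mpoly K[N]}) :
  g != 0 -> weight q t z g ->
  exists (a : 'X_{1..N}) (s : seq nat),
    [/\ g@_a != 0, perm_eq s (iota 0 N), composition_order a s &
        forall r, (r < N)%N ->
          z (nth 0%N s r) = q ^+ mexp a (nth 0%N s r) * t ^+ (N.-1 - r)].
Proof.
elim: N z g => [|N IH] z g g0 zg.
  exists 0%MM, [::]; split=> //.
  apply: contra g0 => /eqP e; apply/eqP/mpolyP => m; rewrite mcoeff0 -[RHS]e.
  by congr (_@__); apply/mnmP => -[].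
have [B /boundedP bB] : exists B, exponents_below B g.
  exists (msize g) => m gm i.
  have /msize_mdeg_lt lt : m \in msupp g by rewrite mcoeff_msupp.
  by apply: leq_ltn_trans lt; rewrite mdegE (bigD1 i) //= leq_addr.
have [M [_ bM] [p [i0 [-> lei0 gi0]]]] :=
  top_degree (V := fun p => p = g) (erefl g) g0 (fun p e => eq_ind_r _ bB e).
have {}bM := bM g erefl.
have ex : exists i, (i <= N)%N && (coef_var i M g != 0).
  by exists i0; rewrite lei0.
case: (ex_minnP ex) => i /andP[lei gi] mini.
have small l : (l < i)%N -> coef_var l M g = 0.
  move=> ltl; apply/eqP; apply: contraT => nz.
  by have := mini l; rewrite nz andbT; lia.
have [a [s [ga ps os zs]]] := IH _ _ gi (weight_coef_var lei bM small zg).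
have ss : size s = N by rewrite (perm_size ps) size_iota.
have gins : g@_(insert_mon i M a) != 0.
  by rewrite -mcoeff_coef_var.
have nths r : (r < N)%N -> (nth 0%N s r < N)%N.
  move=> ltr; have : nth 0%N s r \in s by rewrite mem_nth // ss.
  by rewrite (perm_mem ps) mem_iota.
have nthE r : (r < N)%N ->
    nth 0%N (map (bump i) s) r = bump i (nth 0%N s r).
  by move=> ltr; rewrite (nth_map 0%N) // ss.
exists (insert_mon i M a), (i :: map (bump i) s); split=> //.
- apply: perm_trans (perm_bump lei); rewrite perm_cons.
  exact: perm_map.
- case=> [|r] ltr; last first.
    rewrite /= !nthE //; last exact: ltnW.
    rewrite !mexp_insert ?nths //; last exact: ltnW.
    by case: (os r ltr) => [|[-> lt]]; [left | right; split=> //]; rewrite /bump; lia.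
  rewrite /= nthE // mexp_insert ?nths // mexp_insert_at //.
  set b := bump i _; have ltb : (b <= N)%N.
    by rewrite /b /bump; have := nths 0%N ltr; lia.
  have bE : mexp a (nth 0%N s 0) = mexp (insert_mon i M a) b.
    by rewrite /b mexp_insert // nths.
  have bord : b = (inord b : 'I_N.+1) by rewrite inordK.
  have : (mexp (insert_mon i M a) b < M.+1)%N.
    by rewrite bord mexp_ord; move/boundedP: bM; apply.
  rewrite ltnS leq_eqVlt bE => /orP[/eqP e|]; [right; split=> // | by left].
  have neb : b != i by rewrite /b eq_sym neq_bump.
  rewrite ltn_neqAle eq_sym neb leqNgt; apply/negP => ltbi.
  have := small b ltbi => /(congr1 (mcoeff (delete_mon b (insert_mon i M a)))).
  rewrite mcoeff0 mcoeff_coef_var.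
  have {1}<- : insert_mon i M a (inord b) = M by rewrite -mexp_ord -bord.
  by rewrite insert_delete => /eqP; apply/negP.
- case=> [|r] ltr.
    rewrite /= mexp_insert_at // subn0.
    have := coef_var_xin_self q t_neq0 lei bM small.
    rewrite zg // coef_varZ => /eqP.
    by rewrite -subr_eq0 -scalerBl scaler_eq0 (negbTE gi) orbF subr_eq0 => /eqP.
  rewrite /= nthE // mexp_insert ?nths //.
  have := zs r ltr => /= ->; congr (_ * t ^+ _); lia.
Qed.

(** * Exponents realised by a module *)

Definition joint_weight N (z : nat -> K) (g : {mpoly K[N]}) :=
  forall i, (i < N)%N -> xin q t i g = z i *: g /\ omn t i g = z i *: g.

(** In a T-stable space the variable of maximal degree can be moved to the
    front by the operators T_j, so that the coefficients of x_0^M form a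
    nonzero space of the same kind in one variable fewer. Hence a weight is
    realised whose exponents do not increase, and the last n entries of this
    weight are the joint weight of an eigenvector in n variables, for every
    n. The bound for the exponent M 0 is kept in order to recognise
    constants. *)
Lemma module_exponents N B (V : {mpoly K[N]} -> Prop)
    (W : (nat -> K) -> Prop) f0 :
  (forall f, V f -> forall j, (j.+1 < N)%N -> V (Tn t j f)) ->
  V f0 -> f0 != 0 -> (forall f, V f -> exponents_below B f) ->
  (forall f, V f -> exists2 r : seq {mpoly K[N]}, f = \sum_(g <- r) g &
     forall g, g \in r -> V g /\ exists2 z, W z & joint_weight z g) ->
  exists z M,
    [/\ W z, (forall i, (i < N)%N -> z i = q ^+ M i * t ^+ (N.-1 - i)),
        (forall i, (i.+1 < N)%N -> (M i.+1 <= M i)%N),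
        (0 < N)%N -> (M 0%N < B)%N /\
          (forall f, V f -> exponents_below (M 0%N).+1 f) &
        forall n, (n <= N)%N -> exists2 g : {mpoly K[n]}, g != 0 &
          joint_weight (fun i => z (N - n + i)%N) g].
Proof.
elim: N B V W f0 => [|N IH] B V W f0 TV Vf0 f0_neq0 bV sV.
  have [[|g r] e H] := sV f0 Vf0.
    by case/eqP: f0_neq0; rewrite e big_nil.
  have [_ [z Wz _]] := H g (mem_head _ _).
  exists z, (fun=> 0%N); split=> // n; rewrite leqn0 => /eqP->.
  by exists f0.
have bV' f : V f -> bounded B f by move=> Vf; apply/boundedP/bV.
have [M [ltMB bM] [p [l [Vp lel pl]]]] := top_degree Vf0 f0_neq0 bV'.
pose A := @coef_var K N 0 M.
pose V' f := exists2 g, V g & f = A g.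
pose W' z' := exists z, [/\ W z, z' = (fun i => z i.+1), z 0%N = q ^+ M * t ^+ N
   & exists2 g : {mpoly K[N.+1]}, g != 0 & joint_weight z g].
have VTw f i k : (i + k < N.+1)%N -> V f -> V (Tw t f (iota i k)).
  elim: k i => [//|k IHk] i lt Vf.
  by apply: TV; [apply: IHk => //; lia | lia].
have [] := IH M.+1 V' W' (A (Tw t p (iota 0 l))).
- move=> _ [g Vg ->] j ltj; exists (Tn t j.+1 g); first exact: TV.
  by rewrite /A coef_var_T_above.
- by exists (Tw t p (iota 0 l)) => //; apply: VTw.
- rewrite /A coef_var_Tw_chain //; last exact: bM.
  by rewrite scaler_eq0 expf_eq0 (negbTE t_neq0) andbF.
- move=> _ [g Vg ->] m; rewrite /A mcoeff_coef_var => gm i.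
  have /boundedP/(_ _ gm (lift (inord 0) i)) := bM g Vg.
  by rewrite insert_mon_lift.
- move=> _ [g Vg ->]; have [r -> Hr] := sV g Vg.
  exists [seq A h | h <- r & A h != 0].
    rewrite big_map big_filter [RHS]big_mkcond /=.
    rewrite (_ : A _ = \sum_(h <- r) A h); last first.
      rewrite /A; elim: (r) => [|h r' IHr]; last by rewrite !big_cons coef_varD IHr.
      by rewrite !big_nil -(scale0r 0) coef_varZ !scale0r.
    by apply: eq_bigr => h _; case: eqP => // ->.
  move=> y /mapP[h]; rewrite mem_filter => /andP[Ah hr] ->.
  have [Vh [z Wz zh]] := Hr h hr; split; first by exists h.
  exists (fun i => z i.+1).
    exists z; split=> //; last first.
      by exists h => //; apply: contra Ah => /eqP->; rewrite /A -(scale0r 0) coef_varZ !scale0r.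
    have /(_ _)/wrap[//|] := coef_var_xin_self q t_neq0 (leq0n N) (bM h Vh).
    rewrite (zh 0%N _).1 // coef_varZ.
    move=> /eqP; rewrite -subr_eq0 -scalerBl scaler_eq0 (negbTE Ah) orbF subr_eq0.
    by move=> /eqP.
  move=> i lti; have [zx zo] := zh i.+1 lti; split.
    have := coef_var_xin_above q t_neq0 (ltn0Sn i) lti (bM h Vh).
    by rewrite zx coef_varZ => <-.
  have := coef_var0_omn t_neq0 M h (ltn0Sn i) lti.
  by rewrite zo coef_varZ => <-.
move=> z' [M' [[z [Wz -> z0 [g0 g0_neq0 zg0]]] zM' monM' ltM' trunc]].
exists z, (fun i => if i is k.+1 then M' k else M); split=> //.
- case=> [|i] lti; first by rewrite subn0.
  by rewrite (zM' i lti); congr (_ * _ ^+ _); lia.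
- case=> [|i] lti; last exact: monM'.
  by have [] := ltM' lti.
- by split=> // f /bM/boundedP.
move=> n len; have [->|ltn] : n = N.+1 \/ (n <= N)%N by lia.
  by exists g0 => //; rewrite subnn.
have [g g_neq0 zg] := trunc n ltn; exists g => // i lti.
by rewrite subSn //; apply: zg.
Qed.

End LeadingExponents.

(** * Evaluation at (1, t, ..., t^(N-1)) *)

Section PrincipalEvaluation.
Variables (K : fieldType) (N : nat) (t : K).
Hypotheses (t_neq0 : t != 0) (t_neq1 : t != 1).
Local Notation P := {mpoly K[N]}.

Definition pev (p : P) : K := p.@[fun i : 'I_N => t ^+ i].

Lemma pevZ c p : pev (c *: p) = c * pev p. Proof. exact: mevalZ. Qed.
Lemma pevD p f : pev (p + f) = pev p + pev f. Proof. exact: mevalD. Qed.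
Lemma pevM p f : pev (p * f) = pev p * pev f. Proof. exact: rmorphM. Qed.

Lemma pev_var j : (j < N)%N -> pev (var K N j) = t ^+ j.
Proof. by move=> ltj; rewrite (varE K ltj) /pev mevalXU. Qed.

(** The factor t x_j - x_(j+1) of the exchanged polynomial vanishes at (1, t,
    t^2, ...), hence T_j acts by t on the evaluation. *)
Lemma pev_T j p : (j.+1 < N)%N -> pev (Tn t j p) = t * pev p.
Proof.
move=> ltj; have := congr1 pev (Tn_char t p ltj).
rewrite pevD !pevM /pev !mevalB mevalM !mevalC -!/(pev _).
rewrite !pev_var ?(ltnW ltj) // => e.
apply: (mulfI (x := t ^+ j - t ^+ j.+1)).
  have -> : t ^+ j - t ^+ j.+1 = t ^+ j * (1 - t) by rewrite exprS; ring.
  by rewrite mulf_neq0 ?expf_neq0 // subr_eq0 eq_sym.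
by rewrite e exprS subrr mul0r addr0; ring.
Qed.

Lemma pev_Tw p r : in_range N r -> pev (Tw t p r) = t ^+ size r * pev p.
Proof.
elim: r => [_|j r IH /= /andP[ltj /IH e]]; first by rewrite expr0 mul1r.
by rewrite pev_T // e mulrA exprS.
Qed.

Lemma pev_raise q p : (0 < N)%N -> pev (raise q p) = pev (xin q t 0 p).
Proof.
move=> N_gt0; rewrite /raise /xin expr0 scale1r pevM pev_var ?prednK //=.
by rewrite pev_Tw ?size_iota ?subn0 //; apply: in_range_iota; lia.
Qed.

Lemma pev_omn i p : (i < N)%N -> pev (omn t i p) = t ^+ (N.-1 - i) * pev p.
Proof.
move=> lti; rewrite /omn pevZ !pev_Tw ?in_range_rev; try by apply: in_range_iota; lia.
rewrite size_rev size_iota !mulrA; congr (_ * _).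
rewrite !exprnP -!expfzDr //; congr (t ^ _); lia.
Qed.

End PrincipalEvaluation.

(** * Families of polynomials, polynomial in a parameter *)

Section Families.
Variables (K : fieldType) (N : nat) (t : K).
Local Notation P := {mpoly K[N]}.
Implicit Types (e f : K -> P).

Definition poly_family e := exists E : {poly P}, forall u, e u = E.[u%:MP].

Lemma poly_family_const (p : P) : poly_family (fun=> p).
Proof. by exists p%:P => u; rewrite hornerC. Qed.

Lemma poly_family_D e f :
  poly_family e -> poly_family f -> poly_family (fun u => e u + f u).
Proof. by move=> [E eE] [F fF]; exists (E + F) => u; rewrite eE fF hornerD. Qed.

Lemma poly_family_mul (p : P) e :
  poly_family e -> poly_family (fun u => p * e u).
Proof. by move=> [E eE]; exists (p%:P * E) => u; rewrite eE hornerM hornerC. Qed.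

Lemma poly_family_scale (c : {poly K}) e :
  poly_family e -> poly_family (fun u => c.[u] *: e u).
Proof.
move=> [E eE]; exists (map_poly (@mpolyC N K) c * E) => u.
by rewrite eE hornerM horner_map mul_mpolyC.
Qed.

Lemma poly_family_linear (L : P -> P) e :
  (forall a (p r : P), L (a *: p + r) = a *: L p + L r) ->
  poly_family e -> poly_family (fun u => L (e u)).
Proof.
move=> Ll [E eE]; exists (\poly_(k < size E) L E`_k) => u.
have L0 : L 0 = 0.
  by apply: (addrI (1 *: L 0)); rewrite -Ll !scale1r !addr0.
rewrite eE horner_coef horner_poly.
elim/big_rec2: _ => [|k y x _ <-]; first by rewrite L0.
by rewrite -!rmorphXn /= ![_ * (u ^+ k)%:MP]mulrC !mul_mpolyC Ll.
Qed.

(** The shift w with the variable of {poly P} in place of q. *)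
Definition w_generic : P -> {poly P} :=
  mmap (polyC \o @mpolyC N K)
    (fun l : 'I_N => if val l == 0%N then (var K N N.-1)%:P * 'X
                     else (var K N l.-1)%:P).

HB.instance Definition _ := GRing.RMorphism.copy w_generic
  (mmap (polyC \o @mpolyC N K)
    (fun l : 'I_N => if val l == 0%N then (var K N N.-1)%:P * 'X
                     else (var K N l.-1)%:P)).

Lemma w_genericE u p : w u p = (w_generic p).[u%:MP].
Proof.
apply: (rmorph_ext_var (f := @w K N u)
          (g := horner_eval (u%:MP : P) \o w_generic)).
  by move=> c; rewrite /= wC /w_generic mmapC /horner_eval hornerC.
move=> k ltk; rewrite /= {2}(varE K ltk) /w_generic mmapX mmap1U /horner_eval /=.
case: k ltk => [|k] ltk /=.
  by rewrite w_var0 // hornerM hornerC hornerX -mul_mpolyC mulrC.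
by rewrite w_varS // hornerC.
Qed.

Lemma poly_family_w e : poly_family e -> poly_family (fun u => w u (e u)).
Proof.
move=> [E eE]; exists (\sum_(k < size E) w_generic E`_k * 'X^k) => u.
rewrite eE horner_coef horner_sum rmorph_sum /=; apply: eq_bigr => k _.
rewrite wM -rmorphXn /= wC hornerM hornerXn rmorphXn /=; congr (_ * _).
exact: w_genericE.
Qed.

Lemma poly_family_raise e : poly_family e -> poly_family (fun u => raise u (e u)).
Proof. by move=> /poly_family_w /poly_family_mul; apply. Qed.

End Families.

(** * Monomials with exponents 0 and M *)

Section Rectangle.
Variables (K : fieldType) (N' : nat) (t : K).
Local Notation N := N'.+1.
Local Notation P := {mpoly K[N]}.

Definition mono M (S : nat -> bool) : 'X_{1..N} :=
  [multinom (if S i then M else 0%N) | i < N].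

Lemma mexp_mono M S i : (i < N)%N -> mexp (mono M S) i = if S i then M else 0%N.
Proof. by move=> lti; rewrite (mexp_ord _ (Ordinal lti)) mnmE. Qed.

Lemma mexp_inj (a b : 'X_{1..N}) :
  (forall i, (i < N)%N -> mexp a i = mexp b i) -> a = b.
Proof. by move=> e; apply/mnmP => i; rewrite -!mexp_ord e. Qed.

Lemma mexp_delete (a : 'X_{1..N}) i j : (i <= N')%N -> (j < N')%N ->
  mexp (delete_mon i a) j = mexp a (bump i j).
Proof.
move=> lei ltj; rewrite (mexp_ord _ (Ordinal ltj)) mnmE.
by rewrite -mexp_ord /= inordK.
Qed.

Lemma mono_swap M S i : (i < N')%N ->
  insert_mon i.+1 (if S i then M else 0%N) (delete_mon i (mono M S)) =
  mono M (S \o adj_swap i).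
Proof.
move=> lti; apply: mexp_inj => j ltj; rewrite mexp_mono //=.
have [->|neji] := eqVneq j i.+1.
  by rewrite mexp_insert_at //; have -> : adj_swap i i.+1 = i by adj_swap_lia.
have ej : bump i.+1 (unbump i.+1 j) = j by rewrite unbumpKcond (negbTE neji).
rewrite -[X in mexp _ X]ej.
have ltu : (unbump i.+1 j < N')%N by rewrite /unbump; lia.
rewrite mexp_insert // mexp_delete; [|lia|by []].
rewrite mexp_mono; last by rewrite /bump; lia.
by congr (if S _ then _ else _); rewrite /bump /unbump; adj_swap_lia.
Qed.

Lemma low_char (R : comNzRingType) (u a c : R) (f g h : {poly R}) :
  ('X - u%:P) * h = (a * u)%:P * f + (c%:P * 'X - u%:P) * g ->
  u * h`_0 = u * (g`_0 - a * f`_0).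
Proof.
move=> /(congr1 (coefp 0)); rewrite /coefp /=.
rewrite !mulrBl -mulrA coefB coefD coefB !coefCM !coefXM /= mulr0 !sub0r => e.
by apply: oppr_inj; rewrite e; ring.
Qed.

Lemma coef_T_low i (p : P) : (i < N')%N ->
  coef_var i 0 (Tn t i p) = coef_var i.+1 0 p - (1 - t) *: coef_var i 0 p.
Proof.
move=> lti; rewrite !coef_varE -mul_mpolyC.
have nz : var K N' i != 0.
  apply/eqP; rewrite (varE K lti) => /(congr1 (mcoeff U_(Ordinal lti)%MM)).
  by rewrite mcoeffXU eqxx mcoeff0 => /eqP; rewrite oner_eq0.
by have := low_char (isolate_T_l t p lti) => /(mulfI nz).
Qed.

(** The action on the monomials with exponents 0 and M is that of the Hecke
    algebra on a permutation module. *)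
Lemma coef_T_mono M S i (p : P) : (i < N')%N -> exponents_below M.+1 p ->
  (Tn t i p)@_(mono M S) =
  if S i then t * p@_(mono M (S \o adj_swap i))
  else p@_(mono M (S \o adj_swap i)) + (t - 1) * p@_(mono M S).
Proof.
move=> lti /boundedP bp; have lei := ltnW lti.
have at_i : mono M S (inord i) = if S i then M else 0%N.
  by rewrite mnmE inordK.
have ins : insert_mon i (if S i then M else 0%N) (delete_mon i (mono M S)) =
    mono M S by rewrite -at_i insert_delete.
have := mono_swap M S lti; case: (S i) ins => ins <-.
  have := congr1 (mcoeff (delete_mon i (mono M S))) (coef_var_T_l t lti bp).
  by rewrite mcoeffZ !mcoeff_coef_var ins.
have := congr1 (mcoeff (delete_mon i (mono M S))) (coef_T_low p lti).
rewrite mcoeffB mcoeffZ !mcoeff_coef_var ins => ->.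
by rewrite -mulNr opprB.
Qed.

(** * Iterated raising *)

Lemma coef_raise u (p : P) (a : 'X_{1..N}) :
  (raise u p)@_a =
  (if mexp a N' == 0%N then 0 else u ^+ (mexp a N').-1) *
  p@_(insert_mon 0 (mexp a N').-1 (delete_mon N' a)).
Proof.
have aN : a (inord N') = mexp a N' by rewrite -mexp_ord inordK.
rewrite -{1}(insert_delete N' a) aN -coef_isolate /raise isolateM.
rewrite isolate_var_nat // eqxx coefXM; case: eqP => [_|_].
  by rewrite mcoeff0 mul0r.
by rewrite -coef_varE coef_var_w_last mcoeffZ mcoeff_coef_var.
Qed.

Definition rotate_mon k (a : 'X_{1..N}) : 'X_{1..N} :=
  [multinom (if (i < k)%N then (mexp a (N - k + i)).-1 else mexp a (i - k))
     | i < N].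

Lemma mexp_rotate k a i : (i < N)%N ->
  mexp (rotate_mon k a) i =
  if (i < k)%N then (mexp a (N - k + i)).-1 else mexp a (i - k).
Proof. by move=> lti; rewrite (mexp_ord _ (Ordinal lti)) mnmE. Qed.

(** Raising k times rotates the first k exponents to the end and increases
    them by one. The last two conditions give the factor c for the monomials
    with exponents 0 and M + 1. *)
Lemma coef_iter_raise k u (p : P) (a : 'X_{1..N}) M : (k <= N)%N ->
  exists c, [/\ (iter k (raise u) p)@_a = c * p@_(rotate_mon k a),
    (exists2 i, (N - k <= i < N)%N & mexp a i = 0%N) -> c = 0 &
    (forall i, (N - k <= i < N)%N -> mexp a i = M.+1) -> c = u ^+ (k * M)].
Proof.
elim: k a => [|k IH] a lek.
  exists 1; split=> [|[k ltk _]|_]; last by rewrite mul0n.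
    rewrite mul1r /=; congr mcoeff; apply: mexp_inj => i lti.
    by rewrite mexp_rotate // ltn0 subn0.
  lia.
set a1 := insert_mon 0 (mexp a N').-1 (delete_mon N' a).
have a10 : mexp a1 0 = (mexp a N').-1 by rewrite mexp_insert_at.
have a1S i : (i < N')%N -> mexp a1 i.+1 = mexp a i.
  move=> lti; have -> : i.+1 = bump 0 i by [].
  rewrite mexp_insert // mexp_delete //.
  by congr (mexp a _); rewrite /bump; lia.
have [c [e c0 cM]] := IH a1 (ltnW lek).
exists ((if mexp a N' == 0%N then 0 else u ^+ (mexp a N').-1) * c); split.
- rewrite iterS coef_raise -/a1 e mulrA; congr (_ * mcoeff _ _).
  apply: mexp_inj => i lti; rewrite !mexp_rotate //.
  have [ltik|leki] := ltnP i k.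
    rewrite ltnS (ltnW ltik).
    have -> : (N - k + i = (N - k.+1 + i).+1)%N by lia.
    by rewrite a1S //; lia.
  have [->|ltki] : i = k \/ (k < i)%N by lia.
    by rewrite ltnSn subnn a10; congr (mexp a _).-1; lia.
  have -> : (i < k.+1)%N = false by lia.
  have -> : (i - k = (i - k.+1).+1)%N by lia.
  by rewrite a1S //; lia.
- move=> [i ri ai]; have [eiN|ltiN] : i = N' \/ (i < N')%N by lia.
    by rewrite eiN in ai; rewrite ai eqxx mul0r.
  rewrite c0 ?mulr0 //; exists i.+1; [lia | by rewrite a1S].
- move=> aM; rewrite aM /=; last lia.
  rewrite cM; first by rewrite -exprD mulSn.
  case=> [|i] ri; first lia.
  by rewrite a1S; [apply: aM; lia | lia].
Qed.

Hypotheses (t_neq0 : t != 0) (t_neq1 : t != 1).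

Lemma weight_iter_raise k u z (p : P) : (k <= N)%N -> u != 0 ->
  weight u t z p ->
  weight u t (fun i => if (i + k < N)%N then z (i + k)%N
                       else u * z (i + k - N)%N) (iter k (raise u) p).
Proof.
move=> + u0 zp; elim: k => [_|k IH lek] i lti.
  by rewrite addn0 lti; apply: zp.
rewrite (weight_raise t_neq0 u0 (IH (ltnW lek))) //.
congr (_ *: _); case: ifP => [lti1|nlt].
  by rewrite addSnnS.
have ei : i = N' by lia.
rewrite add0n lek ei; have -> : (N' + k.+1 < N)%N = false by lia.
by congr (u * z _); lia.
Qed.

Lemma pev_iter_raise k u z (p : P) : (k <= N)%N -> u != 0 ->
  weight u t z p ->
  pev t (iter k (raise u) p) = (\prod_(i < k) z i) * pev t p.
Proof.
move=> + u0 zp; elim: k => [_|k IH lek]; first by rewrite big_ord0 mul1r.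
rewrite iterS pev_raise // (weight_iter_raise (ltnW lek) u0 zp) //.
rewrite add0n lek pevZ IH ?(ltnW lek) // big_ord_recr /= mulrA.
by rewrite [z k * _]mulrC.
Qed.

End Rectangle.

(** * The eigenvectors with exponents (M^n, 0^(N-n)) *)

Section RectangularFamily.
Variables (K : fieldType) (N' n : nat) (t : K).
Local Notation N := N'.+1.
Hypotheses (le_nN : (n <= N)%N) (t_neq0 : t != 0) (t_neq1 : t != 1).
Local Notation P := {mpoly K[N]}.
Local Notation mono := (@mono N').
Local Notation a := (N - n)%N.

(** This number orders the monomials with a given multiset of exponents: it
    drops when an exponent M moves to the left past a 0. *)
Definition place (m : 'X_{1..N}) : nat := (\sum_(i < N) m i * i)%N.

Lemma place_swap M S i : (i < N')%N ->
  (place (mono M (S \o adj_swap i)) + (if S i.+1 then M else 0) =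
   place (mono M S) + (if S i then M else 0))%N.
Proof.
move=> lti; have lti1 : (i.+1 < N)%N by []; have lti0 := ltnW lti1.
pose i0 := Ordinal lti0; pose i1 := Ordinal lti1.
have ne : i1 != i0 by rewrite -val_eqE /= gtn_eqF.
rewrite /place (bigD1 i0) //= (bigD1 i1) //= [in RHS](bigD1 i0) //=.
rewrite [in RHS](bigD1 i1) //= !mnmE /=.
have -> : adj_swap i i = i.+1 by adj_swap_lia.
have -> : adj_swap i i.+1 = i by adj_swap_lia.
rewrite (eq_bigr (fun j : 'I_N => mono M S j * j)%N).
  by case: (S i); case: (S i.+1); lia.
move=> j /andP[]; rewrite -!val_eqE /= => nej nej1; rewrite !mnmE /=.
by congr ((if S _ then _ else _) * _)%N; adj_swap_lia.
Qed.

(** The weight that belongs to rank k when exactly the ranks below n have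
    exponent M. *)
Definition rank_weight (u : K) M k : K :=
  (if (k < n)%N then u ^+ M else 1) * t ^+ (N' - k).

(** A family, polynomial in the parameter u in place of q, of eigenvectors
    whose exponent at position i is M if [rk i < n] and 0 otherwise; [v] and
    [l] record its value at (1, t, ..., t^(N-1)) and the coefficient of the
    leading monomial. The last condition is the part of the triangularity of
    these eigenvectors that the exchange of two exponents preserves. *)
Definition stage M (rk : nat -> nat) (v l : {poly K}) :=
  exists2 e : K -> P, poly_family e & forall u, u != 0 ->
    [/\ weight u t (fun i => rank_weight u M (rk i)) (e u),
        exponents_below M.+1 (e u), pev t (e u) = v.[u],
        (e u)@_(mono M (fun i => rk i < n)%N) = l.[u] &
        forall S, mono M S != mono M (fun i => rk i < n)%N ->
          (place (mono M S) <= place (mono M (fun i => rk i < n)%N))%N ->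
          (e u)@_(mono M S) = 0].

Lemma stage_ext M rk rk' v l : (forall i, (i < N)%N -> rk i = rk' i) ->
  stage M rk v l -> stage M rk' v l.
Proof.
move=> e [f ff H]; exists f => // u u0; have [wu bu vu lu zu] := H u u0.
have em : mono M (fun i => rk i < n)%N = mono M (fun i => rk' i < n)%N.
  by apply/mnmP => i; rewrite !mnmE e.
by rewrite -em; split=> // i lti; rewrite wu // e.
Qed.

Definition lin M e : {poly K} := 1 - t ^+ e *: 'X^M.

Lemma lin_neq0 M e : (0 < M)%N -> lin M e != 0.
Proof.
case: M => // M _; apply/eqP => /(congr1 (coefp 0)); rewrite /coefp /= /lin.
by rewrite coefB coefZ coefXn coef1 coef0 /= mulr0 subr0 => /eqP; rewrite oner_eq0.
Qed.

(** The intertwiner exchanges the exponents 0 at i and M at i + 1. It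
    multiplies the value by z_i - t z_(i+1) and the leading coefficient by t
    (z_i - z_(i+1)). *)
Lemma stage_swap M rk v l i : (0 < M)%N -> (i < N')%N -> (n <= rk i)%N ->
  (rk i <= N')%N -> (rk i.+1 < n)%N -> stage M rk v l ->
  let A := (N' - rk i)%N in let B := (N' - rk i.+1)%N in
  stage M (rk \o adj_swap i) (((t ^+ A)%:P - t ^+ B.+1 *: 'X^M) * v)
    (t *: (((t ^+ A)%:P - t ^+ B *: 'X^M) * l)).
Proof.
move=> M0 lti lerk lerkN ltrk [e fe H] A B.
have lti1 : (i.+1 < N)%N by [].
pose c := (t ^+ A)%:P - t ^+ B *: 'X^M.
have cE u : c.[u] = rank_weight u M (rk i) - rank_weight u M (rk i.+1).
  rewrite /c !hornerE /rank_weight ltrk ltnNge lerk /= mul1r.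
  by rewrite [u ^+ M * _]mulrC.
pose g u : P := intertwine t (fun i => rank_weight u M (rk i)) i (e u).
exists g.
  rewrite /g /intertwine; apply: poly_family_D.
    have : poly_family (fun u => c.[u] *: Tn t i (e u)).
      apply: poly_family_scale; apply: poly_family_linear => //.
      exact: Tn_linear.
    by move=> [E eE]; exists E => u; rewrite -eE cE.
  have : poly_family (fun u => ((1 - t) * t ^+ A)%:P.[u] *: e u).
    exact: poly_family_scale.
  move=> [E eE]; exists E => u; rewrite -eE hornerC.
  by rewrite /rank_weight ltnNge lerk mul1r.
move=> u u0; have [wu bu vu lu zu] := H u u0.
set S0 := fun i => (rk i < n)%N; rewrite -/S0 in lu zu.
have S0i : S0 i = false by rewrite /S0 ltnNge lerk.
have S0i1 : S0 i.+1 by [].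
have pS := place_swap M S0 lti; rewrite S0i S0i1 addn0 in pS.
have gS S : (g u)@_(mono M S) = c.[u] *
    (if S i then t * (e u)@_(mono M (S \o adj_swap i))
     else (e u)@_(mono M (S \o adj_swap i)) + (t - 1) * (e u)@_(mono M S)) +
    ((1 - t) * rank_weight u M (rk i)) * (e u)@_(mono M S).
  by rewrite /g /intertwine mcoeffD !mcoeffZ (coef_T_mono t S lti bu) -cE.
have S0K : S0 \o adj_swap i \o adj_swap i = S0.
  by apply: funext => j; rewrite /= adj_swapK.
have -> : (fun j => (rk \o adj_swap i) j < n)%N = S0 \o adj_swap i by [].
split.
- exact: (weight_intertwine t_neq0 lti1 wu).
- rewrite /g /intertwine; apply/boundedP; apply: boundedD; apply: boundedZ.
    by apply: bounded_T => //; apply/boundedP.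
  exact/boundedP.
- rewrite /g /intertwine pevD !pevZ pev_T // vu hornerM -cE cE.
  rewrite !hornerE /rank_weight ltrk ltnNge lerk /= exprS; ring.
- rewrite gS /= [adj_swap i i](_ : _ = i.+1); last by adj_swap_lia.
  rewrite S0i1 -/(S0 \o _) S0K lu zu; first by rewrite hornerZ hornerM; ring.
    apply/eqP => /(congr1 place) e1; lia.
  lia.
move=> S neS leS.
have z1 : (e u)@_(mono M S) = 0.
  apply: zu; last lia.
  by apply/eqP => e1; rewrite e1 in leS; lia.
have z2 : (e u)@_(mono M (S \o adj_swap i)) = 0.
  apply: zu.
    apply: contra neS => /eqP e1; apply/eqP/mnmP => j.
    have /mnmP/(_ (adj_perm N i j)) := e1; rewrite !mnmE /= adj_permE //.
    by rewrite adj_swapK.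
  have := place_swap M S lti; case: (S i); case: (S i.+1); lia.
by rewrite gS z1 z2 !(mulr0, addr0) if_same mulr0.
Qed.

(** The ranks while one row of the rectangle after the other moves to the left
    of the rows of zeros: p rows have arrived, and the next one has passed r
    zeros. *)
Definition moving p r i : nat :=
  if (i < p)%N then i
  else if (i < p + a - r)%N then (n + (i - p))%N
  else if (i == p + a - r)%N then p
  else if (i <= p + a)%N then (n + (i - p - 1))%N
  else (i - a)%N.

Ltac moving_lia := rewrite /moving;
  repeat match goal with |- context [if ?b then _ else _] =>
    lazymatch b with
    | context [if _ then _ else _] => fail
    | _ => case: (boolP b) => ?
    end end; lia.

Lemma moving_step p r i : (p < n)%N -> (r < a)%N ->
  moving p r.+1 i = moving p r (adj_swap (p + a - r.+1)%N i).
Proof.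
move=> ltp ltr; rewrite /adj_swap.
by case: eqP => [->|ne1]; last case: eqP => [->|ne2]; moving_lia.
Qed.

(** Only the quotient of value and leading coefficient is of interest, up to
    a constant: it is B / A. Stating it without division keeps track of it
    through the zeros of the factors. *)
Definition ratio M rk (A B : {poly K}) := exists v l c,
  [/\ stage M rk v l, l != 0, c != 0 & v * A = c *: (l * B)].

Lemma ratio_mul M rk A B C : ratio M rk A B -> ratio M rk (A * C) (B * C).
Proof.
move=> [v [l [c [st l0 c0 e]]]]; exists v, l, c; split=> //.
by rewrite mulrA e -scalerAl mulrA.
Qed.

Lemma ratio_ext M rk rk' A B : (forall i, (i < N)%N -> rk i = rk' i) ->
  ratio M rk A B -> ratio M rk' A B.
Proof.
move=> e [v [l [c [st l0 c0 r]]]]; exists v, l, c; split=> //.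
exact: stage_ext st.
Qed.

Lemma ratio_step M p r A B : (0 < M)%N -> (p < n)%N -> (r < a)%N ->
  ratio M (moving p r) (A * lin M (N - p - r)) B ->
  ratio M (moving p r.+1) (A * lin M (N - p - r.+1)) B.
Proof.
move=> M0 ltp ltr [v [l [c [st l0 c0 e]]]].
pose i := (p + a - r.+1)%N.
have lti : (i < N')%N by rewrite /i; lia.
have rki : moving p r i = (N - r.+1)%N by rewrite /i; moving_lia.
have rki1 : moving p r i.+1 = p by rewrite /i; moving_lia.
have := stage_swap M0 lti _ _ _ st; cbv zeta; rewrite rki rki1.
have -> : (N' - (N - r.+1) = r)%N by lia.
have -> : ((N' - p).+1 = r + (N - p - r))%N by lia.
have -> : (N' - p = r + (N - p - r.+1))%N by lia.
have linE e1 : (t ^+ r)%:P - t ^+ (r + e1) *: 'X^M = t ^+ r *: lin M e1.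
  by rewrite /lin scalerBr scalerA exprD alg_polyC.
rewrite !linE => st1; eexists _, _, (c / t); split.
- apply: (stage_ext (rk := moving p r \o adj_swap i)); last by apply: st1; lia.
  by move=> j _; rewrite /= moving_step.
- by rewrite !(scaler_eq0, mulf_eq0) expf_eq0 (negbTE t_neq0) andbF (negbTE l0)
    (negbTE (lin_neq0 _ M0)).
- by rewrite mulf_neq0 ?invr_eq0.
- set l1 := lin M (N - p - r) in e *; set l2 := lin M _.
  have -> : t ^+ r *: l1 * v * (A * l2) = t ^+ r *: (l2 * (v * (A * l1))).
    by rewrite -!scalerAl; congr (_ *: _); ring.
  rewrite e -!scalerAl !scalerA [c / t * _]mulrA divfK // -scalerAr scalerA mulrA.
  by rewrite [t ^+ r * c]mulrC.
Qed.

Lemma ratio_row M p A B : (0 < M)%N -> (p < n)%N ->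
  ratio M (moving p 0) A B ->
  ratio M (moving p.+1 0) (A * lin M (n - p)) (B * lin M (N - p)).
Proof.
move=> M0 ltp /(ratio_mul (lin M (N - p))) rAB.
have step r : (r <= a)%N ->
    ratio M (moving p r) (A * lin M (N - p - r)) (B * lin M (N - p)).
  elim: r => [_|r IH ltr]; first by rewrite subn0.
  by apply: ratio_step => //; apply: IH; apply: ltnW.
have := step a (leqnn _); have -> : (N - p - a = n - p)%N by lia.
by apply: ratio_ext => i lti; moving_lia.
Qed.

Lemma ratio_rows M p A B : (0 < M)%N -> (p <= n)%N ->
  ratio M (moving 0 0) A B ->
  ratio M (moving p 0) (A * \prod_(i < p) lin M (n - i))
                       (B * \prod_(i < p) lin M (N - i)).
Proof.
move=> M0 + rAB; elim: p => [_|p IH ltp]; first by rewrite !big_ord0 !mulr1.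
by rewrite !big_ord_recr /= !mulrA; apply: ratio_row => //; apply: IH (ltnW ltp).
Qed.

(** The n last exponents of the raised eigenvector become M + 1; value and
    leading coefficient get factors that are powers of t and u, hence
    nonzero. *)
Lemma stage_raise M v l : stage M id v l ->
  exists k, stage M.+1 (moving 0 0) (t ^+ k *: ('X^(n * M) * v)) ('X^(n * M) * l).
Proof.
move=> [e fe H]; exists (\sum_(i < n) (N' - i))%N.
exists (fun u => iter n (raise u) (e u)).
  elim: n => [//|k IH]; exact: (poly_family_raise IH).
move=> u u0; have [wu bu vu lu zu] := H u u0.
have last_row i : (i < N)%N -> (moving 0 0 i < n)%N = (a <= i)%N.
  by move=> lti; moving_lia.
set Sl := fun i => (moving 0 0 i < n)%N.
have coefs S : mono M.+1 S != mono M.+1 Sl ->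
    (iter n (raise u) (e u))@_(mono M.+1 S) = 0.
  move=> neS; have [c [-> c0 cM]] := coef_iter_raise u (e u) (mono M.+1 S) M le_nN.
  case: (boolP [forall i : 'I_N, (a <= i)%N ==> S i]) => [/forallP allS|]; last first.
    move=> /forallPn[j]; rewrite negb_imply => /andP[aj Sj].
    rewrite c0 ?mul0r //; exists j; first by rewrite aj ltn_ord.
    by rewrite mexp_mono // (negbTE Sj).
  case: (boolP [exists i : 'I_N, (i < a)%N && S i]) => [/existsP[i /andP[ai Si]]|].
    rewrite [_@_ _](_ : _ = 0) ?mulr0 //; apply/eqP; apply: contraT => nz.
    have lti : (n + i < N)%N by lia.
    have := bu _ nz (Ordinal lti).
    rewrite -mexp_ord mexp_rotate //=.
    have -> : (n + i < n)%N = false by lia.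
    by rewrite addKn mexp_mono // Si ltnn.
  move=> /existsPn noS; case/eqP: neS; apply/mnmP => i; rewrite !mnmE /Sl last_row //.
  have := noS i; have := allS i; case: leqP => /=; first by move=> _ ->.
  by move=> _ _ /negbTE->.
have wz := weight_iter_raise t_neq0 t_neq1 le_nN u0 wu.
split.
- move=> i lti; rewrite wz //; congr (_ *: _); rewrite /rank_weight last_row //.
  have [leai|ltai] := leqP a i.
    have -> : (i + n < N)%N = false by lia.
    have -> : (i + n - N < n)%N by lia.
    rewrite exprS -mulrA; congr (_ * (_ * t ^+ _)); moving_lia.
  have -> : (i + n < N)%N by lia.
  have -> : (i + n < n)%N = false by lia.
  by congr (_ * t ^+ _); moving_lia.
- move=> m nz i.
  have [c [e1 c0 _]] := coef_iter_raise u (e u) m M le_nN.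
  move: nz; rewrite e1 mulf_eq0 negb_or => /andP[cn nz].
  have rot j (ltj : (j < N)%N) : (mexp (rotate_mon n m) j < M.+1)%N.
    by have := bu _ nz (Ordinal ltj); rewrite -mexp_ord.
  have [leai|ltai] := leqP a i.
    have lti := ltn_ord i.
    have ltj : (i - a < N)%N by lia.
    have := rot _ ltj; rewrite mexp_rotate //.
    have -> : (i - a < n)%N by lia.
    have -> : (N - n + (i - a) = i)%N by lia.
    by rewrite mexp_ord; case: (m i).
  have ltj : (i + n < N)%N by lia.
  have := rot _ ltj; rewrite mexp_rotate //.
  have -> : (i + n < n)%N = false by lia.
  by rewrite addnK mexp_ord => /ltnW.
- rewrite (pev_iter_raise t_neq0 t_neq1 le_nN u0 wu) vu hornerZ hornerM hornerXn.
  rewrite mulrA; congr (_ * _); rewrite /rank_weight.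
  rewrite (eq_bigr (fun i : 'I_n => u ^+ M * t ^+ (N' - i))); last first.
    by move=> i _; rewrite ltn_ord.
  rewrite big_split /= prodr_const card_ord -exprM mulnC mulrC; congr (_ * _).
  by rewrite expr_sum.
- have [c [-> _ cM]] := coef_iter_raise u (e u) (mono M.+1 Sl) M le_nN.
  rewrite cM; last first.
    by move=> i /andP[lei lti]; rewrite mexp_mono // /Sl last_row // lei.
  rewrite hornerM hornerXn -lu; congr (_ * mcoeff _ _); apply: mexp_inj => i lti.
  rewrite mexp_rotate // [RHS]mexp_mono //; case: ltnP => lein.
    by rewrite mexp_mono; [rewrite /Sl last_row ?leq_addr //; lia | lia].
  rewrite mexp_mono; last lia.
  rewrite /Sl last_row; last lia.
  by have -> : (a <= i - n)%N = false by lia.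
- by move=> S neS _; apply: coefs.
Qed.

Lemma ratio_raise M A B : ratio M id A B -> ratio M.+1 (moving 0 0) A B.
Proof.
move=> [v [l [c [/stage_raise[k st] l0 c0 e]]]]; eexists _, _, (t ^+ k * c).
split; first exact: st.
- by rewrite mulf_neq0 // expf_neq0 // polyX_eq0.
- by rewrite mulf_neq0 // expf_neq0.
- by rewrite -scalerAl -['X^_ * v * A]mulrA e -scalerAr scalerA mulrA.
Qed.

Lemma Tn_1 j : (j.+1 < N)%N -> Tn t j (1 : P) = t *: 1.
Proof.
move=> ltj; apply/esym/Tn_uniq => //.
by rewrite /swap msym1 -mul_mpolyC mpolyCB mpolyC1; ring.
Qed.

Lemma Tvn_1 j : (j.+1 < N)%N -> Tvn t j (1 : P) = t^-1 *: 1.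
Proof.
move=> ltj; apply: (can_inj (TnK t_neq0 ltj)).
by rewrite TvnK // TnZ // Tn_1 // scalerA mulVf // scale1r.
Qed.

Lemma xin_1 u i : (i < N)%N -> xin u t i (1 : P) = t ^+ (N' - i) *: 1.
Proof.
move=> lti; have Tw1 r : in_range N r -> Tw t (1 : P) r = t ^+ size r *: 1.
  elim: r => [_|j r IH /= /andP[ltj /IH ->]]; first by rewrite scale1r.
  by rewrite TnZ // Tn_1 // scalerA exprSr.
have Tvw1 r : in_range N r -> Tvw t (1 : P) r = t ^- size r *: 1.
  elim: r => [_|j r IH /= /andP[ltj /IH ->]]; first by rewrite invr1 scale1r.
  by rewrite TvnZ // Tvn_1 // scalerA -!exprVn -exprSr.
have ri : in_range N (iota 0 i) by apply: in_range_iota; lia.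
have ri' : in_range N (iota i (N' - i)) by apply: in_range_iota; lia.
rewrite /xin Tvw1 // wZ -mpolyC1 wC TwZ // mpolyC1 Tw1 // !size_iota !scalerA.
by rewrite mulfV ?expf_neq0 // mul1r.
Qed.

Lemma stage0 : stage 0 id 1 1.
Proof.
exists (fun=> 1); first exact: poly_family_const.
have mono0 S : mono 0 S = 0%MM by apply/mnmP => i; rewrite !mnmE if_same.
move=> u u0; split.
- by move=> i lti; rewrite xin_1 // /rank_weight expr0 if_same mul1r.
- move=> m; rewrite mcoeff1; have [-> _ i|_] := eqVneq m 0%MM; first by rewrite mnm0E.
  by rewrite mulr0n eqxx.
- by rewrite /pev rmorph1 hornerC.
- by rewrite mono0 mcoeff1 eqxx hornerC.
- by move=> S; rewrite !mono0 eqxx.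
Qed.

(** Raising n times turns (M^n, 0^(N-n)) into (0^(N-n), (M+1)^n); moving the n
    exponents M + 1 back to the front past N - n zeros each contributes the
    factors with j = M, in a telescoping product. *)
Lemma rectangular_family M :
  ratio M id (\prod_(j < M) \prod_(p < n) lin j.+1 (n - p))
             (\prod_(j < M) \prod_(p < n) lin j.+1 (N - p)).
Proof.
elim: M => [|M IH].
  rewrite !big_ord0; exists 1, 1, 1; split; rewrite ?oner_neq0 //.
    exact: stage0.
  by rewrite scale1r.
rewrite !big_ord_recr /=; have := ratio_rows (ltn0Sn M) (leqnn n) (ratio_raise IH).
by apply: ratio_ext => i lti; moving_lia.
Qed.

End RectangularFamily.

(** * The weights that determine their exponents *)

(** The weights of the contents of the row reading tableau with rows nd - 1
    and n leave no choice for the exponents. The index j in [0, n) of rank R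
    satisfies R + n k_j = j + nd. If 0 < j then n does not divide j, so that
    some index precedes j in the order; the equations and the rule for ties
    leave only j - 1. Thus the indices below n have consecutive ranks; index
    0 has rank 0, as only n - 1 could precede it. The other indices are fixed
    from the last to the first: an index of rank r has the form r + n k, and
    the indices above r have their ranks already. *)
Lemma rectangular_order n d (k : nat -> nat) (s : seq nat) :
  let N := (n * d + n - 1)%N in
  (2 <= n)%N -> (1 <= d)%N -> perm_eq s (iota 0 N) ->
  (forall r, (r.+1 < N)%N ->
     let i := nth 0%N s r in let j := nth 0%N s r.+1 in
     (k j < k i)%N \/ (k i = k j /\ (i < j)%N)) ->
  (forall r, (r < N)%N -> let i := nth 0%N s r in
     (r + n * k i = i + (if i < n then n * d else 0))%N) ->
  forall i, (i < N)%N -> k i = if (i < n)%N then d else 0%N.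
Proof.
move=> N n2 d1 ps os ws; have ss : size s = N by rewrite (perm_size ps) size_iota.
have le_nN : (n * d + n = N.+1)%N by rewrite /N; lia.
have nd : (n <= n * d)%N by rewrite leq_pmulr.
have us : uniq s by rewrite (perm_uniq ps) iota_uniq.
have ms i : (i < N)%N -> i \in s by rewrite (perm_mem ps) mem_iota.
have nths r : (r < N)%N -> (nth 0%N s r < N)%N.
  move=> ltr; have : nth 0%N s r \in s by rewrite mem_nth // ss.
  by rewrite (perm_mem ps) mem_iota.
pose rk i := index i s.
have rkK i : (i < N)%N -> nth 0%N s (rk i) = i by move=> lti; rewrite nth_index // ms.
have rkN i : (i < N)%N -> (rk i < N)%N by move=> lti; rewrite -ss index_mem ms.
have rk_nth r : (r < N)%N -> rk (nth 0%N s r) = r.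
  by move=> ltr; rewrite /rk index_uniq // ss.
have pred j : (j < N)%N -> (0 < rk j)%N ->
    let i := nth 0%N s (rk j).-1 in
    [/\ (i < N)%N, rk j = (rk i).+1,
        ((rk i) + n * k i = i + (if i < n then n * d else 0))%N &
        (n * k j + n <= n * k i)%N \/ (k i = k j /\ (i < j)%N)].
  move=> ltj rk0 i; have ltr := rkN j ltj.
  have lti : (i < N)%N by apply: nths; lia.
  have ri : rk i = (rk j).-1 by rewrite rk_nth //; lia.
  split=> //; first by lia.
    by have := ws (rk i) (rkN i lti); cbv zeta; rewrite rkK.
  have := os (rk i); rewrite ri prednK // => /(_ ltr); rewrite -ri !rkK //.
  by case=> [lt|]; [left; rewrite addnC -mulnS leq_mul2l lt orbT | right].
have eqn j : (j < N)%N -> (rk j + n * k j = j + (if j < n then n * d else 0))%N.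
  by move=> ltj; have := ws _ (rkN j ltj); cbv zeta; rewrite rkK.
have low j : (0 < j)%N -> (j < n)%N ->
    rk j = (rk j.-1).+1 /\ k j = k j.-1.
  move=> j0 ltj; have ltjN : (j < N)%N by lia.
  have ej := eqn j ltjN; rewrite ltj in ej.
  have r0 : (0 < rk j)%N.
    rewrite lt0n; apply/eqP => r0; rewrite r0 add0n in ej.
    have : (n %| j)%N by rewrite -(dvdn_addl _ (dvdn_mulr d (dvdnn n))) -ej dvdn_mulr.
    by move=> /(dvdn_leq j0); lia.
  have [] := pred j ltjN r0; set i := nth _ _ _ => lti er ei ord.
  have ij : i = j.-1 by move: ei; case: ifP => ltin; lia.
  have ltin : (i < n)%N by lia.
  rewrite ltin in ei; rewrite -ij; split=> //; case: ord => [|[]]; lia.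
have chain j : (j < n)%N -> rk j = (rk 0 + j)%N /\ k j = k 0%N.
  elim: j => [|j IH] ltj; first by rewrite addn0.
  have [e1 e2] := low j.+1 (ltn0Sn j) ltj; have [e3 e4] := IH (ltnW ltj).
  by rewrite e1 e2 /= e3 e4 addnS.
have N0 : (0 < N)%N by lia.
have e0 := eqn 0%N N0; rewrite (ltnW n2) in e0.
have rk0 : rk 0 = 0%N.
  apply/eqP; rewrite -leqn0 leqNgt; apply/negP => r0.
  have [] := pred 0%N N0 r0; set i := nth _ _ _ => lti er ei ord.
  move: ei; case: ifP => ltin; last by lia.
  have [e1 e2] := chain i ltin; rewrite e1 e2; lia.
have k0 : k 0%N = d.
  by move: e0; rewrite rk0 !add0n /= => /eqP; rewrite eqn_pmul2l ?(ltnW n2) // => /eqP.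
have high j r : (N - r <= j)%N -> (n <= r)%N -> (r < N)%N -> rk r = r.
  elim: j r => [|j IH] r lej ler ltr; first by lia.
  have eN := eqn (nth 0%N s r) (nths r ltr); rewrite rk_nth // in eN.
  have := rk_nth r ltr; have := nths r ltr.
  move: eN; set i := nth _ _ _ => eN ltiN ri.
  have [ltin|lein] := ltnP i n.
    by have := (chain i ltin).1; rewrite ri rk0; lia.
  rewrite ltnNge lein addn0 /= in eN.
  have [e|ltri] : i = r \/ (r < i)%N by lia.
    by rewrite -[in LHS]e.
  by have := IH i; rewrite ri; lia.
move=> i lti; case: ifP => ltin; first by rewrite (chain i ltin).2.
have := eqn i lti; rewrite ltin (high (N - i)%N i) //; last by lia.
by move=> /eqP; rewrite addn0 -[X in _ == X]addn0 eqn_add2l muln_eq0; lia.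
Qed.

(** * Identities of polynomial families *)

(** K is infinite, and the product of F with the linear factors of the
    excluded points has all j u as roots. *)
Lemma poly_vanish (R : idomainType) (K : nzRingType) (j : {rmorphism K -> R})
    (F : {poly R}) (s : seq K) :
  injective j -> (forall n : nat, n.+1%:R != 0 :> K) ->
  (forall u, u \notin s -> F.[j u] = 0) -> F = 0.
Proof.
move=> inj_j char0 Fs; pose G := F * \prod_(x <- s) ('X - (j x)%:P).
have G0 u : G.[j u] = 0.
  rewrite hornerM; have [us|us] := boolP (u \in s); last by rewrite Fs // mul0r.
  by rewrite (big_rem u us) /= hornerM hornerXsubC subrr mul0r mulr0.
have : G == 0.
  apply: contraT => Gn0.
  have := max_poly_roots (rs := [seq j n%:R | n <- iota 0 (size G)]) Gn0.
  rewrite size_map size_iota ltnn => ->//.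
    by apply/allP => _ /mapP[n _ ->]; rewrite /root G0.
  rewrite map_inj_in_uniq ?iota_uniq // => a b _ _ /inj_j.
  wlog ltab : a b / (a <= b)%N => [W e|/eqP].
    by case: (leqP a b) => [le|/ltnW le]; [apply: W | apply/esym/W].
  rewrite eq_sym -subr_eq0 -natrB // => e; apply/eqP; rewrite eqn_leq ltab -subn_eq0.
  by case: (b - a)%N e (char0 (b - a).-1) => // k /= ->.
rewrite mulf_eq0 => /orP[/eqP //|]; rewrite prodf_seq_eq0 => /hasP[x _].
by rewrite polyXsubC_eq0.
Qed.

Section FamilyExtra.
Variables (K : fieldType) (N : nat) (t : K).
Local Notation P := {mpoly K[N]}.
Hypotheses (t_neq0 : t != 0) (char0 : forall n : nat, n.+1%:R != 0 :> K).

Lemma poly_family_vanish (e : K -> P) (s : seq K) : poly_family e ->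
  (forall u, u \notin s -> e u = 0) -> forall u, e u = 0.
Proof.
move=> [E eE] e0 u; rewrite eE (_ : E = 0) ?horner0 //.
apply: (poly_vanish (j := @mpolyC N K) (s := s)) => // [|x xs].
  by move=> a b /(congr1 (mcoeff 0%MM)); rewrite !mcoeffC eqxx !mulr1.
by rewrite -eE e0.
Qed.

Lemma poly_family_xin i (e : K -> P) : (i < N)%N -> poly_family e ->
  poly_family (fun u => xin u t i (e u)).
Proof.
move=> lti fe; rewrite /xin.
have ri : in_range N (iota 0 i) by apply: in_range_iota; lia.
have ri' : in_range N (iota i (N.-1 - i)) by apply: in_range_iota; lia.
apply: (poly_family_linear (L := fun p => t ^+ i *: p)).
  by move=> c p r; rewrite scalerDr !scalerA mulrC.
apply: (poly_family_linear (L := fun p => Tw t p (iota i (N.-1 - i)))).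
  by move=> c p r; rewrite TwD // TwZ.
apply: poly_family_w.
apply: (poly_family_linear (L := fun p => Tvw t p (iota 0 i))) => //.
by move=> c p r; rewrite TvwD // TvwZ.
Qed.

Lemma poly_ext (F G : {poly K}) (s : seq K) :
  (forall u, u \notin s -> F.[u] = G.[u]) -> F = G.
Proof.
move=> FG; apply/eqP; rewrite -subr_eq0; apply/eqP.
apply: (poly_vanish (j := idfun : {rmorphism K -> K}) (s := s)) => // u us.
by rewrite hornerD hornerN FG ?subrr.
Qed.

Section LinearForm.
Variable f : P -> K.
Hypothesis f_linear : forall a p r, f (a *: p + r) = a * f p + f r.

Lemma horner_linear (E : {poly P}) u : (map_poly f E).[u] = f E.[u%:MP].
Proof.
have f0 : f 0 = 0 by have := f_linear (-1) 0 0; rewrite scaler0 addr0 mulN1r addNr.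
rewrite /map_poly horner_poly horner_coef.
elim/big_rec2: _ => [//|k y x _ ->].
by rewrite -rmorphXn /= [_`_k * _%:MP]mulrC mul_mpolyC f_linear mulrC.
Qed.

Lemma map_linear_XsubC (E : {poly P}) u :
  map_poly f (E * ('X - u%:MP%:P)) = map_poly f E * ('X - u%:P).
Proof.
apply: (@poly_ext _ _ [::]) => x _; rewrite hornerM !horner_linear hornerM.
rewrite !hornerXsubC -rmorphB /= mulrC mul_mpolyC [RHS]mulrC.
have f0 : f 0 = 0 by have := f_linear (-1) 0 0; rewrite scaler0 addr0 mulN1r addNr.
by rewrite -[_ *: _]addr0 f_linear f0 addr0.
Qed.

End LinearForm.

End FamilyExtra.

(** * Excluded weights *)

Section NoEigenvector.
Variables (K : fieldType) (m n d N' : nat) (q t : K).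
Local Notation N := N'.+1.
Local Notation P := {mpoly K[N]}.
Local Notation M := (m * d)%N.
Hypotheses (m_gt0 : (0 < m)%N) (n_gt1 : (1 < n)%N) (d_gt0 : (0 < d)%N).
Hypothesis N_eq : N = (n * d + n - 1)%N.
Hypothesis char0 : forall n : nat, n.+1%:R != 0 :> K.
Hypotheses (q_neq0 : q != 0) (t_neq0 : t != 0).
Hypothesis qt1 : q ^+ m * t ^+ n = 1.
Hypothesis relation : forall (a : nat) (b : int), q ^+ a * t ^ b = 1 ->
  exists l : nat, a = (m * l)%N /\ b = (n * l)%N%:Z.

Let le_nN : (n <= N)%N.
Proof. by rewrite N_eq; have := leq_pmulr n d_gt0; lia. Qed.

Let order_t (e : int) : t ^ e = 1 -> e = 0.
Proof.
move=> e1; have [|l []] := @relation 0 e; first by rewrite expr0 mul1r.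
by move=> /esym/eqP; rewrite muln_eq0 eqn0Ngt m_gt0 => /eqP ->; rewrite muln0.
Qed.

Let t_neq1 : t != 1.
Proof. by apply/eqP => t1; have := @order_t 1; rewrite t1 exp1rz => /(_ erefl). Qed.

Let qM : q ^+ M = t ^ (- (n * d)%N%:Z).
Proof.
rewrite -exprnN -div1r; apply: (canRL (mulfK _)); first by rewrite expf_neq0.
by rewrite !exprM -exprMn qt1 expr1n.
Qed.

Local Notation mon := (mono N' M (fun i => i < n)%N).
Local Notation rw := (rank_weight N' n t q M).

(** The exponents of g given by [eigenvector_exponents] can only be (M^n,
    0^(N-n)), as a relation q^a t^b = 1 makes their differences multiples of
    (m, n). *)
Lemma rectangular_coef (g : P) : g != 0 -> weight q t rw g -> g@_mon != 0.
Proof.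
move=> g0 /(eigenvector_exponents t_neq0 g0) [a [s [ga ps os ws]]].
have rel r : (r < N)%N -> let i := nth 0%N s r in
    exists2 l, mexp a i = (m * l)%N &
      (r + n * l = i + (if i < n then n * d else 0))%N.
  move=> ltr i; have lti : (i < N)%N.
    have : i \in s by rewrite mem_nth // (perm_size ps) size_iota.
    by rewrite (perm_mem ps) mem_iota.
  have := ws r ltr; rewrite -/i /rank_weight.
  have -> : (if (i < n)%N then q ^+ M else 1) =
      t ^ (- (if (i < n)%N then n * d else 0)%N%:Z).
    by case: ifP => _; rewrite ?qM // oppr0 expr0z.
  move=> e.
  have [|l [al el]] := @relation (mexp a i)
      ((N' - r)%N%:Z - (N' - i)%N%:Z + (if (i < n)%N then n * d else 0)%N%:Z).
    set a_i := mexp a i in e *.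
    have e' : q ^+ a_i * t ^ (N' - r)%N%:Z =
      t ^ (- (if (i < n)%N then n * d else 0)%N%:Z) * t ^ (N' - i)%N%:Z := esym e.
    rewrite !expfzDr // !mulrA e' -!expfzDr //.
    by rewrite [X in t ^ X](_ : _ = 0) //; lia.
  by exists l => //; move: el; case: ifP; lia.
have kE i : (i < N)%N -> (mexp a i %/ m = if (i < n)%N then d else 0)%N.
  have := @rectangular_order n d (fun i => mexp a i %/ m)%N s.
  cbv zeta; rewrite -N_eq; apply=> // {i} r ltr.
    have [l el _] := rel r (ltnW ltr); have [l' el' _] := rel r.+1 ltr.
    case: (os r ltr) => [|[-> lt]]; last by right.
    by rewrite el el' !mulKn // ltn_pmul2l //; left.
  by have [l el e] := rel r ltr; rewrite el mulKn.
rewrite (_ : mon = a) //; apply: mexp_inj => i lti.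
rewrite mexp_mono //; have [r ltr ri] : exists2 r, (r < N)%N & nth 0%N s r = i.
  have i_s : i \in s by rewrite (perm_mem ps) mem_iota.
  exists (index i s); last by rewrite nth_index.
  by rewrite -[N](size_iota 0 N) -(perm_size ps) index_mem.
have [l el _] := rel r ltr; have := kE i lti; rewrite -ri el mulKn // ri => ->.
by case: ifP => _; rewrite ?muln0.
Qed.

(** The combination of g and h with coefficient 0 at the leading monomial is
    0 by [rectangular_coef]: the eigenspace is at most a line. *)
Lemma rectangular_eigenspace (g h : P) : weight q t rw g -> weight q t rw h ->
  h@_mon *: g = g@_mon *: h.
Proof.
move=> gw hw; apply/eqP; rewrite -subr_eq0; apply: contraT => /rectangular_coef.
have dw : weight q t rw (h@_mon *: g - g@_mon *: h).
  rewrite -scaleN1r scalerA => i lti; rewrite xinD // !xinZ // gw // hw //.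
  by rewrite scalerDr !scalerA ![rw i * _]mulrC.
by move=> /(_ dw); rewrite mcoeffB !mcoeffZ mulrC subrr eqxx.
Qed.

Local Notation U1 := (\prod_(j < M) \prod_(p < n) lin t j.+1 (n - p)).
Local Notation U2 := (\prod_(j < M) \prod_(p < n) lin t j.+1 (N - p)).

Lemma M_gt0 : (0 < M)%N. Proof. by rewrite muln_gt0 m_gt0. Qed.

(** The factor with j + 1 = m and p = 0 is 1 - t^n q^m. *)
Lemma U1_root : U1.[q] = 0.
Proof.
have lt1 : (m.-1 < M)%N by have := leq_pmulr m d_gt0; lia.
rewrite horner_prod (bigD1 (Ordinal lt1)) //= horner_prod.
rewrite (bigD1 (Ordinal (ltnW n_gt1))) //= subn0 prednK // /lin.
by rewrite !hornerE [t ^+ _ * _]mulrC qt1 subrr !mul0r.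
Qed.

(** A factor 1 - q^(j+1) t^(N-p) vanishes only if j + 1 = ml and N - p = nl
    for some l; as nd <= N - p < n (d + 1), this is l = d, j + 1 = md, p = n
    - 1. Its derivative is nonzero in characteristic 0. *)
Lemma U2_simple_root : U2.[q] = 0 /\ (U2^`()).[q] != 0.
Proof.
have lt1 : (M.-1 < M)%N by have := M_gt0; lia.
have lt2 : (n.-1 < n)%N by lia.
rewrite pair_big (bigD1 (Ordinal lt1, Ordinal lt2)) //=.
have -> : (N - n.-1 = n * d)%N by lia.
rewrite prednK ?M_gt0 //; set L := lin _ _ _; set rest := \prod_(_ | _) _.
have L0 : L.[q] = 0.
  by rewrite /L /lin !hornerE [t ^+ _ * _]mulrC !exprM -exprMn qt1 expr1n subrr.
have L1 : (L^`()).[q] != 0.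
  rewrite /L /lin derivB derivZ derivXn derivC !hornerE oppr_eq0 hornerMn.
  rewrite mulf_neq0 ?expf_neq0 // hornerXn -mulr_natr mulf_neq0 ?expf_neq0 //.
  by rewrite -(prednK M_gt0) char0.
have rest0 : rest.[q] != 0.
  rewrite /rest horner_prod prodf_seq_neq0; apply/allP => -[j p] _ /=.
  apply/implyP; apply: contra => /eqP; rewrite /lin !hornerE => e.
  have [|l [ej ep]] := @relation j.+1 (N - p)%N%:Z.
    by rewrite -exprnP mulrC; apply/eqP; rewrite eq_sym -subr_eq0; apply/eqP.
  have ep' : (N - p = n * l)%N by lia.
  have ltp := ltn_ord p.
  have el : l = d.
    have : (n * l < n * d.+1)%N by rewrite mulnS; lia.
    have : (n * d <= n * l)%N by lia.
    by rewrite leq_pmul2l ?ltn_pmul2l ?(ltnW n_gt1) // => le1 le2; lia.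
  rewrite el in ej ep'; apply/eqP; congr pair; apply: val_inj => /=; lia.
split; first by rewrite hornerM L0 mul0r.
by rewrite derivM hornerD !hornerM L0 mul0r addr0 mulf_neq0.
Qed.

(** The omega weights force the value of g at (1, t, ..., t^(N-1)) to be 0.
    Divide the generic family by the largest power of u - q, so that its
    member at q is not 0, hence proportional to g: its value vanishes at q,
    its leading coefficient does not. In v U1 = c l U2 the left side then has
    a double zero at q and the right side a simple one. *)
Lemma no_rectangular_eigenvector (g : P) :
  g != 0 -> joint_weight q t rw g -> False.
Proof.
move=> g0 gw; have wg : weight q t rw g by move=> i lti; have [] := gw i lti.
have evg : pev t g = 0.
  apply/eqP; apply: contraT => ev0.
  have [//|_ /(congr1 (pev t))] := gw 0%N.
  rewrite pev_omn // pevZ /rank_weight (ltnW n_gt1) => /(mulIf ev0) /eqP.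
  rewrite -[X in X == _]mul1r (inj_eq (mulIf _)) ?expf_neq0 // qM => /eqP/esym.
  by move=> /order_t/eqP; rewrite oppr_eq0 => /eqP[/eqP]; rewrite muln_eq0; lia.
have [v [l [c [[e [E0 eE] eH] l0 c0 rel]]]] :=
  rectangular_family le_nN t_neq0 t_neq1 M.
pose ev := map_poly (pev t : P -> K); pose lc := map_poly (mcoeff mon : P -> K).
have ev_lin a p r : pev t (a *: p + r : P) = a * pev t p + pev t r.
  by rewrite pevD pevZ.
have lc_lin a p r : (a *: p + r : P)@_mon = a * p@_mon + r@_mon.
  by rewrite mcoeffD mcoeffZ.
(* Induction on the size of E divides out the factors u - q one by one. *)
suff descent k (E : {poly P}) : (size E <= k)%N -> E != 0 ->
    (forall u, u != 0 -> weight u t (rank_weight N' n t u M) E.[u%:MP]) ->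
    ev E * U1 = c *: (lc E * U2) -> False.
  have evE : ev E0 = v.
    apply: (poly_ext char0 (s := [:: 0])) => u; rewrite inE => u0.
    by rewrite /ev horner_linear // -eE; have [] := eH u u0.
  have lcE : lc E0 = l.
    apply: (poly_ext char0 (s := [:: 0])) => u; rewrite inE => u0.
    by rewrite /lc horner_linear // -eE; have [] := eH u u0.
  apply: (descent _ E0 (leqnn _)); last by rewrite evE lcE.
    by apply: contra l0 => /eqP E00; rewrite -lcE E00 /lc map_poly0.
  by move=> u u0; rewrite -eE; have [] := eH u u0.
elim: k E => [|k IH] E sE En0 Ew Erel.
  by move: sE; rewrite leqn0 size_poly_eq0 (negbTE En0).
have [Eq0|Eq0] := eqVneq E.[q%:MP] 0.
  have /factor_theorem[F EF] : root E q%:MP by apply/eqP.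
  have Fn0 : F != 0 by apply: contra En0 => /eqP F0; rewrite EF F0 mul0r.
  apply: (IH F) => //.
  - by move: sE; rewrite EF size_Mmonic ?monicXsubC // size_XsubC addn2.
  - move=> u u0 i lti; apply/eqP; rewrite -subr_eq0; apply/eqP.
    pose zi : {poly K} := (if (i < n)%N then 'X^M else 1) * (t ^+ (N' - i))%:P.
    have ziE x : zi.[x] = rank_weight N' n t x M i.
      by rewrite /zi /rank_weight; case: ifP => _; rewrite !hornerE.
    pose f x := xin x t i F.[x%:MP] - rank_weight N' n t x M i *: F.[x%:MP].
    rewrite -/(f u); move: u {u0}; apply: (poly_family_vanish char0 (s := [:: 0; q])).
      have fF : poly_family (fun x => F.[x%:MP]) by exists F.
      apply: poly_family_D; first exact: poly_family_xin.
      have [H HE] := poly_family_scale (- zi) fF.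
      by exists H => x; rewrite -HE hornerN ziE scaleNr.
    move=> x; rewrite !inE negb_or => /andP[x0 xq]; rewrite /f.
    have := Ew x x0 i lti; rewrite EF hornerM hornerXsubC -rmorphB /= mulrC.
    rewrite mul_mpolyC xinZ // => xE; apply: (scalerI (a := x - q)).
      by rewrite subr_eq0.
    rewrite scalerBr xE scaler0 [X in _ - X]scalerA [(x - q) * _]mulrC.
    by rewrite -[X in _ - X]scalerA subrr.
  move: Erel; rewrite EF /ev /lc !map_linear_XsubC // -/ev -/lc => Erel.
  apply: (mulfI (x := 'X - q%:P)); first by rewrite polyXsubC_eq0.
  by rewrite mulrA [_ * ev F]mulrC Erel -scalerAr; congr (_ *: _); ring.
have wE := Ew q q_neq0.
have Emon : E.[q%:MP]@_mon != 0 by apply: rectangular_coef.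
have gmon : g@_mon != 0 by apply: rectangular_coef.
have evq : (ev E).[q] = 0.
  have /(congr1 (pev t)) := rectangular_eigenspace wg wE.
  rewrite !pevZ evg mulr0 => /esym/eqP; rewrite mulf_eq0 (negbTE gmon) /=.
  by move=> /eqP; rewrite /ev horner_linear.
(* The derivatives at q tell the double zero from the simple one. *)
have [U20 U21] := U2_simple_root.
have := congr1 (fun p => (p^`()).[q]) Erel.
rewrite derivZ !derivM hornerZ !hornerD !hornerM evq U1_root U20 !mulr0 mul0r !add0r.
move=> /esym/eqP; rewrite !mulf_eq0 (negbTE c0) (negbTE U21) orbF /=.
by rewrite /lc horner_linear // (negbTE Emon).
Qed.

End NoEigenvector.

(** * The orbit of a singular polynomial *)

Section SingularOrbit.
Variables (K : fieldType) (N' : nat) (q t : K).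
Local Notation N := N'.+1.
Local Notation P := {mpoly K[N]}.
Local Notation T := (@Tn K N t).
Local Notation Tv := (@Tvn K N t).
Implicit Types (f g p : P) (s h : P -> P) (i j k : nat).
Hypothesis t_neq0 : t != 0.

(** On singular polynomials w is this element of the Hecke algebra, by the
    equation for the last index; [xin_omn] shows that the equations for the
    other indices are this one at the images of the polynomial under T_0^-1
    ... T_(i-1)^-1. *)
Definition theta f : P := t ^ (1 - N%:Z) *: Tw t f (rev (iota 0 N')).

Lemma Tw_inj r : in_range N r -> injective (fun f : P => Tw t f r).
Proof.
elim: r => [_ f g //|j r IH /= /andP[ltj /IH inj] f g] e.
by apply/inj/(can_inj (TnK t_neq0 ltj)).
Qed.

Lemma Tw_cat f r r' : Tw t f (r ++ r') = Tw t (Tw t f r') r.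
Proof. exact: foldr_cat. Qed.

Lemma Tvw_last f i : Tvw t f (iota 0 i.+1) = Tvw t (Tv i f) (iota 0 i).
Proof.
have -> : iota 0 i.+1 = iota 0 i ++ [:: i] by rewrite -addn1 iotaD.
exact: foldr_cat.
Qed.

Lemma iota_word f i : (i <= N')%N ->
  Tw t (Tvw t f (iota 0 i)) (rev (iota 0 i)) = f.
Proof.
elim: i f => [//|i IH] f lei.
rewrite rev_iotaS add0n Tvw_last [LHS]/= IH; last exact: ltnW.
by rewrite TvnK.
Qed.

Lemma theta_Tvw f i : (i <= N')%N ->
  theta (Tvw t f (iota 0 i)) =
  t ^ (1 - N%:Z) *: Tw t f (rev (iota i (N' - i))).
Proof.
move=> lei; rewrite /theta; congr (_ *: _).
have -> : iota 0 N' = iota 0 i ++ iota i (N' - i) by rewrite -{1}(subnKC lei) iotaD.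
by rewrite rev_cat Tw_cat iota_word.
Qed.

Definition twisted f := w q f = theta f.

Lemma xin_omn f i : (i < N)%N ->
  twisted (Tvw t f (iota 0 i)) <-> xin q t i f = omn t i f.
Proof.
move=> lti; have lei : (i <= N')%N by [].
have ri : in_range N (iota i (N' - i)) by apply: in_range_iota; lia.
have omnE : omn t i f = t ^+ i *: Tw t (theta (Tvw t f (iota 0 i))) (iota i (N' - i)).
  rewrite theta_Tvw // TwZ // scalerA exprnP -expfzDr //.
  by rewrite /omn; congr (t ^ _ *: _); lia.
rewrite /twisted omnE /xin; split=> [-> //|/scalerI e].
by apply: (Tw_inj ri); apply: e; rewrite expf_neq0.
Qed.

Lemma twistedD f g : twisted f -> twisted g -> twisted (f + g).
Proof.
move=> tf tg; rewrite /twisted wD tf tg /theta TwD ?scalerDr //.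
by rewrite in_range_rev; apply: in_range_iota; lia.
Qed.

Lemma twistedZ c f : twisted f -> twisted (c *: f).
Proof.
move=> tf; rewrite /twisted wZ tf /theta TwZ; first by rewrite !scalerA mulrC.
by rewrite in_range_rev; apply: in_range_iota; lia.
Qed.

Lemma twisted_T j f : (j.+2 < N)%N -> twisted f -> twisted (T j.+1 f).
Proof.
move=> ltj tf; rewrite /twisted w_Tn // tf /theta TnZ; last exact: ltnW.
by rewrite (Tw_rev_shift t_neq0) //; lia.
Qed.

(** The combinations of products of an element of the subalgebra generated by
    T_1, T_2, ... with one of the representatives T_0^-1 ... T_(i-1)^-1. They
    form a right ideal that contains 1, so the whole Hecke algebra consists of
    them ([coset_span_hecke]). Singularity of p is the equation w f = theta f
    at the representatives applied to p, and this equation is stable under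
    T_1, T_2, ..., since w T_(j+1) = T_j w and theta T_(j+1) = T_j theta. *)
Inductive coset_span : (P -> P) -> Prop :=
| span_rep i : (i < N)%N -> coset_span (fun f => Tvw t f (iota 0 i))
| span_T j s : (j.+2 < N)%N -> coset_span s -> coset_span (fun f => T j.+1 (s f))
| span_add s s' : coset_span s -> coset_span s' ->
    coset_span (fun f => s f + s' f)
| span_scale c s : coset_span s -> coset_span (fun f => c *: s f).

Lemma coset_span_linear s : coset_span s ->
  forall c f g, s (c *: f + g) = c *: s f + s g.
Proof.
elim=> [i lti|j s' ltj _ IH|s1 s2 _ IH1 _ IH2|a s' _ IH] c f g.
- have ri : in_range N (iota 0 i) by apply: in_range_iota; lia.
  by rewrite TvwD // TvwZ.
- by rewrite IH TnD ?TnZ //; apply: ltnW.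
- by rewrite IH1 IH2 scalerDr addrACA.
- by rewrite IH scalerDr !scalerA mulrC.
Qed.

Lemma rep_T i j : (i < N)%N -> (j.+1 < N)%N ->
  exists2 s, coset_span s & forall f, Tvw t (T j f) (iota 0 i) = s f.
Proof.
move=> lti ltj; have ri : in_range N (iota 0 i) by apply: in_range_iota; lia.
have [ltij|[eij|[ej|ltji]]] :
  (i < j)%N \/ i = j \/ j.+1 = i \/ (j.+1 < i)%N by lia.
- case: j ltj ltij => // j ltj ltij.
  exists (fun f => T j.+1 (Tvw t f (iota 0 i))).
    by apply: (span_T ltj); apply: span_rep.
  by move=> f; rewrite Tvw_far // far_iota //; lia.
- rewrite -{}eij in ltj *.
  exists (fun f => t *: Tvw t f (iota 0 i.+1) + (t - 1) *: Tvw t f (iota 0 i)).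
    exact: (span_add (span_scale t (span_rep ltj))
      (span_scale (t - 1) (span_rep lti))).
  move=> f; have -> : T i f = t *: Tv i f + (t - 1) *: f.
    rewrite Tvn_def scalerA mulfV // scale1r -addrA -scalerDl.
    by rewrite addrA subrK subrr scale0r addr0.
  rewrite TvwD // !TvwZ //; congr (_ *: _ + _).
  by rewrite Tvw_last.
- exists (fun f => Tvw t f (iota 0 j)); first by apply: span_rep; lia.
  by move=> f; rewrite -ej Tvw_last TnK.
- exists (fun f => T j.+1 (Tvw t f (iota 0 i))).
    by apply: span_T; [lia | apply: span_rep].
  by move=> f; rewrite (Tvw_shift t_neq0) //; lia.
Qed.

Lemma coset_span_T s j : coset_span s -> (j.+1 < N)%N ->
  exists2 s', coset_span s' & forall f, s (T j f) = s' f.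
Proof.
move=> ss ltj.
elim: ss => [i lti|k s1 ltk _ [s' ss' e]|s1 s2 _ [s1' ss1 e1] _ [s2' ss2 e2]
  |a s1 _ [s' ss' e]].
- exact: rep_T.
- by exists (fun f => T k.+1 (s' f)); [apply: span_T | move=> f; rewrite e].
- by exists (fun f => s1' f + s2' f); [apply: span_add | move=> f; rewrite e1 e2].
- by exists (fun f => a *: s' f); [apply: span_scale | move=> f; rewrite e].
Qed.

Lemma coset_span_hecke h : hecke t h -> forall s, coset_span s ->
  exists2 s', coset_span s' & forall f, s (h f) = s' f.
Proof.
elim=> [|i lti|h1 h2 _ IH1 _ IH2|c h1 _ IH|h1 h2 _ IH1 _ IH2] s ss.
- by exists s.
- have [s' ss' e] := coset_span_T ss lti.
  by exists s' => // f; rewrite -e TnE.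
- have [s1 ss1 e1] := IH1 s ss; have [s2 ss2 e2] := IH2 s ss.
  exists (fun f => s1 f + s2 f); first exact: span_add.
  move=> f; have := coset_span_linear ss 1 (h1 f) (h2 f).
  by rewrite !scale1r e1 e2.
- have [s1 ss1 e1] := IH s ss; exists (fun f => c *: s1 f); first exact: span_scale.
  move=> f; have := coset_span_linear ss c (h1 f) 0.
  have := coset_span_linear ss (-1) 0 0.
  by rewrite !addr0 scaler0 scaleN1r addNr => -> ->; rewrite addr0 e1.
- have [s1 ss1 e1] := IH1 s ss; have [s2 ss2 e2] := IH2 s1 ss1.
  by exists s2 => // f; rewrite /= e1 e2.
Qed.

Lemma singular_orbit p f : singular q t p -> hecke_orbit t p f ->
  forall i, (i < N)%N -> xin q t i f = omn t i f.
Proof.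
move=> sp [h hh ->] i lti.
have tw s : coset_span s -> twisted (s p).
  elim=> [k ltk|j s' ltj _ IH|s1 s2 _ IH1 _ IH2|a s' _ IH].
  - apply/xin_omn => //; have := sp (Ordinal ltk).
    by rewrite xiE // omegaE.
  - exact: twisted_T.
  - exact: twistedD.
  - exact: twistedZ.
have [s ss e] := coset_span_hecke hh (span_rep lti).
by apply/xin_omn => //; rewrite e; apply: tw.
Qed.

End SingularOrbit.

(** * Singular parameters *)

Section RootsOfUnity.
Variable R : realType.
Implicit Types (x y : R) (q t u : R[i]).

Definition cis x : R[i] := (cos x +i* sin x)%C.

Lemma cisD x y : cis (x + y) = cis x * cis y.
Proof. by apply/eqP; rewrite eq_complex /= cosD sinD eqxx /= addrC. Qed.

Lemma cis0 : cis 0 = 1.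
Proof. by rewrite /cis cos0 sin0. Qed.

Lemma cisMn x j : cis (x *+ j) = cis x ^+ j.
Proof. by elim: j => [|j IH]; rewrite ?cis0 // mulrS cisD IH exprS. Qed.

Lemma cisV x : cis x * cis (- x) = 1.
Proof. by rewrite -cisD subrr cis0. Qed.

Lemma cis_neq0 x : cis x != 0.
Proof. by apply/eqP => c0; have /eqP := cisV x; rewrite c0 mul0r eq_sym oner_eq0. Qed.

Lemma cisN x : cis (- x) = (cis x)^-1.
Proof. by apply: (mulfI (cis_neq0 x)); rewrite cisV mulfV ?cis_neq0. Qed.

Lemma cisMz x (k : int) : cis (x *~ k) = cis x ^ k.
Proof. by case: k => j; [apply: cisMn | rewrite NegzE mulrNz cisN cisMn exprnN]. Qed.

Definition prim_root m := cis (2 * pi / m%:R).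

Lemma unity_root_cis m k : unity_root R m k = prim_root m ^ k.
Proof.
rewrite -cisMz -[LHS]/(cis (2 * pi * k%:~R / m%:R)).
by rewrite -[in RHS]mulrzr mulrAC.
Qed.

(** If cos (2 a) = 1 then sin a = 0, which excludes 0 < a < pi. *)
Lemma prim_rootP m : (0 < m)%N -> m.-primitive_root (prim_root m).
Proof.
move=> m0; have mR : 0 < m%:R :> R by rewrite ltr0n.
rewrite /primitive_root_of_unity m0 /=; apply/forallP => i; apply/eqP.
rewrite unity_rootE -cisMn; have [->|neim] := eqVneq i.+1 m.
  have -> : 2 * pi / m%:R *+ m = pi *+ 2 :> R.
    by rewrite -[LHS]mulr_natr -[RHS]mulr_natr; field; rewrite gt_eqF.
  by rewrite /cis cos2pi sin2pi eqxx.
have lti : (i.+1 < m)%N by rewrite ltn_neqAle neim ltn_ord.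
apply/negP => /eqP e.
set a : R := pi * (i.+1%:R / m%:R).
have ea : 2 * pi / m%:R *+ i.+1 = a *+ 2.
  by rewrite /a -[LHS]mulr_natr -[RHS]mulr_natr; field; rewrite gt_eqF.
have : cos (a *+ 2) = 1 by move: e; rewrite -ea => /(congr1 (@complex.Re R)).
rewrite cos_mulr2n => c1.
have /cos1sin0 s0 : `|cos a| = 1.
  by apply/eqP; rewrite -sqr_norm_eq1; apply/eqP; lra.
have : 0 < sin a.
  apply: sin_gt0_pi; rewrite /a; apply/andP; split.
    by rewrite mulr_gt0 ?pi_gt0 // divr_gt0 ?ltr0n.
  by rewrite -[ltRHS]mulr1 ltr_pM2l ?pi_gt0 // ltr_pdivrMr // mul1r ltr_nat.
by rewrite s0 ltxx.
Qed.

(** With q = w^c u^(-n/g) and t = u^(m/g), w a primitive m-th root of unity,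
    the m-th power of the relation gives (m/g) b = (n/g) a, as u has infinite
    order. Hence a = (m/g) s and b = (n/g) s, and the root of unity gives g |
    c s, so g | s. *)
Lemma singular_parameterP m n q t : (0 < m)%N -> (0 < n)%N ->
  singular_parameter m n q t ->
  [/\ q != 0, t != 0, q ^+ m * t ^+ n = 1 &
      forall (a : nat) (b : int), q ^+ a * t ^ b = 1 ->
        exists l : nat, a = (m * l)%N /\ b = (n * l)%N%:Z].
Proof.
move=> m0 n0 [k [u [cop u0 un]]]; set g := gcdn m n in cop *.
have g0 : (0 < g)%N by rewrite gcdn_gt0 m0.
set m' := (m %/ g)%N; set n' := (n %/ g)%N.
have em : m = (m' * g)%N by rewrite divnK // dvdn_gcdl.
have en : n = (n' * g)%N by rewrite divnK // dvdn_gcdr.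
have m'0 : (0 < m')%N by move: m0; rewrite em muln_gt0 => /andP[].
have cop' : coprime m' n'.
  by rewrite /coprime -(eqn_pmul2r g0) mul1n muln_gcdl -em -en.
have prim := prim_rootP m0; set w := prim_root m in prim.
have [c [copc ->]] : exists c : int, coprimez c g%:Z /\
    (if g == 1%N then 1 else unity_root R m k) = w ^ c.
  case: eqP => [->|_]; last by exists k; rewrite unity_root_cis.
  by exists 0; rewrite expr0z.
have w0 : w != 0 by apply: cis_neq0.
move=> -> ->; have uz (e : int) : u ^ e = 1 -> e = 0.
  case: e => [[//|e]|e] ue; first by have /eqP := un e.+1 isT.
  have := un e.+1 isT; move: ue; rewrite NegzE -exprnN => /eqP.
  by rewrite invr_eq1 => /eqP ->; rewrite eqxx.
have wz (e : int) : w ^ e = 1 <-> (m%:Z %| e)%Z.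
  have -> : (m%:Z %| e)%Z = (m %| `|e|)%N by [].
  rewrite (prim_order_dvd prim); case: e => e /=.
    by split=> [e1|/eqP //]; apply/eqP.
  rewrite NegzE -exprnN; split=> [/eqP|/eqP ->]; last by rewrite invr1.
  by rewrite invr_eq1.
have qE (a : nat) : (w ^ c * u ^- n') ^+ a = w ^ (c * a%:Z) * u ^ (- (n' * a)%N%:Z).
  by rewrite exprnP expfzMl exprz_exp exprnN exprz_exp PoszM mulNr.
have tE (b : int) : (u ^+ m') ^ b = u ^ (m'%:Z * b) by rewrite exprnP exprz_exp.
split.
- by rewrite mulf_neq0 ?expfz_neq0 // invr_neq0 // expf_neq0.
- by rewrite expf_neq0.
- rewrite qE [X in _ * X]exprnP tE -mulrA -expfzDr //.
  have -> : - (n' * m)%N%:Z + m'%:Z * n%:Z = 0 by rewrite {1}em {1}en; lia.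
  by rewrite expr0z mulr1; apply/wz; rewrite dvdz_mull.
move=> a b; rewrite qE tE -mulrA -expfzDr // => e.
have e0 : - (n' * a)%N%:Z + m'%:Z * b = 0.
  have /= := congr1 (fun y : R[i] => y ^+ m) e.
  rewrite expr1n exprMn !exprnP !exprz_exp.
  have -> : w ^ (c * a%:Z * m%:Z) = 1 by apply/wz; rewrite dvdz_mull.
  rewrite mul1r => /uz /eqP; rewrite mulf_eq0.
  by case/orP => /eqP //; lia.
have [s es] : exists s : nat, a = (m' * s)%N.
  have : (m' %| n' * a)%N by apply/dvdnP; exists `|b|%N; lia.
  by rewrite Gauss_dvdr // => /dvdnP[s ->]; exists s; rewrite mulnC.
have eb : b = (n' * s)%N%:Z.
  apply: (mulfI (x := m'%:Z)); first by lia.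
  by move: e0; rewrite es; lia.
move: e; rewrite e0 expr0z mulr1 es => /wz.
have -> : c * (m' * s)%N%:Z = m'%:Z * (c * s%:Z) by rewrite PoszM; ring.
rewrite {1}em PoszM dvdz_mul2l ?eqz_nat ?gtn_eqF // Gauss_dvdzr; last first.
  by rewrite coprimez_sym.
move=> /dvdnP[l /= el]; exists l.
by rewrite eb el {1}em {1}en; split; [|congr Posz]; ring.
Qed.

End RootsOfUnity.

(** * Tableaux forced to be row readings *)

Section RowReading.
Local Open Scope nat_scope.
Variables (N n : nat) (tau rw cl k : nat -> nat).
Hypothesis tau_mono : forall r r', r <= r' -> tau r' <= tau r.
Hypothesis in_tau : forall j, j < N -> cl j < tau (rw j).
Hypothesis onto_tau : forall r c, c < tau r ->
  exists j, [/\ j < N, rw j = r & cl j = c].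
Hypothesis cell_inj : forall i j, i < N -> j < N ->
  rw i = rw j -> cl i = cl j -> i = j.
Hypothesis row_order : forall i j, i < N -> j < N ->
  rw i = rw j -> cl i < cl j -> i < j.
Hypothesis col_order : forall i j, i < N -> j < N ->
  cl i = cl j -> rw i < rw j -> i < j.
Hypothesis content_k : forall j, j < N -> cl j + n * k j = j + rw j.
Hypothesis k_mono : forall j, j.+1 < N -> k j <= k j.+1.

(** If the next cell were in an earlier row, then, as the content grows by at
    most 1 from one cell to the next, it would be weakly above and to the
    left of the present one, and would come first. *)
Lemma rows_mono_step j : j.+1 < N -> rw j <= rw j.+1.
Proof.
move=> ltj; rewrite leqNgt; apply/negP => lt_rw; have ltj' := ltnW ltj.
have e := content_k ltj'; have e' := content_k ltj.
have le_nk : n * k j <= n * k j.+1 by rewrite leq_mul2l k_mono ?orbT.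
have le_cl : cl j.+1 <= cl j by lia.
have [i [lti ri ci]] : exists i, [/\ i < N, rw i = rw j & cl i = cl j.+1].
  by apply: onto_tau; apply: leq_ltn_trans le_cl (in_tau ltj').
have lt1 : j.+1 < i by apply: col_order; rewrite ?ci ?ri.
have [lt_cl|] : cl j.+1 < cl j \/ cl j.+1 = cl j by lia.
  by have : i < j by [apply: row_order; rewrite ?ci ?ri]; lia.
by move=> ec; have : i = j by [apply: cell_inj; rewrite ?ci ?ri]; lia.
Qed.

Lemma rows_mono i j : i <= j -> j < N -> rw i <= rw j.
Proof.
elim: j => [|j IH]; first by rewrite leqn0 => /eqP->.
rewrite leq_eqVlt => /orP[/eqP-> //|lti ltj].
by apply: leq_trans (rows_mono_step ltj); apply: IH => //; apply: ltnW.
Qed.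

(** The rows come one after the other, and within a row the cells from left
    to right, as the diagram is filled without gaps. *)
Lemma row_reading j : j.+1 < N ->
  (rw j.+1 = rw j /\ cl j.+1 = (cl j).+1) \/
  [/\ rw j.+1 = (rw j).+1, cl j.+1 = 0 & tau (rw j) = (cl j).+1].
Proof.
move=> ltj; have ltj' := ltnW ltj; have le_rw := rows_mono_step ltj.
have [e_rw|lt_rw] : rw j.+1 = rw j \/ rw j < rw j.+1 by lia.
  left; split=> //; have [lt_cl|[e|gt_cl]] :
    cl j.+1 < cl j \/ cl j.+1 = cl j \/ cl j < cl j.+1 by lia.
  - by have : j.+1 < j by [apply: row_order]; lia.
  - by have : j.+1 = j by [apply: cell_inj]; lia.
  apply/eqP; rewrite eqn_leq gt_cl andbT leqNgt; apply/negP => lt_cl.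
  have [i [lti ri ci]] : exists i, [/\ i < N, rw i = rw j & cl i = (cl j).+1].
    by apply: onto_tau; have := in_tau ltj; rewrite e_rw; lia.
  have : j < i by apply: row_order; rewrite ?ci.
  have : i < j.+1 by apply: row_order; rewrite ?ci ?ri.
  by lia.
right; have lt_in := in_tau ltj'; split.
- apply/eqP; rewrite eqn_leq lt_rw andbT leqNgt; apply/negP => lt2.
  have [i [lti ri _]] : exists i, [/\ i < N, rw i = (rw j).+1 & cl i = 0].
    apply: onto_tau; have := in_tau ltj; have := tau_mono (ltnW lt2); lia.
  have [leij|ltji] := leqP i j; first by have := rows_mono leij ltj'; lia.
  by have := rows_mono ltji lti; lia.
- apply/eqP; rewrite -leqn0 leqNgt; apply/negP => cl0.
  have [i [lti ri ci]] : exists i, [/\ i < N, rw i = rw j.+1 & cl i = 0].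
    by apply: onto_tau; have := in_tau ltj; lia.
  have : i < j.+1 by apply: row_order; rewrite ?ci.
  by rewrite ltnS => leij; have := rows_mono leij ltj'; lia.
apply/eqP; rewrite eqn_leq lt_in andbT leqNgt; apply/negP => lt2.
have [i [lti ri ci]] := onto_tau lt2.
have ltji : j < i by apply: row_order; rewrite ?ci ?ri.
by have := rows_mono ltji lti; lia.
Qed.

Lemma row_end r : 0 < tau r.+1 -> exists j,
  [/\ j.+1 < N, rw j = r, tau r = (cl j).+1, rw j.+1 = r.+1 & cl j.+1 = 0].
Proof.
move=> pos; have [i [lti ri ci]] := onto_tau pos.
have [i0 [lti0 ri0 ci0]] : exists i, [/\ i < N, rw i = r & cl i = 0].
  by apply: onto_tau; have := tau_mono (leqnSn r); lia.
have : i0 < i by apply: col_order; rewrite ?ci ?ri ?ri0.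
case: i lti ri ci => [//|j] ltj rj cj _; exists j.
case: (row_reading ltj) => [[_ e]|[e _ et]]; first by rewrite cj in e.
have rj' : rw j = r by lia.
by split=> //; rewrite -et rj'.
Qed.

(** From the end of row r to the start of row r + 1 the content changes from
    tau_r - 1 - r to - r - 1, while j grows by 1: the multiples of n account
    for the difference tau_r + 1. *)
Lemma dvd_row r : 0 < tau r.+1 -> n %| (tau r).+1.
Proof.
move=> /row_end[j [ltj rj tj rj' cj']].
have := content_k ltj; have := content_k (ltnW ltj); rewrite rj rj' cj' => e e'.
have -> : (tau r).+1 = n * k j.+1 - n * k j by lia.
by rewrite -mulnBr dvdn_mulr.
Qed.

Lemma first_row j : j < tau 0 -> [/\ j < N, rw j = 0 & cl j = j].
Proof.
elim: j => [|j IH] ltj; have [i [lti ri ci]] := onto_tau ltj.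
  have N0 : 0 < N by lia.
  have r0 : rw 0 = 0 by have := rows_mono (leq0n i) lti; lia.
  split=> //; apply/eqP; rewrite -leqn0 leqNgt; apply/negP => c0.
  by have : i < 0 by [apply: row_order; rewrite ?ci ?ri].
have [ltjN rj cj] := IH (ltnW ltj).
have lt : j < i by apply: row_order; rewrite ?ci ?cj ?ri ?rj.
have ltjN' : j.+1 < N by lia.
by split=> //; case: (row_reading ltjN') => [[]|[_ _]]; rewrite rj cj //; lia.
Qed.

Lemma second_row c : c < tau 1 ->
  [/\ tau 0 + c < N, rw (tau 0 + c) = 1 & cl (tau 0 + c) = c].
Proof.
elim: c => [|c IH] ltc.
  have [j [ltj rj tj rj' cj']] := row_end ltc.
  have [|lt0 r0 c0] := @first_row (cl j); first by rewrite tj.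
  have ej : j = cl j by apply: cell_inj => //; [exact: ltnW | rewrite r0].
  by rewrite addn0 tj -ej.
have [ltN r1 c1] := IH (ltnW ltc).
have [i [lti ri ci]] := onto_tau ltc.
have lt : tau 0 + c < i by apply: row_order; rewrite ?r1 ?c1 ?ri ?ci.
have ltN' : (tau 0 + c).+1 < N by lia.
rewrite addnS; split=> //; case: (row_reading ltN') => [[]|[_ _]];
  by rewrite r1 c1 //; lia.
Qed.

(** In a single row the content of the j-th cell is j, which forces k = 0. *)
Lemma second_row_neq0 : 0 < n -> 0 < N -> 0 < k N.-1 -> 0 < tau 1.
Proof.
move=> n0 N0 k0; rewrite lt0n; apply/eqP => t1.
have ltN : N.-1 < N by rewrite prednK.
have rN : rw N.-1 = 0.
  apply/eqP; rewrite -leqn0 leqNgt; apply/negP => r0.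
  by have := in_tau ltN; have := tau_mono r0; lia.
have all0 j : j < N -> rw j = 0.
  by move=> ltj; have := rows_mono (_ : j <= N.-1) ltN; lia.
have clE j : j < N -> cl j = j.
  elim: j => [|j IH] ltj.
    have [|? _ //] := @first_row 0.
    by have := in_tau N0; rewrite all0 //; lia.
  case: (row_reading ltj) => [[_ ->]|[e _ _]]; first by rewrite IH // ltnW.
  by move: e; rewrite !all0 //; lia.
have := content_k ltN; rewrite clE // rN addn0 => /eqP.
by rewrite -[X in _ == X]addn0 eqn_add2l muln_eq0; lia.
Qed.

End RowReading.

(** * Diagrams of partitions *)

Section Diagrams.
Local Open Scope nat_scope.

Lemma sum_nth_le (s : seq nat) k : \sum_(i < k) nth 0 s i <= sumn s.
Proof.
elim: s k => [|a s IH] [|k]; rewrite ?big_ord0 //.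
  by rewrite big1 // => i _; rewrite nth_nil.
by rewrite big_ord_recl /= leq_add2l; apply: IH.
Qed.

Lemma sum_ltn k a : \sum_(c < k) (c < a)%N <= a.
Proof.
suff -> : \sum_(c < k) (c < a)%N = minn k a by apply: geq_minr.
elim: k => [|k IH]; first by rewrite big_ord0 min0n.
by rewrite big_ord_recr /= IH; case: ltnP; lia.
Qed.

Lemma partition_mono tau r r' : sorted geq tau -> r <= r' ->
  nth 0 tau r' <= nth 0 tau r.
Proof.
move=> st le_r; have [ltr|ler] := ltnP r' (size tau); last first.
  by rewrite nth_default.
apply: (sorted_leq_nth (leT := geq)) => //; rewrite ?inE //.
- by move=> a b c /= h1 h2; apply: leq_trans h2 h1.
- exact: leqnn.
- exact: leq_ltn_trans ltr.
Qed.

Lemma partition_part_le N tau r : is_partition N tau -> nth 0 tau r <= N.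
Proof.
move=> /andP[_ /eqP <-]; apply: leq_trans (sum_nth_le tau r.+1).
by rewrite big_ord_recr /= leq_addl.
Qed.

Lemma partition_length N tau r : is_partition N tau -> 0 < nth 0 tau r -> r < N.
Proof.
move=> /andP[st /eqP <-] pos; apply: leq_trans (sum_nth_le tau r.+1).
rewrite -{1}[r.+1]card_ord -sum1_card; apply: leq_sum => i _.
by apply: leq_trans pos _; apply: partition_mono; rewrite // -ltnS.
Qed.

(** The diagram has at most N cells and the filling is injective. *)
Lemma rsyt_onto N tau (Y : rsyt N tau) r c : is_partition N tau ->
  c < nth 0 tau r -> exists k : 'I_N, (val Y k).1 = r :> nat /\ (val Y k).2 = c :> nat.
Proof.
move=> pt lt_c; have /and4P[/injectiveP injY /forallP inY _ _] := valP Y.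
pose D := [set x : 'I_N * 'I_N | x.2 < nth 0 tau x.1].
have cardD : #|D| <= N.
  have /andP[_ /eqP sumN] := pt; apply: leq_trans (_ : sumn tau <= N); last first.
    by rewrite sumN.
  apply: leq_trans (sum_nth_le tau N).
  have -> : #|D| = \sum_(i < N) \sum_(j < N) (j < nth 0 tau i)%N.
    rewrite pair_bigA /= -sum1_card big_mkcond; apply: eq_bigr => -[i j] _.
    by rewrite inE /=; case: ltnP.
  by apply: leq_sum => i _; apply: sum_ltn.
have eD : val Y @: 'I_N = D.
  apply/eqP; rewrite eqEcard card_imset // card_ord cardD andbT.
  by apply/subsetP => _ /imsetP[k _ ->]; rewrite inE.
have ltr : r < N by apply: (partition_length pt); apply: leq_trans lt_c.
have ltc : c < N := leq_trans lt_c (partition_part_le r pt).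
have : (Ordinal ltr, Ordinal ltc) \in D by rewrite inE.
by rewrite -eD => /imsetP[k _ e]; exists k; rewrite -e.
Qed.

(** L is one less than the number of nonzero rows. *)
Lemma nd_expression_exists n tau : (0 < n) -> sorted geq tau ->
  0 < nth 0 tau 1 -> (forall r, 0 < nth 0 tau r.+1 -> n %| (nth 0 tau r).+1) ->
  exists ds r, nd_expression n tau ds r.
Proof.
move=> n0 st pos dv; pose h := count (leq 1) tau.
have hP i : (0 < nth 0 tau i) = (i < h).
  rewrite /h; elim: tau st i {pos dv h} => [|a s IH] st i; first by rewrite nth_nil.
  have ss := path_sorted st; have a_s : forall j, nth 0 s j <= a.
    by move=> j; apply: (@partition_mono (a :: s) 0 j.+1).
  have [a0|a_pos] := posnP a; last first.
    by case: i => [|i] /=; rewrite a_pos // IH.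
  have c0 : count (leq 1) s = 0.
    apply/eqP; rewrite eqn0Ngt -has_count; apply/hasP => -[x /(nthP 0)[j _ <-]] /=.
    by have := a_s j; rewrite a0 leqn0 => /eqP ->.
  by rewrite /= c0 a0; case: i => [|i] //=; have := a_s i; rewrite a0 leqn0 => /eqP ->.
have h2 : 1 < h by rewrite -hP.
have row i : i < h.-1 -> (n * ((nth 0 tau i).+1 %/ n))%N = (nth 0 tau i).+1.
  by move=> lti; rewrite mulnC divnK // dv // hP; lia.
pose ds := [seq (nth 0 tau i).+1 %/ n | i <- iota 0 h.-1].
have sds : size ds = h.-1 by rewrite size_map size_iota.
have nds i : i < h.-1 -> nth 0 ds i = (nth 0 tau i).+1 %/ n.
  by move=> lti; rewrite (nth_map 0) ?size_iota // nth_iota.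
exists ds, (nth 0 tau h.-1); split.
- by rewrite sds; lia.
- rewrite /ds sorted_map; apply: (sub_sorted (e := leq)); last exact: iota_sorted.
  by move=> i j /= le_ij; apply: leq_div2r; rewrite ltnS; apply: partition_mono.
- apply/(all_nthP 0) => i; rewrite sds => lti; rewrite nds // divn_gt0 //.
  by rewrite -(row i lti) leq_pmulr //; have := row i lti; case: (_ %/ _) => //; rewrite muln0.
- have lt2 : h.-2 < h.-1 by lia.
  rewrite -(nth_last 0) sds nds // row // subn1 /=.
  by apply: partition_mono => //; lia.
move=> i; rewrite nth_rcons size_map sds; case: ltngtP => lti.
- by rewrite (nth_map 0) ?sds // nds // row // subn1.
- by apply/eqP; rewrite eqn0Ngt hP; lia.
- by rewrite lti.
Qed.

End Diagrams.

(** * Tableaux with contents N - 1 - i - n k_i *)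

(** The cells are listed in the order of decreasing entries: the j-th cell
    holds the entry N - 1 - j. *)
Lemma rsyt_row_reading N' n tau (Y : rsyt N'.+1 tau) (k : nat -> nat) :
  (0 < n)%N -> is_partition N'.+1 tau ->
  (forall i : 'I_N'.+1, content i Y + (n * k i)%N%:Z = (N' - i)%N%:Z) ->
  (forall i, (i.+1 < N'.+1)%N -> (k i.+1 <= k i)%N) -> (0 < k 0)%N ->
  [/\ (0 < nth 0 tau 1)%N,
      forall r, (0 < nth 0 tau r.+1)%N -> (n %| (nth 0 tau r).+1)%N,
      forall i : 'I_N'.+1, (N' - i < nth 0 tau 0)%N ->
        content i Y = (N' - i)%N%:Z &
      forall (i : 'I_N'.+1) c, (N' - i)%N = (nth 0 tau 0 + c)%N ->
        (c < nth 0 tau 1)%N -> content i Y = c%:Z - 1].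
Proof.
move=> n0 pt cont kmono k0.
have /and4P[/injectiveP injY /forallP inY /forallP rowY /forallP colY] := valP Y.
pose e j : 'I_N'.+1 := inord (N' - j).
have eE j : (j < N'.+1)%N -> e j = (N' - j)%N :> nat.
  by move=> ltj; rewrite /e inordK; lia.
have eK (i : 'I_N'.+1) : e (N' - i)%N = i.
  by apply: val_inj; rewrite /= eE; have := ltn_ord i; lia.
pose rw j : nat := (val Y (e j)).1; pose cl j : nat := (val Y (e j)).2.
pose kk j := k (N' - j)%N.
have H1 r r' : (r <= r')%N -> (nth 0 tau r' <= nth 0 tau r)%N.
  by apply: partition_mono; have /andP[] := pt.
have H2 j : (j < N'.+1)%N -> (cl j < nth 0 tau (rw j))%N by move=> _; apply: inY.
have H3 r c : (c < nth 0 tau r)%N ->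
    exists j, [/\ (j < N'.+1)%N, rw j = r & cl j = c].
  move=> /(rsyt_onto Y pt)[i [ri ci]]; exists (N' - i)%N.
  by rewrite /rw /cl eK; split=> //; lia.
have H4 i j : (i < N'.+1)%N -> (j < N'.+1)%N -> rw i = rw j -> cl i = cl j -> i = j.
  move=> lti ltj er ec; have : e i = e j.
    apply: injY; move: er ec; rewrite /rw /cl.
    case: (val Y (e i)) (val Y (e j)) => [a b] [a' b'] /= ea eb.
    by congr pair; apply: val_inj.
  by move=> /(congr1 val); rewrite /= !eE //; lia.
have H5 i j : (i < N'.+1)%N -> (j < N'.+1)%N -> rw i = rw j ->
    (cl i < cl j)%N -> (i < j)%N.
  move=> lti ltj er lt; have /forallP/(_ (e j)) := rowY (e i).
  by rewrite -val_eqE /= -/(rw i) -/(rw j) er eqxx lt /= !eE //; lia.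
have H6 i j : (i < N'.+1)%N -> (j < N'.+1)%N -> cl i = cl j ->
    (rw i < rw j)%N -> (i < j)%N.
  move=> lti ltj er lt; have /forallP/(_ (e j)) := colY (e i).
  by rewrite -val_eqE /= -/(cl i) -/(cl j) er eqxx lt /= !eE //; lia.
have H7 j : (j < N'.+1)%N -> (cl j + n * kk j = j + rw j)%N.
  move=> ltj; have := cont (e j); rewrite /content -/(rw j) -/(cl j) eE // /kk.
  by set x := (n * _)%N; lia.
have H8 j : (j.+1 < N'.+1)%N -> (kk j <= kk j.+1)%N.
  move=> ltj; rewrite /kk; have -> : (N' - j)%N = (N' - j.+1).+1 by lia.
  by apply: kmono; lia.
have contE (i : 'I_N'.+1) : content i Y = (cl (N' - i)%N)%:Z - (rw (N' - i)%N)%:Z.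
  by rewrite /content /cl /rw eK.
split.
- apply: (second_row_neq0 H1 H2 H3 H4 H5 H6 H7 H8) => //.
  by rewrite /kk subnn.
- exact: (dvd_row H1 H2 H3 H4 H5 H6 H7 H8).
- move=> i /(first_row H1 H2 H3 H4 H5 H6 H7 H8)[_ r c].
  by rewrite contE r c subr0.
- move=> i c ei /(second_row H1 H2 H3 H4 H5 H6 H7 H8)[_ r cc].
  by rewrite contE ei r cc.
Qed.

Lemma nd_expression_shape n tau ds r :
  nd_expression n tau ds r ->
  (forall i, (1 <= i < size ds)%N -> nth 0%N ds i = 1%N) ->
  exists d L r : nat,
    [/\ (1 <= d)%N, (1 <= L)%N
      & same_shape tau ((n * d - 1)%N :: rcons (nseq (L - 1) (n - 1)%N) r)].
Proof.
case: ds => [|d ds] [//= _ _ /andP[d1 _] _ sh] ones; exists d, (size ds).+1, r.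
split=> // i; rewrite sh /= subSS subn0; congr (nth 0%N (_ :: rcons _ r) i).
apply: (@eq_from_nth _ 0%N) => [|j]; rewrite size_map ?size_nseq // => ltj.
by rewrite (nth_map 0%N) // nth_nseq ltj; have /= -> := ones j.+1 ltj; rewrite muln1.
Qed.

(** * The isotype of a singular polynomial *)

Section ConstantTerm.
Variables (K : fieldType) (N : nat).
Implicit Types p f : {mpoly K[N]}.

Lemma homogeneous_coef0 d p : p \is d.-homog ->
  (forall c : K, p <> c%:MP) -> p@_0%MM = 0.
Proof.
move=> hp pc; apply/eqP; apply: contraT => p0.
have d0 : d = 0%N.
  apply/eqP; apply: contraR p0 => d0.
  by rewrite (dhomog_nemf_coeff hp) //= mdeg0 eq_sym.
case: (pc p@_0%MM); apply/mpolyP => m; rewrite mcoeffC.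
have [->|m0] := eqVneq m 0%MM; first by rewrite mulr1.
by rewrite mulr0 (dhomog_nemf_coeff hp) //= d0 mdeg_eq0.
Qed.

(** In T_i f the divided difference is multiplied by a variable, so the
    constant term of T_i f is t times that of f. *)
Lemma orbit_coef0 (t : K) p f : p@_0%MM = 0 -> hecke_orbit t p f -> f@_0%MM = 0.
Proof.
move=> + [h hh ->]; elim: hh p => {h f} [//|i lti|h1 h2 _ IH1 _ IH2|c h _ IH
  |h1 h2 _ IH1 _ IH2] p p0.
- rewrite /T mcoeffD !mcoeffZ mcoeff_sym rmorphM /= mcoeffX mnm1_eq0 mul0r mulr0.
  rewrite add0r [X in p@_X](_ : _ = 0%MM) ?p0 ?mulr0 //.
  by apply/mnmP => j; rewrite mnmE !mnm0E.
- by rewrite mcoeffD IH1 ?IH2 ?addr0.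
- by rewrite mcoeffZ IH ?mulr0.
- by apply: IH1; apply: IH2.
Qed.

End ConstantTerm.

Lemma exponents_below_sum (K : fieldType) N B (I : finType) (b : I -> {mpoly K[N]})
    (a : I -> K) : (forall i, exponents_below B (b i)) ->
  exponents_below B (\sum_i a i *: b i).
Proof.
move=> bb m; rewrite raddf_sum /= => nz j.
have [i bi] : exists i, (b i)@_m != 0.
  apply/existsP; apply: contraT => /existsPn z; case/eqP: nz; apply: big1 => i _.
  by rewrite mcoeffZ; have := z i; rewrite negbK => /eqP ->; rewrite mulr0.
exact: bb bi j.
Qed.

Lemma joint_weight_ext (K : fieldType) N (q t : K) z z' (g : {mpoly K[N]}) :
  (forall i, (i < N)%N -> z i = z' i) ->
  joint_weight q t z g -> joint_weight q t z' g.
Proof. by move=> e H i lti; rewrite -e //; apply: H. Qed.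

Section Isotype.
Variables (K : fieldType) (m n N' : nat) (q t : K).
Local Notation N := N'.+1.
Local Notation P := {mpoly K[N]}.
Hypotheses (m_gt0 : (0 < m)%N) (n_gt1 : (1 < n)%N).
Hypothesis char0 : forall n : nat, n.+1%:R != 0 :> K.
Hypotheses (q_neq0 : q != 0) (t_neq0 : t != 0).
Hypothesis qt1 : q ^+ m * t ^+ n = 1.
Hypothesis relation : forall (a : nat) (b : int), q ^+ a * t ^ b = 1 ->
  exists l : nat, a = (m * l)%N /\ b = (n * l)%N%:Z.
Variable p : P.
Hypothesis p_singular : singular q t p.
Hypothesis p0 : p@_0%MM = 0.
Variable M : P -> Prop.
Hypothesis M_irreducible : hecke_irreducible t M.
Hypothesis M_sub : forall f, M f -> hecke_orbit t p f.
Variable tau : seq nat.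
Hypothesis tau_partition : is_partition N tau.
Hypothesis M_isotype : has_isotype t tau M.

(** [module_exponents] applies to M, spanned by the joint eigenvectors that
    the tableaux index. If k 0 were 0 then all elements of M would be
    constants, against [orbit_coef0]. *)
Lemma isotype_tableau : exists (Y : rsyt N tau) (k : nat -> nat),
  [/\ forall i : 'I_N, content i Y + (n * k i)%N%:Z = (N' - i)%N%:Z,
      forall i, (i.+1 < N)%N -> (k i.+1 <= k i)%N, (0 < k 0)%N &
      forall N2, (N2 <= N)%N -> exists2 g : {mpoly K[N2]}, g != 0 &
        joint_weight q t (fun i => t ^ content (inord (N - N2 + i)) Y) g].
Proof.
have [[M0 MD MZ MH] [f0 Mf0 f0_neq0] _] := M_irreducible.
have [b [Mb _ span bw]] := M_isotype.
have orb i f : (i < N)%N -> M f -> xin q t i f = omn t i f.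
  by move=> lti Mf; apply: (singular_orbit t_neq0 p_singular (M_sub Mf)).
pose z (Y : rsyt N tau) i := t ^ content (inord i) Y.
pose W z' := exists Y, z' = z Y.
pose B := (\max_Y msize (b Y)).+1.
have bB Y : exponents_below B (b Y).
  move=> x xb i; have /msize_mdeg_lt lt : x \in msupp (b Y) by rewrite mcoeff_msupp.
  apply: leq_trans (leq_trans lt _); last first.
    by rewrite /B; apply: leqW; apply: (leq_bigmax (F := fun Y => msize (b Y))).
  by rewrite ltnS mdegE (bigD1 i) //= leq_addr.
have weights Y c : joint_weight q t (z Y) (c *: b Y).
  move=> i lti; rewrite orb //; last exact: MZ.
  suff -> : omn t i (c *: b Y) = z Y i *: (c *: b Y) by [].
  rewrite -orb //; last exact: MZ.
  rewrite xinZ // orb // -[i in omn t i]/(val (Ordinal lti)) -omegaE // bw.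
  rewrite scalerA mulrC -scalerA; congr (t ^ content _ Y *: _).
  by apply: val_inj; rewrite /= inordK.
have [|||||z' [E [[Y ->] zE Emono /(_ isT)[_ small] trunc]]] :=
  @module_exponents K q t t_neq0 N B M W f0.
- by move=> f Mf j ltj; rewrite (TnE t (Ordinal (ltnW ltj))); apply: MH => //; apply: hecke_T.
- exact: Mf0.
- exact/eqP.
- by move=> f /span[a ->]; apply: exponents_below_sum.
- move=> f /span[a ->]; exists [seq a Y *: b Y | Y <- index_enum (rsyt N tau)].
    by rewrite big_map.
  move=> g /mapP[Y _ ->]; split; first exact: MZ.
  by exists (z Y); [exists Y | apply: weights].
(* Comparing the two expressions of the weight gives a relation q^a t^b = 1. *)
pose k i := (E i %/ m)%N.
have kE i : (i < N)%N -> E i = (m * k i)%N /\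
    content (inord i) Y + (n * k i)%N%:Z = (N' - i)%N%:Z.
  move=> lti; have [|l [El cl]] := @relation (E i) ((N' - i)%N%:Z - content (inord i) Y).
    rewrite expfzDr // mulrA [q ^+ _ * _](esym (zE i lti)) /z -expfzDr //.
    by rewrite subrr expr0z.
  by rewrite /k El mulKn //; split=> //; lia.
exists Y, k; split.
- by move=> i; have [_] := kE i (ltn_ord i); rewrite inord_val.
- by move=> i lti; apply: leq_div2r; apply: Emono.
- rewrite lt0n; apply/eqP => k0; have [E0 _] := kE 0%N isT.
  have f00 := orbit_coef0 p0 (M_sub Mf0).
  case: f0_neq0; apply/mpolyP => x; rewrite mcoeff0; apply/eqP; apply: contraT => nz.
  have x0 : x = 0%MM.
    apply/mnmP => i; rewrite mnm0E; have := small f0 Mf0 x nz i.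
    by rewrite E0 k0 muln0 ltnS leqn0 => /eqP.
  by rewrite x0 f00 eqxx in nz.
- move=> N2 leN2; have [g g0 gw] := trunc N2 leN2.
  by exists g => //; apply: joint_weight_ext gw.
Qed.

(** If d_2 were at least 2, the second row would have at least n cells. The
    truncation to the variables of the first row and of the first n cells of
    the second has the weights excluded by [no_rectangular_eigenvector]. *)
Lemma isotype_shape :
  (exists ds r, nd_expression n tau ds r) /\
  (forall ds r, nd_expression n tau ds r ->
     forall i, (1 <= i < size ds)%N -> nth 0%N ds i = 1%N).
Proof.
have [Y [k [cont kmono k0 trunc]]] := isotype_tableau.
have n_gt0 := ltnW n_gt1.
have [tau1 dv row0 row1] := rsyt_row_reading n_gt0 tau_partition cont kmono k0.
have /andP[tau_sorted /eqP tau_sum] := tau_partition.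
split; first exact: nd_expression_exists.
move=> ds r [_ sds dpos _ shape] i /andP[i1 lti].
apply/eqP; rewrite eqn_leq (all_nthP 0%N dpos) // andbT leqNgt; apply/negP => di.
have d1 : (1 < nth 0%N ds 1)%N by apply: leq_trans di (partition_mono sds i1).
have d0 : (0 < nth 0%N ds 0)%N by apply: (all_nthP 0%N dpos); apply: leq_ltn_trans lti.
have shapeE j : (j < size ds)%N -> nth 0%N tau j = (n * nth 0%N ds j - 1)%N.
  by move=> ltj; rewrite shape nth_rcons size_map ltj (nth_map 0%N).
have t0 := shapeE 0%N (leq_ltn_trans (leq0n _) lti).
have t1 := shapeE 1%N (leq_ltn_trans i1 lti).
set d := nth 0%N ds 0 in d0 t0.
have nd : (n <= n * d)%N by rewrite leq_pmulr.
have le_t1 : (n <= nth 0%N tau 1)%N.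
  have : (n * 2 <= n * nth 0%N ds 1)%N by rewrite leq_mul2l d1 orbT.
  by rewrite t1; lia.
(* The variable of index i in the truncation belongs to the cell of rank
   N2 - 1 - i: those with n <= i form the first row. *)
pose N2 := (n * d + n - 1)%N.
have leN2 : (N2 <= N)%N.
  have : (nth 0 tau 0 + nth 0 tau 1 <= N)%N.
    by have := sum_nth_le tau 2; rewrite tau_sum !big_ord_recl big_ord0 addn0.
  by rewrite t0 /N2; lia.
have N2E : N2.-1.+1 = N2 by rewrite /N2; lia.
have [g g0 gw] := trunc N2.-1.+1 (eq_ind_r (fun x => (x <= N)%N) leN2 N2E).
apply: (no_rectangular_eigenvector m_gt0 n_gt1 d0 N2E char0 q_neq0 t_neq0 qt1
  relation g0).
apply: joint_weight_ext gw => j; rewrite N2E => ltj.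
have qM : q ^+ (m * d) = t ^ (- (n * d)%N%:Z).
  rewrite -exprnN -div1r; apply: (canRL (mulfK _)); first by rewrite expf_neq0.
  by rewrite !exprM -exprMn qt1 expr1n.
have val_j : (inord (N - N2 + j) : 'I_N) = (N - N2 + j)%N :> nat by rewrite inordK //; lia.
rewrite /rank_weight; case: ltnP => [ltn|len].
  rewrite (row1 _ (n - j.+1)%N); rewrite ?val_j; try lia.
  rewrite qM exprnP -expfzDr //; congr (t ^ _); lia.
by rewrite row0 ?val_j ?mul1r ?exprnP; [congr (t ^ _)|]; lia.
Qed.

End Isotype.

Theorem mainTheorem1 (R : realType) (m n N : nat)
    (hm : (1 <= m)%N) (hn : (2 <= n)%N) (hN : (n <= N)%N)
    (* E is a common subfield of the complex numbers and of K containing q, t *)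
    (E K : fieldType) (iC : {rmorphism E -> R[i]}) (iK : {rmorphism E -> K})
    (q t : E) (hqt : singular_parameter m n (iC q) (iC t))
    (p : {mpoly K[N]})
    (p_homogeneous : exists d : nat, p \is d.-homog)
    (p_nonconstant : forall c : K, p <> c%:MP)
    (p_singular : singular (iK q) (iK t) p)
    (M : {mpoly K[N]} -> Prop)
    (M_irreducible : hecke_irreducible (iK t) M)
    (M_sub : forall f : {mpoly K[N]}, M f -> hecke_orbit (iK t) p f)
    (tau : seq nat) (tau_partition : is_partition N tau)
    (M_isotype : has_isotype (iK t) tau M) :
  [/\ (exists (ds : seq nat) (r : nat), nd_expression n tau ds r),
      (forall (ds : seq nat) (r : nat), nd_expression n tau ds r ->
         forall i : nat, (1 <= i < size ds)%N -> nth 0%N ds i = 1%N)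
    & (exists d L r : nat,
         [/\ (1 <= d)%N, (1 <= L)%N
           & same_shape tau
               ((n * d - 1)%N :: rcons (nseq (L - 1) (n - 1)%N) r)])].
Proof.
have n_gt0 := ltnW hn; have N_gt0 := leq_trans n_gt0 hN.
have [q0 t0 qt1 rel] := singular_parameterP hm n_gt0 hqt.
have E0 (x : E) : (iC x == 0) = (x == 0) by rewrite fmorph_eq0.
have q_neq0 : iK q != 0 by rewrite fmorph_eq0 -E0.
have t_neq0 : iK t != 0 by rewrite fmorph_eq0 -E0.
have char0 e : e.+1%:R != 0 :> K.
  by rewrite -(rmorph_nat iK) fmorph_eq0 -E0 rmorph_nat pnatr_eq0.
have qt1' : iK q ^+ m * iK t ^+ n = 1.
  rewrite -!rmorphXn -rmorphM -(rmorph1 iK); congr (iK _).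
  by apply: (fmorph_inj iC); rewrite rmorphM !rmorphXn rmorph1.
have rel' (a : nat) (b : int) : iK q ^+ a * iK t ^ b = 1 ->
    exists l : nat, a = (m * l)%N /\ b = (n * l)%N%:Z.
  rewrite -rmorphXn -fmorphXz -rmorphM -(rmorph1 iK) => /fmorph_inj e.
  by apply: rel; rewrite -rmorphXn -fmorphXz -rmorphM e rmorph1.
have [D p_hom] := p_homogeneous.
have p0 := homogeneous_coef0 p_hom p_nonconstant.
case: N N_gt0 {hN p_homogeneous p_hom p_nonconstant} p p_singular p0 M M_irreducible
  M_sub tau_partition M_isotype => [//|N'] _ p p_singular p0 M M_irr M_sub tau_part M_iso.
have [ex ones] := isotype_shape hm hn char0 q_neq0 t_neq0 qt1' rel'
  p_singular p0 M_irr M_sub tau_part M_iso.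
split=> //; have [ds [r nd]] := ex.
exact: nd_expression_shape nd (ones ds r nd).
Qed.
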